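(* Let $n\ge1$. There is a one-to-one correspondence between Lévy processes on $S_n^+$ (up to equivalence) and equivalence classes of tuples $(\rho;\xi_1,\ldots,\xi_n)$ consisting of a representation $\rho$ of $\mathrm{Pol}(S_n^+)$ on some Hilbert space $\mathsf{h}$ and vectors $\xi_1,\ldots,\xi_n\in\mathsf{h}$ satisfying $$\rho(p_{ii})\xi_i=0\quad\text{and}\quad\rho(p_{ij})\xi_i=\rho(p_{ij})\xi_j\quad\text{for all } i,j=1,\ldots,n,$$ and such that the associated cocycle (the unique $\rho$-$\varepsilon$-cocycle $\eta$ with $\eta(p_{ii})=\xi_i$ for all $i$) has dense range in $\mathsf{h}$. The correspondence assigns to a Lévy process with Schürmann triple $(\rho,\eta,L)$ (with $\eta$ of dense range) the class of $(\rho;\eta(p_{11}),\ldots,\eta(p_{nn}))$.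
   Context: $\mathrm{Pol}(S_n^+)$ is the universal unital $*$-algebra generated by $p_{ij}$ ($1\le i,j\le n$) subject to $p_{ij}=p_{ij}^*=p_{ij}^2$, $p_{ij}p_{ik}=0=p_{ji}p_{ki}$ for $j\ne k$, and $\sum_j p_{ij}=\sum_j p_{ji}=1$ for all $i$; it is a Hopf $*$-algebra with $\Delta(p_{ij})=\sum_k p_{ik}\otimes p_{kj}$ and counit $\varepsilon(p_{ij})=\delta_{ij}$. For functionals, $\mu\star\nu=(\mu\otimes\nu)\circ\Delta$. A Lévy process on $S_n^+$ is a family $(j_{s,t})_{0\le s\le t}$ of unital $*$-homomorphisms $j_{s,t}:\mathrm{Pol}(S_n^+)\to\mathcal{B}$, where $\mathcal{B}$ is a unital $*$-algebra with a state $\Phi$, such that the functionals $\omega_{s,t}=\Phi\circ j_{s,t}$ satisfy: $\omega_{r,t}=\omega_{r,s}\star\omega_{s,t}$ for $r\le s\le t$; $\omega_{t,t}=\varepsilon$; $\omega_{s,t}=\omega_{0,t-s}$; $\Phi(\prod_{i=1}^m j_{s_i,t_i}(a_i))=\prod_{i=1}^m\omega_{s_i,t_i}(a_i)$ for all $m$, all $a_i$ and all pairwise disjoint intervals $[s_i,t_i)$; and $\omega_{0,t}(a)\to\varepsilon(a)$ as $t\to0^+$ for all $a$. Its convolution semigroup is $(\omega_t)_{t\ge0}=(\omega_{0,t})_{t\ge0}$, and its generating functional is $L(a)=\lim_{t\to0^+}(\omega_t(a)-\varepsilon(a))/t$. Two Lévy processes are equivalent if they have the same convolution semigroup. A representation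 on a Hilbert space $\mathsf{h}$ is a unital $*$-homomorphism $\rho:\mathrm{Pol}(S_n^+)\to B(\mathsf{h})$; a $\rho$-$\varepsilon$-cocycle is a linear map $\eta:\mathrm{Pol}(S_n^+)\to\mathsf{h}$ with $\eta(ab)=\rho(a)\eta(b)+\eta(a)\varepsilon(b)$; $(\rho,\eta,L)$ is a Schürmann triple if moreover $L$ is hermitian and $L(a^*b)=\langle\eta(a),\eta(b)\rangle+\varepsilon(a^* )L(b)+L(a^* )\varepsilon(b)$ (inner product linear in the second argument). The Schürmann triple of a Lévy process is the one (unique up to unitary equivalence) containing its generating functional $L$ and with $\eta$ of dense range. Tuples $(\rho;\xi_1,\ldots,\xi_n)$ on $\mathsf{h}$ and $(\rho';\xi_1',\ldots,\xi_n')$ on $\mathsf{h}'$ are equivalent if there is a unitary $V:\mathsf{h}\to\mathsf{h}'$ with $V\rho(a)=\rho'(a)V$ for all $a$ and $\xi_i'=V\xi_i$ for all $i$. *)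

(* Defs.v *)
From HB Require Import structures.
From mathcomp Require Import all_boot all_order all_algebra.
From mathcomp Require Import boolp classical_sets functions reals topology normedtype.
From mathcomp Require Import sesquilinear complex.

Set Implicit Arguments.
Unset Strict Implicit.
Unset Printing Implicit Defensive.

Import Order.TTheory GRing.Theory Num.Theory numFieldNormedType.Exports.
Local Open Scope classical_set_scope.
Local Open Scope ring_scope.

HB.mixin Record isStarAlgebra (C : numClosedFieldType) A
    of GRing.Algebra C A := {
  star : A -> A;
  starK : involutive star;
  starD : {morph star : a b / a + b};
  starM : forall a b : A, star (a * b) = star b * star a;
  starZ : forall (c : C) (a : A), star (c *: a) = c^* *: star a
}.

#[short(type="starAlgType")]
HB.structure Definition StarAlgebra (C : numClosedFieldType) :=
  {A of GRing.Algebra C A & isStarAlgebra C A}.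

HB.mixin Record isStarMorphism (C : numClosedFieldType) (A B : starAlgType C)
    (f : A -> B) := {
  star_morph : forall a, f (star a) = star (f a)
}.

#[short(type="starMorphism")]
HB.structure Definition StarMorphism (C : numClosedFieldType)
    (A B : starAlgType C) :=
  {f of @GRing.LRMorphism C A B *:%R f & isStarMorphism C A B f}.

Section StarAlgebraTheory.
Variables (C : numClosedFieldType) (A : starAlgType C).

Lemma star0 : star (0 : A) = 0.
Proof. by rewrite -(scale0r (0 : A)) starZ conjC0 !scale0r. Qed.

Lemma star1 : star (1 : A) = 1.
Proof. by rewrite -[LHS](mulr1) -{2}[1]starK -starM mulr1 starK. Qed.

Lemma star_sum I (r : seq I) (P : pred I) (F : I -> A) :
  star (\sum_(i <- r | P i) F i) = \sum_(i <- r | P i) star (F i).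
Proof. exact: (big_morph _ (@starD C A) star0). Qed.

End StarAlgebraTheory.

Section ScalarStarAlgebra.
Variable C : numClosedFieldType.
Implicit Types a b : C^o.

Let scal_D : {morph (Num.conj : C^o -> C^o) : a b / a + b}.
Proof. exact: rmorphD. Qed.
Let scal_M a b : Num.conj (a * b : C) = Num.conj (b : C) * Num.conj (a : C).
Proof. by rewrite rmorphM mulrC. Qed.
Let scal_Z (c : C) a :
  Num.conj (c *: a : C) = c^* *: (Num.conj (a : C) : C^o).
Proof. exact: rmorphM. Qed.

HB.instance Definition _ := isStarAlgebra.Build C C^o
  (@conjCK C) scal_D scal_M scal_Z.

End ScalarStarAlgebra.

(* The algebraic tensor product of A and B, realized as the span of the
   evaluations a (x) b : beta |-> beta a b in the dual of the space of bilinear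
   forms on A * B; two formal sums of pure tensors agree iff all bilinear forms
   agree on them. *)
Section Tensor.
Variables (C : numClosedFieldType) (A B : starAlgType C).

Definition bilform := {bilinear A -> B -> C | *%R & *%R}.

Definition eval_at (a : A) (b : B) : bilform -> C^o := fun beta => beta a b.

Definition finite_tensor : {pred bilform -> C^o} :=
  [pred f | `[< exists s : seq (A * B), f = \sum_(x <- s) eval_at x.1 x.2 >]].

Record tensor := Tensor {
  tensor_val :> bilform -> C^o;
  tensor_valP : tensor_val \in finite_tensor }.

HB.instance Definition _ := [isSub for tensor_val].
HB.instance Definition _ := gen_eqMixin tensor.
HB.instance Definition _ := gen_choiceMixin tensor.

Let eval_scale (c : C) a b : eval_at (c *: a) b = c *: eval_at a b.
Proof. by apply/funext => beta; rewrite /eval_at linearZl_LR. Qed.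

Fact finite_tensor_submod : submod_closed finite_tensor.
Proof.
split; first by apply/asboolP; exists [::]; rewrite big_nil.
move=> c f g /asboolP[s ->] /asboolP[t ->]; apply/asboolP.
exists ([seq (c *: x.1, x.2) | x <- s] ++ t).
rewrite big_cat big_map /= scaler_sumr; congr (_ + _).
by apply: eq_bigr => x _; rewrite eval_scale.
Qed.

HB.instance Definition _ := GRing.isSubmodClosed.Build C (bilform -> C^o)
  finite_tensor finite_tensor_submod.
HB.instance Definition _ := [SubChoice_isSubLmodule of tensor by <:].

Lemma tensor_inj (f g : tensor) : (forall beta, f beta = g beta) -> f = g.
Proof. by move=> fg; apply/val_inj/funext. Qed.

Lemma tensor_sum (f : tensor) : exists s : seq (A * B),
  forall beta, f beta = \sum_(x <- s) beta x.1 x.2.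
Proof.
have /asboolP[s fE] := tensor_valP f; exists s => beta; rewrite fE.
exact: (big_morph (fun h : bilform -> C^o => h beta)).
Qed.

Lemma tensor_eq (f : tensor) (beta gamma : bilform) :
  (forall a b, beta a b = gamma a b) -> f beta = f gamma.
Proof.
move=> bg; have [s fE] := tensor_sum f; rewrite !fE.
by apply: eq_bigr => x _; rewrite bg.
Qed.

Lemma tensor_linear (f : tensor) (c : C) (beta gamma delta : bilform) :
  (forall a b, delta a b = c * beta a b + gamma a b) ->
  f delta = c * f beta + f gamma.
Proof.
move=> dE; have [s fE] := tensor_sum f; rewrite !fE mulr_sumr -big_split.
by apply: eq_bigr => x _; rewrite dE.
Qed.

Fact pure_subproof a b : eval_at a b \in finite_tensor.
Proof. by apply/asboolP; exists [:: (a, b)]; rewrite big_seq1. Qed.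

Definition pure (a : A) (b : B) : tensor := Tensor (pure_subproof a b).

Section Shift.
Variables (beta : bilform) (a : A) (b : B).
Definition shift_fun (c : A) (d : B) : C := beta (a * c) (b * d).

Fact shift_bilinear : bilinear_for
  (GRing.Scale.Law.clone _ _ *%R _) (GRing.Scale.Law.clone _ _ *%R _) shift_fun.
Proof.
split=> u c x y; rewrite /shift_fun.
  by rewrite mulrDr -scalerAr linearPl.
by rewrite mulrDr -scalerAr linearPr.
Qed.

HB.instance Definition _ :=
  bilinear_isBilinear.Build C A B C _ _ shift_fun shift_bilinear.

Definition shift : bilform := shift_fun.
End Shift.

Section Contract.
Variables (g : tensor) (beta : bilform).
Definition contract_fun (a : A) (b : B) : C := g (shift beta a b).

Fact contract_bilinear : bilinear_for
  (GRing.Scale.Law.clone _ _ *%R _) (GRing.Scale.Law.clone _ _ *%R _)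
  contract_fun.
Proof.
split=> u c x y; apply: tensor_linear => a b /=; rewrite /shift_fun.
  by rewrite mulrDl -scalerAl linearPl.
by rewrite mulrDl -scalerAl linearPr.
Qed.

HB.instance Definition _ :=
  bilinear_isBilinear.Build C A B C _ _ contract_fun contract_bilinear.

Definition contract : bilform := contract_fun.
End Contract.

Fact tensor_mul_subproof (f g : tensor) :
  (fun beta => f (contract g beta)) \in finite_tensor.
Proof.
have [s fE] := tensor_sum f; have [t gE] := tensor_sum g; apply/asboolP.
exists [seq (x.1 * y.1, x.2 * y.2) | x <- s, y <- t]; apply/funext => beta.
rewrite fct_sumE.
rewrite big_allpairs_dep fE; apply: eq_bigr => x _ /=.
by rewrite /contract_fun gE.
Qed.

Definition tensor_one : tensor := pure 1 1.
(* (a (x) b) * (c (x) d) = (a * c) (x) (b * d) *)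
Definition tensor_mul (f g : tensor) : tensor := Tensor (tensor_mul_subproof f g).

Fact tensor_mulA : associative tensor_mul.
Proof.
move=> f g h; apply: tensor_inj => beta /=; apply: tensor_eq => a b /=.
rewrite /contract_fun; apply: tensor_eq => c d /=.
rewrite /contract_fun; apply: tensor_eq => a' b' /=.
by rewrite /shift_fun /= /shift_fun !mulrA.
Qed.

Fact tensor_mul1 : left_id tensor_one tensor_mul.
Proof.
move=> f; apply: tensor_inj => beta /=; apply: tensor_eq => a b /=.
by rewrite /shift_fun !mul1r.
Qed.

Fact tensor_1mul : right_id tensor_one tensor_mul.
Proof.
move=> f; apply: tensor_inj => beta /=; apply: tensor_eq => a b /=.
by rewrite /contract_fun/= /eval_at/= /shift_fun !mulr1.
Qed.

Fact tensor_mulDl : left_distributive tensor_mul +%R.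
Proof. by move=> f g h; apply: tensor_inj. Qed.

Fact tensor_mulDr : right_distributive tensor_mul +%R.
Proof.
move=> f g h; apply: tensor_inj => beta.
rewrite /= -[RHS]/(f (contract g beta) + f (contract h beta)).
rewrite -[f (contract g beta)]mul1r; apply: tensor_linear => a b.
by rewrite mul1r.
Qed.

HB.instance Definition _ := GRing.Zmodule_isPzRing.Build tensor
  tensor_mulA tensor_mul1 tensor_1mul tensor_mulDl tensor_mulDr.

Section Conj.
Variable beta : bilform.
Definition conj_fun (a : A) (b : B) : C := (beta (star a) (star b))^*.

Fact conj_bilinear : bilinear_for
  (GRing.Scale.Law.clone _ _ *%R _) (GRing.Scale.Law.clone _ _ *%R _)
  conj_fun.
Proof.
split=> u c x y; rewrite /conj_fun starD starZ.
  by rewrite linearPl rmorphD rmorphM/= conjCK.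
by rewrite linearPr rmorphD rmorphM/= conjCK.
Qed.

HB.instance Definition _ :=
  bilinear_isBilinear.Build C A B C _ _ conj_fun conj_bilinear.

Definition conj_form : bilform := conj_fun.
End Conj.

Fact tensor_star_subproof (f : tensor) :
  (fun beta => (f (conj_form beta) : C)^* : C^o) \in finite_tensor.
Proof.
have [s fE] := tensor_sum f; apply/asboolP.
exists [seq (star x.1, star x.2) | x <- s]; apply/funext => beta.
rewrite fct_sumE.
rewrite big_map fE rmorph_sum; apply: eq_bigr => x _ /=.
by rewrite /conj_fun conjCK.
Qed.

(* star (a (x) b) = star a (x) star b *)
Definition tensor_star (f : tensor) : tensor := Tensor (tensor_star_subproof f).

Fact tensor_starK : involutive tensor_star.
Proof.
move=> f; apply: tensor_inj => beta /=; rewrite conjCK.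
by apply: tensor_eq => a b /=; rewrite /conj_fun/= /conj_fun !starK conjCK.
Qed.

Fact tensor_starD : {morph tensor_star : f g / f + g}.
Proof. by move=> f g; apply: tensor_inj => beta; apply: rmorphD. Qed.

Fact tensor_starM f g : tensor_star (f * g) = tensor_star g * tensor_star f.
Proof.
apply: tensor_inj => beta /=.
have [s fE] := tensor_sum f; have [t gE] := tensor_sum g.
rewrite fE rmorph_sum gE rmorph_sum.
under eq_bigr => x _ do rewrite /= /contract_fun gE rmorph_sum.
rewrite exchange_big; apply: eq_bigr => y _ /=.
rewrite /conj_fun/= /contract_fun/= fE rmorph_sum conjCK.
apply: eq_bigr => x _ /=.
by rewrite /shift_fun/= /conj_fun !starM conjCK.
Qed.

Fact tensor_starZ (c : C) f : tensor_star (c *: f) = c^* *: tensor_star f.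
Proof. by apply: tensor_inj => beta; apply: rmorphM. Qed.

Fact tensor_scaleAl (c : C) (f g : tensor) : c *: (f * g) = (c *: f) * g.
Proof. exact: tensor_inj. Qed.

Fact tensor_scaleAr (c : C) (f g : tensor) : c *: (f * g) = f * (c *: g).
Proof.
apply: tensor_inj => beta /=; rewrite -[LHS]/(c * f (contract g beta)).
have [s fE] := tensor_sum f; rewrite !fE mulr_sumr.
exact: eq_bigr.
Qed.

Lemma pureM a b c d : pure a b * pure c d = pure (a * c) (b * d).
Proof. by apply: tensor_inj. Qed.

Lemma star_pure a b : tensor_star (pure a b) = pure (star a) (star b).
Proof.
by apply: tensor_inj => beta; rewrite /= /eval_at /= /conj_fun conjCK.
Qed.

Fact pure_bilinear : bilinear_for
  (GRing.Scale.Law.clone _ _ *:%R _) (GRing.Scale.Law.clone _ _ *:%R _) pure.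
Proof.
split=> u c x y; apply: tensor_inj => beta; rewrite /= /eval_at.
  by rewrite linearPl.
by rewrite linearPr.
Qed.

HB.instance Definition _ :=
  bilinear_isBilinear.Build C A B tensor _ _ pure pure_bilinear.

Let pure_bil : {bilinear A -> B -> tensor | *:%R & *:%R} := pure.

Lemma pure0l b : pure 0 b = 0. Proof. exact: (linear0l pure_bil). Qed.
Lemma pure0r a : pure a 0 = 0. Proof. exact: (linear0r pure_bil). Qed.
Lemma pure_suml I (r : seq I) (P : pred I) (E : I -> A) b :
  pure (\sum_(i <- r | P i) E i) b = \sum_(i <- r | P i) pure (E i) b.
Proof. exact: (linear_sumlz pure_bil). Qed.
Lemma pure_sumr I (r : seq I) (P : pred I) (E : I -> B) a :
  pure a (\sum_(i <- r | P i) E i) = \sum_(i <- r | P i) pure a (E i).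
Proof. exact: (linear_sumr pure_bil). Qed.

Section Functional.
Variables (mu : {linear A -> C^o}) (nu : {linear B -> C^o}).
Definition product_fun (a : A) (b : B) : C := mu a * nu b.

Fact product_bilinear : bilinear_for
  (GRing.Scale.Law.clone _ _ *%R _) (GRing.Scale.Law.clone _ _ *%R _)
  product_fun.
Proof.
split=> u c x y; rewrite /product_fun linearP.
  by rewrite mulrDl -mulrA.
by rewrite mulrDr mulrCA.
Qed.

HB.instance Definition _ :=
  bilinear_isBilinear.Build C A B C _ _ product_fun product_bilinear.

(* mu (x) nu : A (x) B -> C *)
Definition tensor_functional (f : tensor) : C^o := f product_fun.

Lemma tensor_functional_pure a b : tensor_functional (pure a b) = mu a * nu b.
Proof. by []. Qed.
End Functional.

End Tensor.

Section Magic.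
Variables (C : numClosedFieldType) (n : nat).

Record magic_unitary (A : starAlgType C) (q : 'I_n -> 'I_n -> A) : Prop := {
  magic_star : forall i j, star (q i j) = q i j;
  magic_idem : forall i j, q i j * q i j = q i j;
  magic_row0 : forall i j k, j != k -> q i j * q i k = 0;
  magic_col0 : forall i j k, j != k -> q j i * q k i = 0;
  magic_row1 : forall i, \sum_j q i j = 1;
  magic_col1 : forall i, \sum_j q j i = 1 }.

Lemma magic_id : magic_unitary (fun i j : 'I_n => (i == j)%:R : C^o).
Proof.
split=> [i j|i j|i j k|i j k|i|i].
- exact: conjC_nat.
- by case: eqP; rewrite ?mulr1 ?mulr0.
- by case: (i =P j) => [->|]; rewrite ?mul0r// => /negPf ->; rewrite mulr0.
- by case: (j =P i) => [->|]; rewrite ?mul0r// eq_sym => /negPf ->; rewrite mulr0.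
- by rewrite (bigD1 i)//= eqxx big1 ?addr0// => j; rewrite eq_sym => /negPf ->.
- by rewrite (bigD1 i)//= eqxx big1 ?addr0// => j /negPf ->.
Qed.

End Magic.

(* Pol(S_n^+): *-polynomial expressions in n^2 indeterminates, two of them being
   identified when they take the same value at every magic unitary of every
   unital *-algebra (algType only covers nonzero algebras, but the zero algebra
   imposes no condition). The universal property is pol_hom, pol_hom_gen and
   pol_hom_unique. *)
Section Pol.
Variables (C : numClosedFieldType) (n : nat).

Inductive pol_expr :=
| ExprGen of 'I_n & 'I_n
| ExprZero
| ExprOne
| ExprAdd of pol_expr & pol_expr
| ExprMul of pol_expr & pol_expr
| ExprScale of C & pol_expr
| ExprStar of pol_expr.

HB.instance Definition _ := gen_eqMixin pol_expr.
HB.instance Definition _ := gen_choiceMixin pol_expr.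

Fixpoint expr_eval (A : starAlgType C) (q : 'I_n -> 'I_n -> A) (t : pol_expr) : A :=
  match t with
  | ExprGen i j => q i j
  | ExprZero => 0
  | ExprOne => 1
  | ExprAdd t u => expr_eval q t + expr_eval q u
  | ExprMul t u => expr_eval q t * expr_eval q u
  | ExprScale c t => c *: expr_eval q t
  | ExprStar t => star (expr_eval q t)
  end.

Definition expr_eq : rel pol_expr := fun t u =>
  `[< forall (A : starAlgType C) (q : 'I_n -> 'I_n -> A),
        magic_unitary q -> expr_eval q t = expr_eval q u >].

Fact expr_eq_equiv : equiv_class_of expr_eq.
Proof.
split=> [t|t u|t u v].
- exact/asboolP.
- by apply/asboolP/asboolP => h A q /h.
- by move=> /asboolP tu /asboolP uv; apply/asboolP => A q qP; rewrite tu ?uv.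
Qed.

Canonical expr_equiv := EquivRelPack expr_eq_equiv.

Definition Pol := {eq_quot expr_eq}%qT.
HB.instance Definition _ := Choice.on Pol.
HB.instance Definition _ := EqQuotient.on Pol.

Definition pol_lift (A : starAlgType C) (q : 'I_n -> 'I_n -> A) (a : Pol) : A :=
  expr_eval q (repr a).

Lemma pol_lift_pi (A : starAlgType C) (q : 'I_n -> 'I_n -> A) (t : pol_expr) :
  magic_unitary q -> pol_lift q (\pi_Pol t)%qT = expr_eval q t.
Proof.
move=> qP; rewrite /pol_lift.
by case: piP => u /eqmodP/asboolP/(_ A q qP).
Qed.

Lemma pol_eqP (a b : Pol) :
  (forall (A : starAlgType C) (q : 'I_n -> 'I_n -> A),
     magic_unitary q -> pol_lift q a = pol_lift q b) -> a = b.
Proof. by move=> ab; rewrite -[a]reprK -[b]reprK; apply/eqmodP/asboolP. Qed.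

Definition pol0 : Pol := (\pi_Pol ExprZero)%qT.
Definition pol1 : Pol := (\pi_Pol ExprOne)%qT.
Definition pol_add (a b : Pol) : Pol := (\pi_Pol (ExprAdd (repr a) (repr b)))%qT.
Definition pol_mul (a b : Pol) : Pol := (\pi_Pol (ExprMul (repr a) (repr b)))%qT.
Definition pol_scale (c : C) (a : Pol) : Pol := (\pi_Pol (ExprScale c (repr a)))%qT.
Definition pol_opp (a : Pol) : Pol := pol_scale (-1) a.
Definition pol_star (a : Pol) : Pol := (\pi_Pol (ExprStar (repr a)))%qT.

Section LiftE.
Variables (A : starAlgType C) (q : 'I_n -> 'I_n -> A) (qP : magic_unitary q).
Fact lift0 : pol_lift q pol0 = 0. Proof. exact: pol_lift_pi. Qed.
Fact lift1 : pol_lift q pol1 = 1. Proof. exact: pol_lift_pi. Qed.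
Fact liftD a b : pol_lift q (pol_add a b) = pol_lift q a + pol_lift q b.
Proof. exact: pol_lift_pi. Qed.
Fact liftM a b : pol_lift q (pol_mul a b) = pol_lift q a * pol_lift q b.
Proof. exact: pol_lift_pi. Qed.
Fact liftZ c a : pol_lift q (pol_scale c a) = c *: pol_lift q a.
Proof. exact: pol_lift_pi. Qed.
Fact liftN a : pol_lift q (pol_opp a) = - pol_lift q a.
Proof. by rewrite liftZ scaleN1r. Qed.
Fact lift_star a : pol_lift q (pol_star a) = star (pol_lift q a).
Proof. exact: pol_lift_pi. Qed.
Definition liftE := (lift0, lift1, liftD, liftM, liftN, liftZ, lift_star).
End LiftE.

Fact pol_addA : associative pol_add.
Proof. by move=> a b c; apply: pol_eqP => A q qP; rewrite !liftE// addrA. Qed.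
Fact pol_addC : commutative pol_add.
Proof. by move=> a b; apply: pol_eqP => A q qP; rewrite !liftE// addrC. Qed.
Fact pol_add0 : left_id pol0 pol_add.
Proof. by move=> a; apply: pol_eqP => A q qP; rewrite !liftE// add0r. Qed.
Fact pol_addN : left_inverse pol0 pol_opp pol_add.
Proof. by move=> a; apply: pol_eqP => A q qP; rewrite !liftE// addNr. Qed.

HB.instance Definition _ :=
  GRing.isZmodule.Build Pol pol_addA pol_addC pol_add0 pol_addN.

Fact pol_mulA : associative pol_mul.
Proof. by move=> a b c; apply: pol_eqP => A q qP; rewrite !liftE// mulrA. Qed.
Fact pol_mul1 : left_id pol1 pol_mul.
Proof. by move=> a; apply: pol_eqP => A q qP; rewrite !liftE// mul1r. Qed.
Fact pol_1mul : right_id pol1 pol_mul.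
Proof. by move=> a; apply: pol_eqP => A q qP; rewrite !liftE// mulr1. Qed.
Fact pol_mulDl : left_distributive pol_mul pol_add.
Proof. by move=> a b c; apply: pol_eqP => A q qP; rewrite !liftE// mulrDl. Qed.
Fact pol_mulDr : right_distributive pol_mul pol_add.
Proof. by move=> a b c; apply: pol_eqP => A q qP; rewrite !liftE// mulrDr. Qed.
Fact pol_1neq0 : pol1 != pol0.
Proof.
apply/eqP => /(congr1 (pol_lift (fun i j : 'I_n => (i == j)%:R : C^o))).
by rewrite lift1 ?lift0; try exact: magic_id; apply/eqP/oner_neq0.
Qed.

HB.instance Definition _ := GRing.Zmodule_isNzRing.Build Pol
  pol_mulA pol_mul1 pol_1mul pol_mulDl pol_mulDr pol_1neq0.

Fact pol_scaleA (c d : C) a : pol_scale c (pol_scale d a) = pol_scale (c * d) a.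
Proof. by apply: pol_eqP => A q qP; rewrite !liftE// scalerA. Qed.
Fact pol_scale1 : left_id 1 pol_scale.
Proof. by move=> a; apply: pol_eqP => A q qP; rewrite !liftE// scale1r. Qed.
Fact pol_scaleDr : right_distributive pol_scale +%R.
Proof. by move=> c a b; apply: pol_eqP => A q qP; rewrite !liftE// scalerDr. Qed.
Fact pol_scaleDl a : {morph pol_scale^~ a : c d / c + d}.
Proof. by move=> c d; apply: pol_eqP => A q qP; rewrite !liftE// scalerDl. Qed.

HB.instance Definition _ := GRing.Zmodule_isLmodule.Build C Pol
  pol_scaleA pol_scale1 pol_scaleDr pol_scaleDl.

Fact pol_scaleAl (c : C) (a b : Pol) : c *: (a * b) = (c *: a) * b.
Proof. by apply: pol_eqP => A q qP; rewrite !liftE// scalerAl. Qed.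
HB.instance Definition _ := GRing.Lmodule_isLalgebra.Build C Pol pol_scaleAl.
Fact pol_scaleAr (c : C) (a b : Pol) : c *: (a * b) = a * (c *: b).
Proof. by apply: pol_eqP => A q qP; rewrite !liftE// scalerAr. Qed.
HB.instance Definition _ := GRing.Lalgebra_isAlgebra.Build C Pol pol_scaleAr.

Fact pol_starK : involutive pol_star.
Proof. by move=> a; apply: pol_eqP => A q qP; rewrite !liftE// starK. Qed.
Fact pol_starD : {morph pol_star : a b / a + b}.
Proof. by move=> a b; apply: pol_eqP => A q qP; rewrite !liftE// starD. Qed.
Fact pol_starM (a b : Pol) : pol_star (a * b) = pol_star b * pol_star a.
Proof. by apply: pol_eqP => A q qP; rewrite !liftE// starM. Qed.
Fact pol_starZ (c : C) (a : Pol) : pol_star (c *: a) = c^* *: pol_star a.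
Proof. by apply: pol_eqP => A q qP; rewrite !liftE// starZ. Qed.

HB.instance Definition _ := isStarAlgebra.Build C Pol
  pol_starK pol_starD pol_starM pol_starZ.

Definition pgen (i j : 'I_n) : Pol := (\pi_Pol (ExprGen i j))%qT.

Lemma pol_lift_gen (A : starAlgType C) (q : 'I_n -> 'I_n -> A) :
  magic_unitary q -> forall i j, pol_lift q (pgen i j) = q i j.
Proof. by move=> qP i j; apply: pol_lift_pi. Qed.

Section Lift.
Variables (A : starAlgType C) (q : 'I_n -> 'I_n -> A) (qP : magic_unitary q).

Definition pol_hom_fun : Pol -> A := let _ := qP in pol_lift q.

Fact pol_hom_linear : linear pol_hom_fun.
Proof. by move=> c a b; rewrite -(liftZ qP) -(liftD qP). Qed.
Fact pol_hom_monoid : monoid_morphism pol_hom_fun.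
Proof. by split=> [|a b]; [apply: lift1 | apply: liftM]. Qed.

HB.instance Definition _ :=
  GRing.isLinear.Build C Pol A *:%R pol_hom_fun pol_hom_linear.
HB.instance Definition _ :=
  GRing.isMonoidMorphism.Build Pol A pol_hom_fun pol_hom_monoid.
HB.instance Definition _ :=
  isStarMorphism.Build C Pol A pol_hom_fun (lift_star qP).

Definition pol_hom : starMorphism Pol A := pol_hom_fun.

Lemma pol_hom_gen i j : pol_hom (pgen i j) = q i j.
Proof. exact: pol_lift_gen. Qed.
End Lift.

Lemma pgen_magic : magic_unitary pgen.
Proof.
have sumE (A : starAlgType C) (q : 'I_n -> 'I_n -> A) (qP : magic_unitary q)
    (F : 'I_n -> Pol) : pol_lift q (\sum_j F j) = \sum_j pol_lift q (F j).
  exact: (raddf_sum (pol_hom qP)).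
split=> [i j|i j|i j k jk|i j k jk|i|i]; apply: pol_eqP => A q qP.
- by rewrite lift_star// pol_lift_gen// magic_star.
- by rewrite liftM// pol_lift_gen// magic_idem.
- by rewrite liftM// !pol_lift_gen// lift0// magic_row0.
- by rewrite liftM// !pol_lift_gen// lift0// magic_col0.
- rewrite sumE// lift1// -(magic_row1 qP i).
  by apply: eq_bigr => j _; rewrite pol_lift_gen.
- rewrite sumE// lift1// -(magic_col1 qP i).
  by apply: eq_bigr => j _; rewrite pol_lift_gen.
Qed.

Lemma expr_eval_morph (A : starAlgType C) (f : starMorphism Pol A) (t : pol_expr) :
  f (\pi_Pol t)%qT = expr_eval (fun i j => f (pgen i j)) t.
Proof.
have piE u v : expr_eq u v -> (\pi_Pol u = \pi_Pol v)%qT by move=> /eqmodP.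
have reprE u : (forall (B : starAlgType C) (q : 'I_n -> 'I_n -> B),
    magic_unitary q -> expr_eval q (repr (\pi_Pol u)%qT) = expr_eval q u).
  by move=> B q qP; apply: pol_lift_pi.
elim: t => [i j|||t IHt u IHu|t IHt u IHu|c t IHt|t IHt] //=.
- exact: raddf0.
- exact: rmorph1.
- rewrite -IHt -IHu -raddfD; congr (f _).
  by apply: piE; apply/asboolP => B q qP; rewrite /= !reprE.
- rewrite -IHt -IHu -rmorphM; congr (f _).
  by apply: piE; apply/asboolP => B q qP; rewrite /= !reprE.
- rewrite -IHt -linearZ; congr (f _).
  by apply: piE; apply/asboolP => B q qP; rewrite /= !reprE.
- rewrite -IHt -star_morph; congr (f _).
  by apply: piE; apply/asboolP => B q qP; rewrite /= !reprE.
Qed.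

Lemma pol_hom_unique (A : starAlgType C) (f g : starMorphism Pol A) :
  (forall i j, f (pgen i j) = g (pgen i j)) -> f =1 g.
Proof.
move=> fg a; rewrite -[a]reprK !expr_eval_morph.
by elim: (repr a) => //= [t -> u ->|t -> u ->|c t ->|t ->].
Qed.

Definition counit : starMorphism Pol C^o := pol_hom (magic_id C n).

Local Notation PolPol := (tensor Pol Pol).

Fact polpol_1neq0 : (1 : PolPol) != 0.
Proof.
apply/eqP => /(congr1 (tensor_functional counit counit)).
rewrite tensor_functional_pure rmorph1 mulr1.
by apply/eqP/oner_neq0.
Qed.
HB.instance Definition _ := GRing.PzSemiRing_isNonZero.Build PolPol polpol_1neq0.
HB.instance Definition _ :=
  GRing.Lmodule_isLalgebra.Build C PolPol (@tensor_scaleAl C Pol Pol).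
HB.instance Definition _ :=
  GRing.Lalgebra_isAlgebra.Build C PolPol (@tensor_scaleAr C Pol Pol).
HB.instance Definition _ := isStarAlgebra.Build C PolPol
  (@tensor_starK C Pol Pol) (@tensor_starD C Pol Pol)
  (@tensor_starM C Pol Pol) (@tensor_starZ C Pol Pol).

Lemma star_purepol (a b : Pol) : star (pure a b : PolPol) = pure (star a) (star b).
Proof. exact: star_pure. Qed.

Definition comult_gen (i j : 'I_n) : PolPol :=
  \sum_k pure (pgen i k) (pgen k j).

Lemma comult_genM i j i' j' : comult_gen i j * comult_gen i' j' =
  \sum_k \sum_l pure (pgen i k * pgen i' l) (pgen k j * pgen l j').
Proof.
rewrite mulr_suml; apply: eq_bigr => k _; rewrite mulr_sumr.
by apply: eq_bigr => l _; rewrite pureM.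
Qed.

Lemma comult_magic : magic_unitary comult_gen.
Proof.
have [ps pp r0 c0 r1 c1] := pgen_magic.
split=> [i j|i j|i j k jk|i j k jk|i|i].
- by rewrite star_sum; apply: eq_bigr => k _; rewrite star_purepol !ps.
- rewrite comult_genM; apply: eq_bigr => k _.
  rewrite (bigD1 k)//= !pp big1 ?addr0// => l lk.
  by rewrite r0 1?eq_sym// pure0l.
- rewrite comult_genM big1// => l _; rewrite big1// => m _.
  have [->|lm] := eqVneq l m; first by rewrite (r0 m _ _ jk) pure0r.
  by rewrite (r0 i _ _ lm) pure0l.
- rewrite comult_genM big1// => l _; rewrite big1// => m _.
  have [->|lm] := eqVneq l m; first by rewrite (c0 m _ _ jk) pure0l.
  by rewrite (c0 i _ _ lm) pure0r.
- rewrite exchange_big; under eq_bigr => k _ do rewrite -pure_sumr r1.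
  by rewrite -pure_suml r1.
- rewrite exchange_big; under eq_bigr => k _ do rewrite -pure_suml c1.
  by rewrite -pure_sumr c1.
Qed.

Definition comult : starMorphism Pol PolPol := pol_hom comult_magic.

Definition convolution (mu nu : {linear Pol -> C^o}) (a : Pol) : C :=
  tensor_functional mu nu (comult a).

End Pol.

(* By sesquilinear's convention hdot is linear in its first argument; inner is
   linear in the second one. *)
HB.mixin Record isHilbert (C : numClosedFieldType) H
    of CompleteNormedModule C H := {
  hdot : {dot H for @Num.conj C};
  hdot_norm : forall x : H, `|x| ^+ 2 = hdot x x
}.

#[short(type="hilbertType")]
HB.structure Definition Hilbert (C : numClosedFieldType) :=
  {H of CompleteNormedModule C H & isHilbert C H}.

Definition inner (C : numClosedFieldType) (H : hilbertType C) (x y : H) : C :=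
  hdot y x.

Definition unitary (C : numClosedFieldType) (H K : hilbertType C) (V : H -> K) :=
  [/\ linear V, forall x y, inner (V x) (V y) = inner x y
    & forall y, exists x, V x = y].

Section SchurmannTriple.
Variables (C : numClosedFieldType) (n : nat) (H : hilbertType C).
Local Notation Pol := (Pol C n).
Local Notation eps := (counit C n).

(* For linear maps between normed spaces, continuity is boundedness. *)
Record representation (rho : Pol -> H -> H) : Prop := {
  rho_linear : forall a, linear (rho a);
  rho_bounded : forall a, continuous (rho a);
  rhoP : forall c a b x, rho (c *: a + b) x = c *: rho a x + rho b x;
  rho1 : forall x, rho 1 x = x;
  rhoM : forall a b x, rho (a * b) x = rho a (rho b x);
  rho_star : forall a x y, inner (rho (star a) x) y = inner x (rho a y) }.

Definition cocycle (rho : Pol -> H -> H) (eta : Pol -> H) : Prop :=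
  linear eta /\
  forall a b, eta (a * b) = rho a (eta b) + (eps b : C) *: eta a.

Record schurmann_triple (rho : Pol -> H -> H) (eta : Pol -> H)
    (L : {linear Pol -> C^o}) : Prop := {
  st_rep : representation rho;
  st_cocycle : cocycle rho eta;
  st_hermitian : forall a, L (star a) = (L a : C)^*;
  st_coboundary : forall a b, L (star a * b) =
    inner (eta a) (eta b) + eps (star a) * L b + L (star a) * eps b }.

End SchurmannTriple.

Definition state (C : numClosedFieldType) (B : starAlgType C)
    (Phi : {linear B -> C^o}) : Prop :=
  Phi 1 = 1 /\ forall b, 0 <= (Phi (star b * b) : C).

Section LevyProcess.
Variables (R : realType) (n : nat).
Local Notation C := R[i].
Local Notation Pol := (Pol C n).
Local Notation eps := (counit C n).

(* Time ranges over 0 <= s <= t: the values of levy_hom elsewhere are junk.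
   Functionals take their values in the alias C^o of R[i], which carries the
   topology. *)
Record levy_process := LevyProcess {
  levy_alg : starAlgType C;
  levy_state : {linear levy_alg -> C^o};
  levy_hom : R -> R -> starMorphism Pol levy_alg;
  omega := (fun s t => levy_state \o levy_hom s t) : R -> R -> {linear Pol -> C^o};
  levy_stateP : state levy_state;
  levy_conv : forall r s t, 0 <= r -> r <= s -> s <= t ->
    forall a, omega r t a = convolution (omega r s) (omega s t) a;
  levy_tt : forall t, 0 <= t -> forall a, omega t t a = eps a;
  levy_stationary : forall s t, 0 <= s -> s <= t ->
    forall a, omega s t a = omega 0 (t - s) a;
  levy_independent : forall m (s t : 'I_m -> R) (a : 'I_m -> Pol),
    (forall i, 0 <= s i <= t i) ->
    trivIset setT (fun i => `[s i, t i[%classic) ->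
    levy_state (\prod_(i < m) levy_hom (s i) (t i) (a i)) =
    \prod_(i < m) omega (s i) (t i) (a i);
  levy_continuous : forall a, (fun t => omega 0 t a) @ 0^'+ --> eps a }.

Definition levy_equiv (X Y : levy_process) : Prop :=
  forall t, 0 <= t -> forall a, omega X 0 t a = omega Y 0 t a.

Definition generating_functional (X : levy_process) (L : Pol -> C^o) : Prop :=
  forall a, (fun t => (omega X 0 t a - eps a) / (t%:C)%C : C^o) @ 0^'+ --> L a.

Definition schurmann_triple_of (X : levy_process) (H : hilbertType C)
    (rho : Pol -> H -> H) (eta : Pol -> H) (L : {linear Pol -> C^o}) : Prop :=
  [/\ schurmann_triple rho eta L, generating_functional X L
    & dense (range eta)].

Lemma schurmann_triple_rep (X : levy_process) (H : hilbertType C)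
    (rho : Pol -> H -> H) (eta : Pol -> H) (L : {linear Pol -> C^o}) :
  schurmann_triple_of X rho eta L -> representation rho.
Proof. by case=> -[]. Qed.

Record rep_tuple := RepTuple {
  rt_space : hilbertType C;
  rt_rho : Pol -> rt_space -> rt_space;
  rt_xi : 'I_n -> rt_space;
  rt_rep : representation rt_rho }.

Arguments rt_rho : clear implicits.
Arguments rt_xi : clear implicits.

Definition tuple_relations (T : rep_tuple) : Prop :=
  (forall i, rt_rho T (pgen C i i) (rt_xi T i) = 0) /\
  (forall i j, rt_rho T (pgen C i j) (rt_xi T i) =
               rt_rho T (pgen C i j) (rt_xi T j)).

Definition associated_cocycle (T : rep_tuple) (eta : Pol -> rt_space T) : Prop :=
  cocycle (rt_rho T) eta /\ forall i, eta (pgen C i i) = rt_xi T i.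

Arguments associated_cocycle : clear implicits.

Definition admissible (T : rep_tuple) : Prop :=
  tuple_relations T /\
  exists eta, associated_cocycle T eta /\ dense (range eta).

Definition tuple_equiv (T T' : rep_tuple) : Prop :=
  exists V : rt_space T -> rt_space T',
  [/\ unitary V, forall a x, V (rt_rho T a x) = rt_rho T' a (V x)
    & forall i, rt_xi T' i = V (rt_xi T i)].

(* Equivalence classes, as predicates: for universe reasons the library's set
   cannot be applied to these large types. *)
Definition levy_class := {c : levy_process -> Prop | exists X, c = levy_equiv X}.

Definition tuple_class :=
  {c : rep_tuple -> Prop | exists2 T, admissible T & c = tuple_equiv T}.

Definition class_of_levy (X : levy_process) : levy_class :=
  exist _ (levy_equiv X) (ex_intro _ X erefl).

End LevyProcess.

Arguments rt_rho {R n} r.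
Arguments rt_xi {R n} r.
Arguments associated_cocycle {R n} T eta.

(* Main.v *)
From HB Require Import structures.
Require Import Defs.
From mathcomp Require Import all_boot all_order all_algebra.
From mathcomp Require Import boolp classical_sets functions reals topology normedtype.
From mathcomp Require Import sesquilinear complex exp sequences ring lra.

Set Implicit Arguments.
Unset Strict Implicit.
Unset Printing Implicit Defensive.

Import Order.TTheory GRing.Theory Num.Theory numFieldNormedType.Exports.
Local Open Scope classical_set_scope.
Local Open Scope ring_scope.
Import ComplexField.Normc.

(** A Levy process is determined by its generating functional L, and L by a
Schurmann triple; on S_n^+ the cocycle of the triple is determined by n vectors
and, conversely, determines L. The proof follows these steps in both
directions.

Vectors and cocycles. The triples (rho, eta, L) with given rho are exactly the
homomorphisms from Pol(S_n^+) into the algebra schur_alg of upper triangular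
operators on C + H + C that have (eps, rho, eps) on the diagonal. By the
universal property such a homomorphism is a magic unitary in this algebra, and
the relations between rho and xi_1, ..., xi_n are what is needed to write one
down (schurmann_triple_exists). They are also necessary, because eta (p_ij) can
be computed from p_ij p_ii = 0 and from p_ij p_jj = 0 (cocycle_relations). Since
Pol(S_n^+) is generated by projections and an eps-derivation vanishes on
projections (eps_derivation0), eta determines L, and every cocycle has an L.

Functionals and processes. Every element of Pol(S_n^+) is a coefficient of a
finite dimensional corepresentation (corep_exists), on which convolution
semigroups of functionals are one-parameter semigroups of matrices. The
elementary theory of those, including differentiability of a continuous
semigroup and the Euler approximation of the exponential, gives a bijection
between linear functionals and convolution semigroups continuous at 0. The semigroup
generated by the L of a triple is positive (schoenberg_positive): up to a second
order error, which disappears in the Euler approximation, eps + s L is a kernel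
with a Kraus decomposition, and the powers of such kernels are positive. A
process with given positive semigroup is realized by operators on a space with
one site for each interval of time, acting at their own site by the GNS action
of the law of the increment (levy_of_semigroup); then increments over disjoint
intervals are independent by construction.

From a process to a triple. The generating functional of a process is hermitian,
vanishes at 1 and is positive on the kernel of eps. The GNS construction on this
kernel, followed by completion, gives a triple with dense range
(cond_positive_triple). It is unique up to unitary equivalence because L
determines all inner products of the vectors eta a (triple_unitary).

Hence two processes are equivalent if and only if their tuples are
(triple_of_equiv), and every admissible tuple occurs (levy_of_admissible). *)

(** * The Hopf *-algebra, its representations and its cocycles *)

Lemma add_self_eq0 (V : zmodType) (x : V) : x = x + x -> x = 0.
Proof. by rewrite -{1}[x]addr0 => /addrI. Qed.

Section StarMorphismId.
Variables (C : numClosedFieldType) (A : starAlgType C).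
HB.instance Definition _ := isStarMorphism.Build C A A idfun (fun _ => erefl).
End StarMorphismId.

Section PolInduction.
Variables (C : numClosedFieldType) (n : nat).
Local Notation Pol := (Pol C n).
Local Notation p := (@pgen C n).
Local Notation eps := (counit C n).

(** An element is the value of an expression at the generators, and an
expression may contain the adjoint of a subexpression, about which P says
nothing. So P is proved for an element together with its adjoint: generators
are selfadjoint, and the adjoint passes through sums, products and scalings. *)
Lemma pol_ind (P : Pol -> Prop) :
  (forall i j, P (p i j)) -> P 1 -> (forall a b, P a -> P b -> P (a + b)) ->
  (forall a b, P a -> P b -> P (a * b)) -> (forall c a, P a -> P (c *: a)) ->
  forall a, P a.
Proof.
move=> Pg P1 PD PM PZ a.
have P0 : P 0 by rewrite -(scale0r 1); exact: PZ.
have evalE (t : pol_expr C n) : (\pi_Pol t)%qT = expr_eval (@pgen C n) t.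
  exact: (expr_eval_morph (idfun : starMorphism Pol Pol)).
suff PE (t : pol_expr C n) : P (expr_eval (@pgen C n) t) /\ P (star (expr_eval (@pgen C n) t)).
  by rewrite -[a]reprK evalE; have [] := PE (repr a).
elim: t => [i j|||t [Pt Pt'] u [Pu Pu']|t [Pt Pt'] u [Pu Pu']|c t [Pt Pt']|t [Pt Pt']] /=.
- by rewrite (magic_star (pgen_magic C n)).
- by rewrite star0.
- by rewrite star1.
- by rewrite starD; split; apply: PD.
- by rewrite starM; split; apply: PM.
- by rewrite starZ; split; apply: PZ.
- by rewrite starK.
Qed.

Lemma eps_pgen i j : eps (p i j) = (i == j)%:R.
Proof. exact: pol_hom_gen. Qed.

Lemma eps_star a : eps (star a) = (eps a : C)^*.
Proof. exact: star_morph. Qed.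

Lemma epsM a b : (eps (a * b) : C) = (eps a : C) * (eps b : C).
Proof. by rewrite rmorphM. Qed.

Lemma epsD a b : (eps (a + b) : C) = (eps a : C) + (eps b : C).
Proof. by rewrite rmorphD. Qed.

Lemma epsB a b : (eps (a - b) : C) = (eps a : C) - (eps b : C).
Proof. by rewrite rmorphB. Qed.

Lemma epsZ c a : (eps (c *: a) : C) = c * (eps a : C).
Proof. by rewrite linearZ. Qed.

Lemma eps1 : (eps 1 : C) = 1.
Proof. by rewrite rmorph1. Qed.

Lemma star_pgen i j : star (p i j) = p i j.
Proof. exact: magic_star (pgen_magic C n) i j. Qed.

Lemma pgen_idem i j : p i j * p i j = p i j.
Proof. exact: magic_idem (pgen_magic C n) i j. Qed.

(** On an idempotent p the product rule reads D p = 2 (eps p) (D p), and the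
number eps p is 0 or 1, so D p = 0; and a derivation that vanishes on
generators vanishes. This is why on S_n^+ a cocycle has at most one generating
functional: two of them differ by such a derivation. *)
Lemma eps_derivation0 (D : Pol -> C) :
  (forall c a b, D (c *: a + b) = c * D a + D b) ->
  (forall a b, D (a * b) = (eps a : C) * D b + D a * (eps b : C)) -> forall a, D a = 0.
Proof.
move=> linD derD.
have D1 : D 1 = 0.
  have := derD 1 1; rewrite mulr1 rmorph1 mul1r mulr1 => /add_self_eq0 //.
have D0 : D 0 = 0 by rewrite -(mulr0 0) derD rmorph0 mul0r mulr0 addr0.
apply: pol_ind => [i j|//|a b Da Db|a b Da Db|c a Da].
- have := derD (p i j) (p i j); rewrite pgen_idem eps_pgen.
  case: eqP => _; last by rewrite mul0r mulr0 addr0.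
  by rewrite mul1r mulr1 => /add_self_eq0.
- by rewrite -[a]scale1r linD Da Db mulr0 addr0.
- by rewrite derD Da Db mulr0 mul0r addr0.
- by rewrite -[_ *: a]addr0 linD Da D0 mulr0 addr0.
Qed.

End PolInduction.

Section InnerTheory.
Variables (C : numClosedFieldType) (H : hilbertType C).
Implicit Types x y z : H.

Lemma innerDr x y z : inner x (y + z) = inner x y + inner x z.
Proof. exact: linearDl. Qed.
Lemma innerZr c x y : inner x (c *: y) = c * inner x y.
Proof. exact: linearZl_LR. Qed.
Lemma inner0r x : inner x 0 = 0. Proof. exact: linear0l. Qed.
Lemma innerBr x y z : inner x (y - z) = inner x y - inner x z.
Proof. exact: linearBl. Qed.
Lemma innerC x y : inner x y = (inner y x)^*.
Proof. by rewrite /inner hermC expr0 mul1r. Qed.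
Lemma innerDl x y z : inner (x + y) z = inner x z + inner y z.
Proof. exact: linearDr. Qed.
Lemma innerZl c x y : inner (c *: x) y = c^* * inner x y.
Proof. by rewrite innerC innerZr rmorphM /= -innerC. Qed.
Lemma inner0l x : inner 0 x = 0. Proof. exact: linear0r. Qed.
Lemma innerBl x y z : inner (x - y) z = inner x z - inner y z.
Proof. exact: linearBr. Qed.
Lemma inner_norm x : inner x x = `|x| ^+ 2. Proof. by rewrite hdot_norm. Qed.
End InnerTheory.

Section RepTheory.
Variables (C : numClosedFieldType) (n : nat) (H : hilbertType C).
Local Notation Pol := (Pol C n).
Local Notation eps := (counit C n).
Local Notation p := (@pgen C n).
Variables (rho : Pol -> H -> H) (rep : representation rho).

Lemma repDr a x y : rho a (x + y) = rho a x + rho a y.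
Proof. by have := rho_linear rep a 1 x y; rewrite !scale1r. Qed.
Lemma rep0r a : rho a 0 = 0.
Proof. by have := repDr a 0 0; rewrite addr0 => /add_self_eq0. Qed.
Lemma repZr a c x : rho a (c *: x) = c *: rho a x.
Proof. by have := rho_linear rep a c x 0; rewrite !addr0 rep0r addr0. Qed.
Lemma repNr a x : rho a (- x) = - rho a x.
Proof. by rewrite -scaleN1r repZr scaleN1r. Qed.
Lemma repDl a b x : rho (a + b) x = rho a x + rho b x.
Proof. by have := rhoP rep 1 a b x; rewrite !scale1r. Qed.
Lemma rep0l x : rho 0 x = 0.
Proof. by have := repDl 0 0 x; rewrite addr0 => /add_self_eq0. Qed.
Lemma repZl a c x : rho (c *: a) x = c *: rho a x.
Proof. by have := rhoP rep c a 0 x; rewrite addr0 rep0l addr0. Qed.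
Lemma rep_starr a x y : inner x (rho (star a) y) = inner (rho a x) y.
Proof. by rewrite -(rho_star rep) starK. Qed.

End RepTheory.

Section CocycleTheory.
Variables (C : numClosedFieldType) (n : nat) (H : hilbertType C).
Local Notation Pol := (Pol C n).
Local Notation eps := (counit C n).
Local Notation p := (@pgen C n).
Variables (rho : Pol -> H -> H) (eta : Pol -> H) (ceta : cocycle rho eta).

Lemma cocM a b : eta (a * b) = rho a (eta b) + (eps b : C) *: eta a.
Proof. by case: ceta. Qed.
Lemma cocD a b : eta (a + b) = eta a + eta b.
Proof. by have [h _] := ceta; have := h 1 a b; rewrite !scale1r. Qed.
Lemma coc0 : eta 0 = 0.
Proof. by have := cocD 0 0; rewrite addr0 => /add_self_eq0. Qed.
Lemma cocZ c a : eta (c *: a) = c *: eta a.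
Proof. by have [h _] := ceta; have := h c a 0; rewrite !addr0 coc0 addr0. Qed.
Hypothesis rep : representation rho.
Lemma coc1 : eta 1 = 0.
Proof.
have := cocM 1 1; rewrite mulr1 rmorph1 scale1r (rho1 rep) => /add_self_eq0 //.
Qed.

(** Apply the cocycle to p_ij p_ii = 0. Thus eta is determined by its values at
the diagonal generators; doing the same with p_ij p_jj = 0 expresses eta (p_ij)
in a second way, and comparing the two gives the relations on the tuple. *)
Lemma coc_offdiagl i j : i != j -> eta (p i j) = - rho (p i j) (eta (p i i)).
Proof.
move=> ij; have := cocM (p i j) (p i i).
rewrite (magic_row0 (pgen_magic C n)) 1?eq_sym// coc0 eps_pgen eqxx scale1r.
by move/esym/eqP; rewrite addrC addr_eq0 => /eqP.
Qed.

Lemma coc_offdiagr i j : i != j -> eta (p i j) = - rho (p i j) (eta (p j j)).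
Proof.
move=> ij; have := cocM (p i j) (p j j).
rewrite (magic_col0 (pgen_magic C n))// coc0 eps_pgen eqxx scale1r.
by move/esym/eqP; rewrite addrC addr_eq0 => /eqP.
Qed.

Lemma coc_diag i : rho (p i i) (eta (p i i)) = 0.
Proof.
have := cocM (p i i) (p i i).
rewrite pgen_idem eps_pgen eqxx scale1r => /(congr1 (fun x => x - eta (p i i))).
by rewrite addrK subrr.
Qed.

End CocycleTheory.

Section CocycleUnique.
Variables (C : numClosedFieldType) (n : nat) (H : hilbertType C).
Local Notation Pol := (Pol C n).
Local Notation p := (@pgen C n).
Variables (rho : Pol -> H -> H) (rep : representation rho).

Lemma cocycle_unique (eta eta' : Pol -> H) : cocycle rho eta -> cocycle rho eta' ->
  (forall i, eta (p i i) = eta' (p i i)) -> eta =1 eta'.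
Proof.
move=> ce ce' ee; apply: pol_ind => [i j||a b IHa IHb|a b IHa IHb|c a IHa].
- have [<-|ij] := eqVneq i j; first exact: ee.
  by rewrite (coc_offdiagl ce ij) (coc_offdiagl ce' ij) ee.
- by rewrite (coc1 ce rep) (coc1 ce' rep).
- by rewrite (cocD ce) (cocD ce') IHa IHb.
- by rewrite (cocM ce) (cocM ce') IHa IHb.
- by rewrite (cocZ ce) (cocZ ce') IHa.
Qed.

End CocycleUnique.

Section SemiInner.
Variables (C : numClosedFieldType) (V : lmodType C) (F : V -> V -> C).

(** Degenerate forms are allowed because the forms built below, from
positive functionals, have in general a kernel. *)
Record semi_inner : Prop := {
  form_linear : forall x c y z, F x (c *: y + z) = c * F x y + F x z;
  form_herm : forall x y, F x y = (F y x)^*;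
  form_ge0 : forall x, 0 <= F x x }.

Hypothesis FP : semi_inner.

Lemma formDr x y z : F x (y + z) = F x y + F x z.
Proof. by have := form_linear FP x 1 y z; rewrite scale1r mul1r. Qed.
Lemma form0r x : F x 0 = 0.
Proof. by have := formDr x 0 0; rewrite addr0 => /add_self_eq0. Qed.
Lemma formZr x c y : F x (c *: y) = c * F x y.
Proof. by have := form_linear FP x c y 0; rewrite !addr0 form0r addr0. Qed.
Lemma formNr x y : F x (- y) = - F x y.
Proof. by rewrite -scaleN1r formZr mulN1r. Qed.
Lemma formBr x y z : F x (y - z) = F x y - F x z.
Proof. by rewrite formDr formNr. Qed.
Lemma formDl x y z : F (x + y) z = F x z + F y z.
Proof. by rewrite (form_herm FP) formDr rmorphD /= -!(form_herm FP). Qed.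
Lemma form0l x : F 0 x = 0.
Proof. by rewrite (form_herm FP) form0r conjC0. Qed.
Lemma formZl x c y : F (c *: x) y = c^* * F x y.
Proof. by rewrite (form_herm FP) formZr rmorphM /= -(form_herm FP). Qed.
Lemma formNl x y : F (- x) y = - F x y.
Proof. by rewrite -scaleN1r formZl rmorphN1 mulN1r. Qed.
Lemma formBl x y z : F (x - y) z = F x z - F y z.
Proof. by rewrite formDl formNl. Qed.

End SemiInner.

(** * Existence of cocycles and generating functionals *)

Section ConjugateModule.
Variables (C : numClosedFieldType) (V : lmodType C).
(** The two vector components of a quadruple in schur_alg are exchanged by the
adjoint, which is antilinear; the second one must therefore carry the conjugate
scalar action. *)
Definition conjugate_module : Type := V.
HB.instance Definition _ := GRing.Zmodule.on conjugate_module.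
Definition conjugate_scale (c : C) (x : conjugate_module) : conjugate_module :=
  c^* *: (x : V).
Fact conjugate_scaleA c d x :
  conjugate_scale c (conjugate_scale d x) = conjugate_scale (c * d) x.
Proof. by rewrite /conjugate_scale scalerA rmorphM. Qed.
Fact conjugate_scale1 : left_id 1 conjugate_scale.
Proof. by move=> x; rewrite /conjugate_scale conjC1 scale1r. Qed.
Fact conjugate_scaleDr : right_distributive conjugate_scale +%R.
Proof. by move=> c x y; apply: scalerDr. Qed.
Fact conjugate_scaleDl x : {morph conjugate_scale^~ x : c d / c + d}.
Proof. by move=> c d; rewrite /conjugate_scale rmorphD scalerDl. Qed.
HB.instance Definition _ := GRing.Zmodule_isLmodule.Build C conjugate_module
  conjugate_scaleA conjugate_scale1 conjugate_scaleDr conjugate_scaleDl.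
End ConjugateModule.

Section SchurmannAlgebra.
Variables (C : numClosedFieldType) (n : nat) (H : hilbertType C).
Local Notation Pol := (Pol C n).
Local Notation eps := (counit C n).
Local Notation p := (@pgen C n).
Variables (rho : Pol -> H -> H) (rep : representation rho).

(** The quadruple (a, v, w, c) stands for the upper triangular operator on
C + H + C with diagonal (eps a, rho a, eps a), first row (eps a, w^*, c) and
last column (c, v, eps a). A homomorphism into this algebra that lifts the
identity of Pol(S_n^+) has a cocycle as its component v and a generating
functional as its component c, so that the universal property of Pol(S_n^+)
constructs both at once. *)
Definition schur_alg of representation rho : Type :=
  ((Pol * H) * (conjugate_module H * C^o))%type.
Local Notation A := (schur_alg rep).
HB.instance Definition _ := GRing.Lmodule.on A.

Definition sa_mk (a : Pol) (v w : H) (c : C) : A := ((a, v), (w, c)).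
Definition sa_pol (x : A) : Pol := x.1.1.
Definition sa_vec (x : A) : H := x.1.2.
Definition sa_covec (x : A) : H := x.2.1.
Definition sa_scal (x : A) : C := x.2.2.

Lemma sa_eq (x y : A) : sa_pol x = sa_pol y -> sa_vec x = sa_vec y ->
  sa_covec x = sa_covec y -> sa_scal x = sa_scal y -> x = y.
Proof. by case: x y => [[a v] [w c]] [[a' v'] [w' c']]; cbn => -> -> -> ->. Qed.

Definition sa_mul (x y : A) : A :=
  sa_mk (sa_pol x * sa_pol y)
    (rho (sa_pol x) (sa_vec y) + (eps (sa_pol y) : C) *: sa_vec x)
    (rho (star (sa_pol y)) (sa_covec x) + (eps (sa_pol x) : C)^* *: sa_covec y)
    ((eps (sa_pol x) : C) * sa_scal y + sa_scal x * (eps (sa_pol y) : C)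
      + inner (sa_covec x) (sa_vec y)).
Definition sa_one : A := sa_mk 1 0 0 0.
Definition sa_star (x : A) : A :=
  sa_mk (star (sa_pol x)) (sa_covec x) (sa_vec x) (sa_scal x)^*.

Fact sa_mulA : associative sa_mul.
Proof.
move=> x y z; apply: sa_eq; rewrite /sa_pol /sa_vec /sa_covec /sa_scal /=.
- exact: mulrA.
- rewrite (repDr rep) (repZr rep) (rhoM rep) rmorphM /= scalerDr scalerA addrA.
  by rewrite [X in X *: x.1.2]mulrC.
- rewrite (repDr rep) (repZr rep) starM (rhoM rep) rmorphM /= rmorphM /=.
  by rewrite scalerDr scalerA addrA.
- rewrite innerDr innerDl innerZr innerZl conjCK (rho_star rep) !rmorphM /=.
  by rewrite /sa_scal /= !/sa_scal; ring.
Qed.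
Fact sa_mul1 : left_id sa_one sa_mul.
Proof.
move=> x; apply: sa_eq; rewrite /sa_pol /sa_vec /sa_covec /sa_scal /=.
- exact: mul1r.
- by rewrite (rho1 rep) scaler0 addr0.
- by rewrite (rep0r rep) rmorph1 conjC1 scale1r add0r.
- by rewrite rmorph1 mul1r mul0r inner0l !addr0.
Qed.
Fact sa_1mul : right_id sa_one sa_mul.
Proof.
move=> x; apply: sa_eq; rewrite /sa_pol /sa_vec /sa_covec /sa_scal /=.
- exact: mulr1.
- by rewrite (rep0r rep) rmorph1 scale1r add0r.
- by rewrite star1 (rho1 rep) scaler0 addr0.
- by rewrite rmorph1 mulr1 mulr0 inner0r !addr0 add0r.
Qed.
Fact sa_mulDl : left_distributive sa_mul +%R.
Proof.
move=> x y z; apply: sa_eq; rewrite /sa_pol /sa_vec /sa_covec /sa_scal /=.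
- exact: mulrDl.
- by rewrite (repDl rep) scalerDr addrACA.
- by rewrite (repDr rep) rmorphD /= rmorphD scalerDl addrACA.
- by rewrite rmorphD innerDl /= /sa_scal /=; ring.
Qed.
Fact sa_mulDr : right_distributive sa_mul +%R.
Proof.
move=> x y z; apply: sa_eq; rewrite /sa_pol /sa_vec /sa_covec /sa_scal /=.
- exact: mulrDr.
- by rewrite (repDr rep) rmorphD /= scalerDl addrACA.
- by rewrite starD (repDl rep) scalerDr addrACA.
- by rewrite rmorphD innerDr /= /sa_scal /=; ring.
Qed.
Fact sa_1neq0 : sa_one != 0.
Proof. by apply/eqP => /(congr1 sa_pol) /eqP; rewrite oner_eq0. Qed.
HB.instance Definition _ := GRing.Zmodule_isNzRing.Build A
  sa_mulA sa_mul1 sa_1mul sa_mulDl sa_mulDr sa_1neq0.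

Lemma sa_polM (x y : A) : sa_pol (x * y) = sa_pol x * sa_pol y.
Proof. by []. Qed.
Lemma sa_vecM (x y : A) : sa_vec (x * y) =
  rho (sa_pol x) (sa_vec y) + (eps (sa_pol y) : C) *: sa_vec x.
Proof. by []. Qed.
Lemma sa_covecM (x y : A) : sa_covec (x * y) =
  rho (star (sa_pol y)) (sa_covec x) + (eps (sa_pol x) : C)^* *: sa_covec y.
Proof. by []. Qed.
Lemma sa_scalM (x y : A) : sa_scal (x * y) =
  (eps (sa_pol x) : C) * sa_scal y + sa_scal x * (eps (sa_pol y) : C)
      + inner (sa_covec x) (sa_vec y).
Proof. by []. Qed.
Lemma sa_polZ c (x : A) : sa_pol (c *: x) = c *: sa_pol x. Proof. by []. Qed.
Lemma sa_vecZ c (x : A) : sa_vec (c *: x) = c *: sa_vec x. Proof. by []. Qed.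
Lemma sa_covecZ c (x : A) : sa_covec (c *: x) = c^* *: sa_covec x. Proof. by []. Qed.
Lemma sa_scalZ c (x : A) : sa_scal (c *: x) = c * sa_scal x. Proof. by []. Qed.
Lemma eps_scale c a : (eps (c *: a) : C) = c * (eps a : C).
Proof. by rewrite linearZ. Qed.

Fact sa_scaleAl (c : C) (x y : A) : c *: (x * y) = (c *: x) * y.
Proof.
apply: sa_eq.
- exact: scalerAl.
- rewrite sa_vecZ !sa_vecM sa_polZ sa_vecZ (repZl rep) scalerDr !scalerA.
  by rewrite [c * _]mulrC.
- rewrite sa_covecZ !sa_covecM sa_polZ sa_covecZ (repZr rep) scalerDr !scalerA.
  by rewrite eps_scale rmorphM.
- by rewrite sa_scalZ !sa_scalM sa_polZ sa_covecZ sa_scalZ eps_scale innerZl conjCK; ring.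
Qed.
HB.instance Definition _ := GRing.Lmodule_isLalgebra.Build C A sa_scaleAl.
Fact sa_scaleAr (c : C) (x y : A) : c *: (x * y) = x * (c *: y).
Proof.
apply: sa_eq.
- exact: scalerAr.
- by rewrite sa_vecZ !sa_vecM sa_polZ sa_vecZ (repZr rep) scalerDr !scalerA eps_scale.
- rewrite sa_covecZ !sa_covecM sa_polZ sa_covecZ starZ (repZl rep) scalerDr !scalerA.
  by rewrite [c^* * _]mulrC.
- by rewrite sa_scalZ !sa_scalM sa_polZ sa_vecZ sa_scalZ eps_scale innerZr; ring.
Qed.
HB.instance Definition _ := GRing.Lalgebra_isAlgebra.Build C A sa_scaleAr.

Fact sa_starK : involutive sa_star.
Proof. by move=> x; apply: sa_eq => //; [exact: starK|exact: conjCK]. Qed.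
Fact sa_starD : {morph sa_star : x y / x + y}.
Proof. by move=> x y; apply: sa_eq => //; [exact: starD|exact: rmorphD]. Qed.
Fact sa_starM (x y : A) : sa_star (x * y) = sa_star y * sa_star x.
Proof.
apply: sa_eq; rewrite /sa_pol /sa_vec /sa_covec /sa_scal /=.
- exact: starM.
- by rewrite eps_star.
- by rewrite starK eps_star conjCK.
- rewrite !eps_star 2!rmorphD !rmorphM /= -innerC; congr (_ + _).
  by rewrite addrC; congr (_ + _); rewrite mulrC.
Qed.
Fact sa_starZ (c : C) (x : A) : sa_star (c *: x) = c^* *: sa_star x.
Proof.
apply: sa_eq => //.
- exact: starZ.
- by rewrite /sa_covec /= /GRing.scale /= /conjugate_scale conjCK.
- exact: rmorphM.
Qed.
HB.instance Definition _ := isStarAlgebra.Build C A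
  sa_starK sa_starD sa_starM sa_starZ.

(** The conjugate of the diagonal operator diag (eps a, rho a, eps a) by a
unipotent matrix with entries built from x, hence a unital homomorphism that
respects adjoints. It corresponds to the coboundary cocycle
a |-> (eps a) x - rho a x. *)
Definition coboundary_hom (x : H) (a : Pol) : A :=
  sa_mk a ((eps a : C) *: x - rho a x) ((eps a : C)^* *: x - rho (star a) x)
    (inner x (rho a x) - (eps a : C) * inner x x).

Lemma coboundary_homM x a b :
  coboundary_hom x (a * b) = coboundary_hom x a * coboundary_hom x b.
Proof.
have epsM : (eps (a * b) : C) = eps a * eps b by rewrite rmorphM.
apply: sa_eq; rewrite ?sa_polM ?sa_vecM ?sa_covecM ?sa_scalM;
  rewrite /sa_pol /sa_vec /sa_covec /sa_scal ?[coboundary_hom _ _]/(sa_mk _ _ _ _) /fst /snd;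
  cbn [fst snd sa_mk coboundary_hom].
- by [].
- rewrite epsM (rhoM rep) (repDr rep) (repNr rep) (repZr rep) scalerBr !scalerA.
  by rewrite [eps b * eps a]mulrC [RHS]addrC addrA subrK.
- rewrite epsM starM (rhoM rep) (repDr rep) (repNr rep) (repZr rep) scalerBr !scalerA.
  by rewrite rmorphM [RHS]addrC addrA subrK.
- rewrite epsM (rhoM rep) !innerBl !innerBr !innerZl !innerZr conjCK.
  by rewrite !(rho_star rep); ring.
Qed.

Lemma coboundary_homD x a b :
  coboundary_hom x (a + b) = coboundary_hom x a + coboundary_hom x b.
Proof.
have epsD : (eps (a + b) : C) = eps a + eps b by rewrite rmorphD.
apply: sa_eq; rewrite /sa_pol /sa_vec /sa_covec /sa_scal;
  cbn [fst snd sa_mk coboundary_hom].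
- by [].
- by rewrite epsD (repDl rep) scalerDl opprD addrACA.
- by rewrite epsD starD (repDl rep) rmorphD scalerDl opprD addrACA.
- by rewrite epsD (repDl rep) innerDr mulrDl opprD addrACA.
Qed.

Lemma coboundary_hom1 x : coboundary_hom x 1 = 1.
Proof.
have eps1 : (eps 1 : C) = 1 by rewrite rmorph1.
apply: sa_eq; rewrite /sa_pol /sa_vec /sa_covec /sa_scal;
  cbn [fst snd sa_mk coboundary_hom].
- by [].
- by rewrite eps1 (rho1 rep) scale1r subrr.
- by rewrite eps1 star1 (rho1 rep) conjC1 scale1r subrr.
- by rewrite eps1 (rho1 rep) mul1r subrr.
Qed.

Lemma coboundary_hom0 x : coboundary_hom x 0 = 0.
Proof. by apply: (addrI (coboundary_hom x 0)); rewrite -coboundary_homD !addr0. Qed.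

Lemma coboundary_hom_sum x I (r : seq I) (F : I -> Pol) :
  coboundary_hom x (\sum_(i <- r) F i) = \sum_(i <- r) coboundary_hom x (F i).
Proof. by apply: big_morph; [exact: coboundary_homD|exact: coboundary_hom0]. Qed.

Lemma coboundary_hom_star x a :
  coboundary_hom x (star a) = star (coboundary_hom x a).
Proof.
apply: sa_eq; rewrite /sa_pol /sa_vec /sa_covec /sa_scal;
  cbn [fst snd sa_mk coboundary_hom].
- by [].
- by rewrite eps_star.
- by rewrite starK eps_star conjCK.
- rewrite -[RHS]/((inner x (rho a x) - (eps a : C) * inner x x)^*).
  rewrite eps_star rmorphB rmorphM /= -!innerC; congr (_ - _).
  by rewrite (rep_starr rep).
Qed.

Section Magic.
Variable xi : 'I_n -> H.
Hypothesis xi_diag : forall i, rho (p i i) (xi i) = 0.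
Hypothesis xi_eq : forall i j, rho (p i j) (xi i) = rho (p i j) (xi j).

Let q (i j : 'I_n) : A := coboundary_hom (xi i) (p i j).

(** The components of q i j see xi i only through rho (p i j) (xi i), which is
where the relations on the tuple enter. *)
Let q_col i j : q i j = coboundary_hom (xi j) (p i j).
Proof.
rewrite /q /coboundary_hom eps_pgen star_pgen xi_eq.
have [->//|ij] := eqVneq i j; rewrite conjC0 !scale0r !mul0r !subr0.
have innerE x : inner x (rho (p i j) x) = inner (rho (p i j) x) (rho (p i j) x).
  by rewrite -{1}pgen_idem (rhoM rep) -{1}star_pgen (rep_starr rep).
by rewrite -{3}xi_eq innerE xi_eq -innerE.
Qed.

(** Row i of q is the image of row i of p under the homomorphism attached to
xi i, and by q_col column j of q is the image of column j of p under the one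
attached to xi j. All relations of a magic unitary involve a single row or a
single column, so they are inherited from p. *)
Fact schur_magic : magic_unitary q.
Proof.
have [ps pp r0 c0 r1 c1] := pgen_magic C n.
split=> [i j|i j|i j k jk|i j k jk|i|i].
- by rewrite -coboundary_hom_star ps.
- by rewrite -coboundary_homM pp.
- by rewrite -coboundary_homM r0// coboundary_hom0.
- by rewrite !q_col -coboundary_homM c0// coboundary_hom0.
- by rewrite -coboundary_hom_sum r1 coboundary_hom1.
- under eq_bigr do rewrite q_col.
  by rewrite -coboundary_hom_sum c1 coboundary_hom1.
Qed.

Let Phi := pol_hom schur_magic.

Let Phi_pol a : sa_pol (Phi a) = a.
Proof.
elim/pol_ind: a => [i j||a b IHa IHb|a b IHa IHb|c a IHa].
- by rewrite pol_hom_gen.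
- by rewrite rmorph1.
- by rewrite rmorphD -[LHS]/(sa_pol (Phi a) + sa_pol (Phi b)) IHa IHb.
- by rewrite rmorphM sa_polM IHa IHb.
- by rewrite linearZ sa_polZ IHa.
Qed.

Let L (a : Pol) : C^o := sa_scal (Phi a).
Fact L_linear : linear L.
Proof. by move=> c a b; rewrite /L linearP. Qed.
HB.instance Definition _ := GRing.isLinear.Build C Pol C^o *:%R L L_linear.

(** At a diagonal generator the cocycle of q takes the value
xi i - rho (p_ii) (xi i), which is xi i by the first relation. *)
Lemma schurmann_triple_exists : exists (eta : Pol -> H) (L : {linear Pol -> C^o}),
  schurmann_triple rho eta L /\ forall i, eta (p i i) = xi i.
Proof.
exists (fun a => sa_vec (Phi a)), L; split; last first.
  move=> i; rewrite pol_hom_gen /q /coboundary_hom eps_pgen eqxx scale1r.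
  by rewrite /sa_vec /= xi_diag subr0.
have covecE a : sa_covec (Phi a) = sa_vec (Phi (star a)) by rewrite star_morph.
split=> //.
- split=> [c a b|a b]; first by rewrite linearP.
  by rewrite rmorphM sa_vecM !Phi_pol.
- by move=> a; rewrite -[LHS]/(sa_scal (Phi (star a))) star_morph.
- move=> a b; rewrite -[LHS]/(sa_scal (Phi (star a * b))) rmorphM sa_scalM !Phi_pol covecE starK.
  by rewrite addrC addrA.
Qed.

End Magic.

End SchurmannAlgebra.

(** * Coefficients of corepresentations *)

Section Coalgebra.
Variables (C : numClosedFieldType) (n : nat).
Local Notation Pol := (Pol C n).
Local Notation p := (@pgen C n).
Local Notation eps := (counit C n).
Local Notation comult := (comult C n).

Section Convolution.
Variables (mu nu : {linear Pol -> C^o}).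

Definition conv (a : Pol) : C^o := convolution mu nu a.

Fact conv_linear : linear conv.
Proof. by move=> c a b; rewrite /conv /convolution linearP. Qed.

HB.instance Definition _ := GRing.isLinear.Build C Pol C^o *:%R conv conv_linear.

End Convolution.

(** A matrix of elements on which the comultiplication and the counit act as on
matrix coefficients: convolution of functionals becomes multiplication of
matrices. *)
Definition corep (J : finType) (U : J -> J -> Pol) : Prop :=
  (forall i j, comult (U i j) = \sum_k pure (U i k) (U k j)) /\
  (forall i j, (eps (U i j) : C) = (i == j)%:R).

Lemma conv_corep (J : finType) (U : J -> J -> Pol) mu nu i j : corep U ->
  conv mu nu (U i j) = \sum_k (mu (U i k) : C) * (nu (U k j) : C).
Proof.
move=> [UD _]; rewrite /conv /convolution UD.
by rewrite (big_morph (tensor_functional mu nu) (id1 := 0) (op1 := +%R)).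
Qed.

Definition coefficient (J : finType) (U : J -> J -> Pol) (a : Pol) : Prop :=
  exists c : J -> J -> C, a = \sum_i \sum_j c i j *: U i j.

Lemma corep_coefficient (J : finType) (U : J -> J -> Pol) i j : coefficient U (U i j).
Proof.
exists (fun k l => ((k == i) && (l == j))%:R).
rewrite (bigD1 i)//= (bigD1 j)//= !eqxx scale1r !big1 ?addr0// => [k /negPf ki|l /negPf lj].
  by rewrite big1// => l _; rewrite ki scale0r.
by rewrite lj scale0r.
Qed.

Lemma coefficientZ (J : finType) (U : J -> J -> Pol) c a :
  coefficient U a -> coefficient U (c *: a).
Proof.
move=> [d ->]; exists (fun i j => c * d i j).
rewrite scaler_sumr; apply: eq_bigr => i _; rewrite scaler_sumr.
by apply: eq_bigr => j _; rewrite scalerA.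
Qed.

Definition corep_sum (J K : finType) (U : J -> J -> Pol) (V : K -> K -> Pol)
    (x y : J + K) : Pol :=
  match x, y with
  | inl i, inl j => U i j
  | inr i, inr j => V i j
  | _, _ => 0
  end.

Definition corep_prod (J K : finType) (U : J -> J -> Pol) (V : K -> K -> Pol)
    (x y : J * K) : Pol := U x.1 y.1 * V x.2 y.2.

Lemma corep_sumP (J K : finType) (U : J -> J -> Pol) (V : K -> K -> Pol) :
  corep U -> corep V -> corep (corep_sum U V).
Proof.
move=> [UD Ue] [VD Ve]; split=> -[i|i] [j|j]; rewrite ?big_sumType /=.
- rewrite UD [X in _ + X]big1 ?addr0// => k _; exact: pure0l.
- rewrite raddf0 !big1 ?addr0// => k _; [exact: pure0l|exact: pure0r].
- rewrite raddf0 !big1 ?addr0// => k _; [exact: pure0r|exact: pure0l].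
- rewrite VD [X in X + _]big1 ?add0r// => k _; exact: pure0l.
- exact: Ue.
- by rewrite raddf0.
- by rewrite raddf0.
- exact: Ve.
Qed.

Lemma corep_prodP (J K : finType) (U : J -> J -> Pol) (V : K -> K -> Pol) :
  corep U -> corep V -> corep (corep_prod U V).
Proof.
move=> [UD Ue] [VD Ve]; split=> -[i k] [j l]; rewrite /corep_prod /=.
  transitivity (comult (U i j) * comult (V k l)); first exact: rmorphM.
  rewrite UD VD mulr_suml -(pair_bigA _ (fun x y =>
    pure (U i x * V k y) (U x j * V y l))) /=; apply: eq_bigr => x _.
  by rewrite mulr_sumr; apply: eq_bigr => y _; exact: pureM.
by rewrite rmorphM /= Ue Ve xpair_eqE -natrM mulnb.
Qed.

Lemma coefficient_sum (J K : finType) (U : J -> J -> Pol) (V : K -> K -> Pol) a b :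
  coefficient U a -> coefficient V b -> coefficient (corep_sum U V) (a + b).
Proof.
move=> [c ->] [d ->].
exists (fun x y => match x, y with inl i, inl j => c i j | inr i, inr j => d i j | _, _ => 0 end).
rewrite big_sumType /=; congr (_ + _); apply: eq_bigr => i _; rewrite big_sumType /=.
  by rewrite [X in _ + X]big1 ?addr0// => k _; rewrite scaler0.
by rewrite [X in X + _]big1 ?add0r// => k _; rewrite scaler0.
Qed.

Lemma coefficient_prod (J K : finType) (U : J -> J -> Pol) (V : K -> K -> Pol) a b :
  coefficient U a -> coefficient V b -> coefficient (corep_prod U V) (a * b).
Proof.
move=> [c ->] [d ->]; exists (fun x y => c x.1 y.1 * d x.2 y.2).
rewrite mulr_suml -(pair_bigA _ (fun i k =>
  \sum_y (c i y.1 * d k y.2) *: corep_prod U V (i, k) y)) /=.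
apply: eq_bigr => i _; rewrite mulr_sumr; apply: eq_bigr => k _.
rewrite mulr_suml -(pair_bigA _ (fun j l =>
  (c i j * d k l) *: corep_prod U V (i, k) (j, l))) /=.
apply: eq_bigr => j _; rewrite mulr_sumr; apply: eq_bigr => l _.
by rewrite /corep_prod /= -scalerAl -scalerAr scalerA.
Qed.

Lemma corep_pgen : corep p.
Proof.
by split=> i j; [exact: pol_hom_gen|exact: eps_pgen].
Qed.

Lemma corep_one : corep (fun _ _ : 'I_1 => 1).
Proof.
split=> i j; first by rewrite rmorph1 big_ord1.
by rewrite rmorph1 !ord1 eqxx.
Qed.

(** Local finiteness of the coalgebra: the generators are coefficients of a
corepresentation, and coefficients are stable under sums and products because
direct sums and tensor products of corepresentations are corepresentations.
It reduces every question on convolution semigroups to finite matrices. *)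
Lemma corep_exists (a : Pol) : exists (J : finType) (U : J -> J -> Pol),
  corep U /\ coefficient U a.
Proof.
elim/pol_ind: a => [i j||a b [J [U [UP Ua]]] [K [V [VP Vb]]]
    |a b [J [U [UP Ua]]] [K [V [VP Vb]]]|c a [J [U [UP Ua]]]].
- by exists _, p; split; [exact: corep_pgen|exact: corep_coefficient].
- exists _, (fun _ _ : 'I_1 => 1); split; first exact: corep_one.
  by exists (fun _ _ => 1); rewrite !big_ord1 scale1r.
- by exists _, (corep_sum U V); split; [exact: corep_sumP|exact: coefficient_sum].
- by exists _, (corep_prod U V); split; [exact: corep_prodP|exact: coefficient_prod].
- by exists _, U; split=> //; exact: coefficientZ.
Qed.

Definition functional_mx (J : finType) (U : J -> J -> Pol) (mu : Pol -> C^o) : 'M[C]_#|J| :=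
  \matrix_(x, y) mu (U (enum_val x) (enum_val y)).

Lemma functional_mx_conv (J : finType) (U : J -> J -> Pol) mu nu : corep U ->
  functional_mx U (conv mu nu) = functional_mx U mu * functional_mx U nu.
Proof.
move=> UP; apply/matrixP => x y; rewrite !mxE (conv_corep _ _ _ _ UP).
rewrite (reindex (@enum_val J J)) /=; last first.
  by apply: onW_bij; exact: enum_val_bij.
by apply: eq_bigr => k _; rewrite !mxE.
Qed.

Lemma functional_mx_eps (J : finType) (U : J -> J -> Pol) : corep U ->
  functional_mx U eps = 1.
Proof.
move=> UP; apply/matrixP => x y; rewrite !mxE UP.2.
by rewrite (inj_eq enum_val_inj).
Qed.

Lemma functional_mxE (J : finType) (U : J -> J -> Pol) (mu : Pol -> C^o) i j :
  functional_mx U mu (enum_rank i) (enum_rank j) = mu (U i j).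
Proof. by rewrite mxE !enum_rankK. Qed.

Lemma eq_on_coreps (mu nu : {linear Pol -> C^o}) :
  (forall (J : finType) (U : J -> J -> Pol), corep U -> forall i j, mu (U i j) = nu (U i j)) ->
  mu =1 nu.
Proof.
move=> h a; have [J [U [UP [c ->]]]] := corep_exists a.
rewrite !linear_sum; apply: eq_bigr => i _; rewrite !linear_sum.
by apply: eq_bigr => j _; rewrite !linearZ /= (h _ _ UP).
Qed.

End Coalgebra.

(** * Convergence of complex numbers, norms of matrices *)

Section ComplexConvergence.
Variable R : realType.
Local Notation C := R[i].
Implicit Types z w : C.

(** On R[i] the norm takes values in R[i]; the estimates below are done in R, with
normc. *)
Lemma normE z : `|z| = (normc z)%:C%C.
Proof. by case: z. Qed.

Lemma normc_ge0 z : 0 <= normc z.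
Proof. by rewrite -ler0c -normE. Qed.

Lemma normc_real (x : R) : 0 <= x -> normc (x%:C%C) = x.
Proof. by move=> x0; apply: complexI; rewrite -normE ger0_norm// ler0c. Qed.

Lemma normc_conj z : normc (z^*) = normc z.
Proof. by apply: complexI; rewrite -!normE norm_conjC. Qed.

Lemma normcB z w : normc (z - w) = normc (w - z).
Proof. by rewrite -normcN opprB. Qed.

Lemma normc_sum I (r : seq I) (F : I -> C) :
  normc (\sum_(i <- r) F i) <= \sum_(i <- r) normc (F i).
Proof.
elim: r => [|i r IH]; first by rewrite !big_nil normc0.
by rewrite !big_cons (le_trans (le_normcD _ _))// lerD2l.
Qed.

Lemma normc_Re z : `|complex.Re z| <= normc z.
Proof. by rewrite -lecR -normE; exact: normc_ge_Re. Qed.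

Lemma normc_Im z : `|complex.Im z| <= normc z.
Proof.
case: z => a b /=; rewrite -sqrtr_sqr ler_sqrt; last by rewrite addr_ge0 ?sqr_ge0.
by rewrite lerDr sqr_ge0.
Qed.

Lemma normc_le_ReIm z : normc z <= `|complex.Re z| + `|complex.Im z|.
Proof.
rewrite {1}[z]complexE (le_trans (le_normcD _ _))// normcM.
have -> : normc ('i%C : C) = 1 by rewrite /= expr0n expr1n add0r sqrtr1.
have h (x : R) : normc (x%:C%C) = `|x| by rewrite /= expr0n addr0 sqrtr_sqr.
by rewrite mul1r !h.
Qed.

Lemma cvgCP T (F : set_system T) {FF : Filter F} (f : T -> C) (l : C) :
  (f x : C^o) @[x --> F] --> (l : C^o) <->
  forall e : R, 0 < e -> \forall x \near F, normc (f x - l) < e.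
Proof.
split=> [/cvgrPdist_lt fl e e0|fl].
  have : 0 < e%:C%C by rewrite ltcR.
  by move=> /fl; apply: filterS => x; rewrite normE ltcR normcB.
apply/cvgrPdist_lt => e e0.
have er : e = (complex.Re e)%:C%C by rewrite RRe_real// gtr0_real.
move: e0; rewrite er ltcR => /fl; apply: filterS => x.
by rewrite normE ltcR normcB.
Qed.

Lemma cvgC_unique T (F : set_system T) (FF : ProperFilter F) (f : T -> C) (l l' : C) :
  (f x : C^o) @[x --> F] --> (l : C^o) -> (f x : C^o) @[x --> F] --> (l' : C^o) ->
  l = l'.
Proof. by move=> h h'; exact: (cvg_unique (@norm_hausdorff _ C^o) h h'). Qed.

Lemma cauchyC T (F : set_system T) (FF : ProperFilter F) (f : T -> C) :
  (forall e : R, 0 < e -> \forall x & y \near F, normc (f x - f y) < e) ->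
  exists l : C, (f x : C^o) @[x --> F] --> (l : C^o).
Proof.
move=> fC.
have part (g : C -> R) : (forall z w, g (z - w) = g z - g w) ->
    (forall z, `|g z| <= normc z) -> exists l : R, g (f x) @[x --> F] --> l.
  move=> gB gN.
  have : cvg (g \o f @ F).
    apply: cauchy_cvg; apply/cauchy_ballP => e e0.
    have [[P Q] /= [FP FQ] PQ] := fC e e0.
    exists ([set y | exists2 x, P x & y = g (f x)], [set y | exists2 x, Q x & y = g (f x)]) => /=.
      by split; [apply: filterS FP|apply: filterS FQ] => x ?; exists x.
    move=> [_ _] /= [[x Px ->] [y Qy ->]].
    rewrite -ball_normE /= -gB (le_lt_trans (gN _))//.
    exact: (PQ (x, y)).
  by move=> /cvg_ex[l gl]; exists l.
have [a fa] := part (@complex.Re R) (fun z w => ltac:(by case: z; case: w)) normc_Re.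
have [b fb] := part (@complex.Im R) (fun z w => ltac:(by case: z; case: w)) normc_Im.
exists (Complex a b); apply/cvgCP => e e0.
move/cvgrPdist_lt: fa => /(_ (e / 2)) fa; move/cvgrPdist_lt: fb => /(_ (e / 2)) fb.
have e2 : 0 < e / 2 by rewrite divr_gt0.
near=> x; rewrite (le_lt_trans (normc_le_ReIm _))// [e]splitr ltrD//.
  have -> : complex.Re (f x - Complex a b) = complex.Re (f x) - a by case: (f x).
  by rewrite distrC; near: x; exact: fa.
have -> : complex.Im (f x - Complex a b) = complex.Im (f x) - b by case: (f x).
by rewrite distrC; near: x; exact: fb.
Unshelve. all: by end_near. Qed.

Lemma normc_limit_ge0 (z : C) :
  (forall e : R, 0 < e -> exists2 x : C, 0 <= x & normc (x - z) <= e) -> 0 <= z.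
Proof.
move=> h.
have near0 (e : R) : 0 < e -> - e <= complex.Re z /\ `|complex.Im z| <= e.
  move=> /h[x]; rewrite lecE => /andP[/eqP Im0 Re0] xz; split.
    have := le_trans (normc_Re _) xz.
    have -> : complex.Re (x - z) = complex.Re x - complex.Re z by case: (x); case: (z).
    by rewrite ler_norml => /andP[_]; move: Re0 => /=; lra.
  have := le_trans (normc_Im _) xz.
  have -> : complex.Im (x - z) = complex.Im x - complex.Im z by case: (x); case: (z).
  by rewrite Im0 /= sub0r normrN.
rewrite lecE /=; apply/andP; split.
  rewrite -normr_eq0 eq_le normr_ge0 andbT.
  by apply/ler_addgt0Pl => e e0; rewrite addr0; have [] := near0 e e0.
by apply/ler_addgt0Pl => e e0; have [h1 _] := near0 e e0; lra.
Qed.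

Lemma cvgC_ge0 T (F : set_system T) (FF : ProperFilter F) (f : T -> C) (l : C) :
  (f x : C^o) @[x --> F] --> (l : C^o) -> (\forall x \near F, 0 <= f x) -> 0 <= l.
Proof.
move=> /cvgCP fl f0; apply: normc_limit_ge0 => e /fl fle; near F => x.
by exists (f x); [near: x|apply: ltW; near: x].
Unshelve. all: by end_near. Qed.

End ComplexConvergence.

Section MatrixNorm.
Variables (R : realType) (N : nat).
Local Notation C := R[i].
Local Notation M := 'M[C]_N.
Implicit Types A B X Y : M.

(** The entrywise sum is submultiplicative, but its value at the identity is N;
so powers are estimated through the distance of X to 1 rather than through the
norm of X. *)
Definition mxnorm A : R := \sum_i \sum_j normc (A i j).

Lemma mxnorm_ge0 A : 0 <= mxnorm A.
Proof. by do 2!(apply: sumr_ge0 => ? _); exact: normc_ge0. Qed.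

Lemma mxnormD A B : mxnorm (A + B) <= mxnorm A + mxnorm B.
Proof.
rewrite /mxnorm -big_split ler_sum// => i _; rewrite -big_split ler_sum// => j _.
by rewrite mxE le_normcD.
Qed.

Lemma mxnorm0 : mxnorm 0 = 0.
Proof. by rewrite /mxnorm big1// => i _; rewrite big1// => j _; rewrite mxE normc0. Qed.

Lemma mxnormN A : mxnorm (- A) = mxnorm A.
Proof. by apply: eq_bigr => i _; apply: eq_bigr => j _; rewrite mxE normcN. Qed.

Lemma mxnormB A B : mxnorm (A - B) = mxnorm (B - A).
Proof. by rewrite -mxnormN opprB. Qed.

Lemma mxnormZ c A : mxnorm (c *: A) = normc c * mxnorm A.
Proof.
rewrite /mxnorm mulr_sumr; apply: eq_bigr => i _; rewrite mulr_sumr.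
by apply: eq_bigr => j _; rewrite mxE normcM.
Qed.

Lemma mxnormM A B : mxnorm (A * B) <= mxnorm A * mxnorm B.
Proof.
rewrite /mxnorm mulr_suml ler_sum// => i _.
rewrite (@le_trans _ _ (\sum_j \sum_k normc (A i k) * normc (B k j)))//.
  rewrite ler_sum// => j _; rewrite mxE (le_trans (normc_sum _ _))//.
  by rewrite ler_sum// => k _; rewrite normcM.
rewrite exchange_big /= mulr_suml ler_sum// => k _.
rewrite -mulr_sumr ler_wpM2l ?normc_ge0//.
by rewrite [leRHS](bigD1 k)//= lerDl sumr_ge0// => l _; rewrite sumr_ge0// => j _; exact: normc_ge0.
Qed.

Lemma normc_mxnorm A i j : normc (A i j) <= mxnorm A.
Proof.
rewrite /mxnorm (bigD1 i)//= (bigD1 j)//= -addrA lerDl addr_ge0// sumr_ge0// => k _.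
  exact: normc_ge0.
by rewrite sumr_ge0// => l _; exact: normc_ge0.
Qed.

Lemma mxnorm_eq0 A : mxnorm A = 0 -> A = 0.
Proof.
move=> A0; apply/matrixP => i j; rewrite mxE; apply: eq0_normc.
by apply/eqP; rewrite eq_le normc_ge0 andbT -A0 normc_mxnorm.
Qed.

Lemma mxnorm_small A : (forall e, 0 < e -> mxnorm A <= e) -> A = 0.
Proof.
move=> h; apply: mxnorm_eq0; apply/eqP; rewrite eq_le mxnorm_ge0 andbT.
by apply/ler_addgt0Pl => e e0; rewrite addr0 h.
Qed.

Lemma mxnorm_mul1D X Y : mxnorm (X * Y) <= (1 + mxnorm (X - 1)) * mxnorm Y.
Proof.
rewrite -[X in X * Y](subrK 1) mulrDl mul1r (le_trans (mxnormD _ _))//.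
by rewrite [leRHS]mulrDl mul1r addrC lerD2l mxnormM.
Qed.

Lemma mxnorm_mulD1 X Y : mxnorm (Y * X) <= mxnorm Y * (1 + mxnorm (X - 1)).
Proof.
rewrite -[X in Y * X](subrK 1) mulrDr mulr1 (le_trans (mxnormD _ _))//.
by rewrite [leRHS]mulrDr mulr1 addrC lerD2l mxnormM.
Qed.

Lemma mxnorm_mulX X Y k m : mxnorm (X - 1) <= k ->
  mxnorm (Y * X ^+ m) <= mxnorm Y * (1 + k) ^+ m.
Proof.
move=> Xk; have k0 : 0 <= 1 + k by rewrite addr_ge0// (le_trans _ Xk)// mxnorm_ge0.
elim: m => [|m IH]; first by rewrite !expr0 !mulr1.
rewrite exprSr mulrA (le_trans (mxnorm_mulD1 _ _))//.
rewrite exprSr mulrA ler_pM ?mxnorm_ge0//; first by rewrite addr_ge0 ?mxnorm_ge0.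
by rewrite lerD2l.
Qed.

(** Telescoping X^m - Y^m. If X and Y are within O(1/m) of the identity, then
the factor (1 + k)^m stays bounded and only m |X - Y| matters. *)
Lemma mxnorm_expB X Y k m : mxnorm (X - 1) <= k -> mxnorm (Y - 1) <= k ->
  mxnorm (X ^+ m - Y ^+ m) <= m%:R * (1 + k) ^+ m * mxnorm (X - Y).
Proof.
move=> Xk Yk; have k0 : 0 <= k by rewrite (le_trans _ Xk)// mxnorm_ge0.
elim: m => [|m IH]; first by rewrite !expr0 subrr mxnorm0 !mul0r.
have -> : X ^+ m.+1 - Y ^+ m.+1 = X * (X ^+ m - Y ^+ m) + (X - Y) * Y ^+ m.
  by rewrite !exprS mulrBr mulrBl addrA subrK.
rewrite (le_trans (mxnormD _ _))//.
have h1 : mxnorm (X * (X ^+ m - Y ^+ m)) <=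
    (1 + k) * (m%:R * (1 + k) ^+ m * mxnorm (X - Y)).
  rewrite (le_trans (mxnorm_mul1D _ _))// ler_pM ?mxnorm_ge0//; last by rewrite lerD2l.
  by rewrite addr_ge0 ?mxnorm_ge0.
have h2 : mxnorm ((X - Y) * Y ^+ m) <= mxnorm (X - Y) * (1 + k) ^+ m.+1.
  rewrite (le_trans (mxnorm_mulX _ _ Yk))// ler_wpM2l ?mxnorm_ge0//.
  by rewrite exprSr ler_peMr ?exprn_ge0 ?addr_ge0// lerDl.
rewrite (le_trans (lerD h1 h2))// -natr1 exprS.
set p := (1 + k) ^+ m; set d := mxnorm _; set c : R := m%:R.
by rewrite le_eqVlt; apply/orP; left; apply/eqP; ring.
Qed.

Lemma mxnorm_expB_lin B m :
  mxnorm ((1 + B) ^+ m - 1 - m%:R *: B) <= (m%:R * mxnorm B) ^+ 2 * (1 + mxnorm B) ^+ m.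
Proof.
elim: m => [|m IH].
  by rewrite expr0 subrr scale0r subr0 mxnorm0 mul0r expr0n mul0r.
have -> : (1 + B) ^+ m.+1 - 1 - m.+1%:R *: B =
    (1 + B) * ((1 + B) ^+ m - 1 - m%:R *: B) + m%:R *: (B * B).
  have scalerr c X Y : X * (c *: Y) = c *: (X * Y) by exact: esym (scalemxAr _ _ _).
  rewrite !mulrBr mulr1 -exprS scalerr mulrDl mul1r scalerDr !opprD !addrA subrK.
  by rewrite -natr1 scalerDl scale1r !opprD !addrA [_ - B - _]addrAC.
rewrite (le_trans (mxnormD _ _))// mxnormZ.
have b0 := mxnorm_ge0 B; set b := mxnorm B in b0 IH *.
have h1 : mxnorm ((1 + B) * ((1 + B) ^+ m - 1 - m%:R *: B)) <=
    (1 + b) * ((m%:R * b) ^+ 2 * (1 + b) ^+ m).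
  have Bb : mxnorm (1 + B - 1) = b by rewrite (addrC 1 B) addrK.
  have := mxnorm_mul1D (1 + B) ((1 + B) ^+ m - 1 - m%:R *: B).
  by rewrite Bb => /le_trans; apply; rewrite ler_wpM2l// addr_ge0.
have nm : normc (m%:R : C) = m%:R by rewrite -(rmorph_nat (real_complex R)) normc_real.
have h2 : normc (m%:R : C) * mxnorm (B * B) <= m%:R * b ^+ 2 * (1 + b) ^+ m.+1.
  rewrite nm -mulrA ler_wpM2l// (le_trans (mxnormM _ _))// -/b -expr2.
  by rewrite ler_peMr ?exprn_ge0// exprn_ege1// lerDl.
rewrite (le_trans (lerD h1 h2))//.
have p0 : 0 <= (1 + b) ^+ m by rewrite exprn_ge0// addr_ge0.
have c0 : 0 <= m%:R :> R by [].
rewrite [(1 + b) ^+ m.+1]exprS -natr1 -subr_ge0; set c : R := m%:R in c0 *; set p := _ ^+ m in p0 *.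
suff -> : ((c + 1) * b) ^+ 2 * ((1 + b) * p) -
  ((1 + b) * ((c * b) ^+ 2 * p) + c * b ^+ 2 * ((1 + b) * p)) =
  b ^+ 2 * ((1 + b) * p) * (c + 1) by rewrite !mulr_ge0 ?sqr_ge0 ?addr_ge0.
by ring.
Qed.

End MatrixNorm.

(** * One-parameter semigroups of matrices *)

Section MatrixSemigroup.
Variables (R : realType) (N : nat).
Local Notation C := R[i].
Local Notation M := 'M[C]_N.
Implicit Types (A B : M) (T : R -> M) (X Y : nat -> M).

Definition semigroup T := T 0 = 1 /\ forall s t, 0 <= s -> 0 <= t -> T (s + t) = T s * T t.

Definition has_generator T A := forall e : R, 0 < e ->
  exists2 d : R, 0 < d & forall t, 0 < t -> t < d ->
    mxnorm (T t - 1 - t%:C%C *: A) <= e * t.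

Lemma normc_nat m : normc (m%:R : C) = m%:R.
Proof. by rewrite -(rmorph_nat (real_complex R)) normc_real. Qed.

Lemma exp_bound (K : R) m : 0 <= K -> (0 < m)%N -> (1 + K / m%:R) ^+ m <= expR K.
Proof.
move=> K0 m0; have mR : 0 < m%:R :> R by rewrite ltr0n.
have KE : K = m%:R * (K / m%:R) by rewrite mulrCA mulfV ?mulr1// gt_eqF.
rewrite [in leRHS]KE expRM_natl lerXn2r ?nnegrE ?expR_ge0//.
  by rewrite addr_ge0// divr_ge0// ltW.
exact: expR_ge1Dx.
Qed.

Lemma near_inv (c e : R) : 0 < e -> \forall m \near \oo, c / m%:R <= e.
Proof.
move=> e0; pose k := (Num.truncn (`|c| / e)).+1.
have kE : `|c| / e < k%:R by rewrite truncnS_gt.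
near=> m; have km : (k <= m)%N by near: m; exact: nbhs_infty_ge.
have kmR : k%:R <= m%:R :> R by rewrite ler_nat.
have m0 : 0 < m%:R :> R by rewrite (lt_le_trans _ kmR)// ltr0n.
rewrite ler_pdivrMr// (le_trans (ler_norm _))// mulrC -ler_pdivrMr// ltW//.
exact: lt_le_trans kmR.
Unshelve. all: by end_near. Qed.

Lemma power_approx X Y (K : R) : 0 <= K ->
  (\forall m \near \oo, mxnorm (X m - 1) <= K / m%:R) ->
  (\forall m \near \oo, mxnorm (Y m - 1) <= K / m%:R) ->
  (forall e : R, 0 < e -> \forall m \near \oo, m%:R * mxnorm (X m - Y m) <= e) ->
  forall e : R, 0 < e -> \forall m \near \oo, mxnorm (X m ^+ m - Y m ^+ m) <= e.
Proof.
move=> K0 XK YK XY e e0.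
have eK : 0 < e / expR K by rewrite divr_gt0// expR_gt0.
near=> m; have m0 : (0 < m)%N by near: m; exact: nbhs_infty_gt.
have h1 : mxnorm (X m - 1) <= K / m%:R by near: m.
have h2 : mxnorm (Y m - 1) <= K / m%:R by near: m.
rewrite (le_trans (mxnorm_expB _ h1 h2))// mulrAC.
have h3 : m%:R * mxnorm (X m - Y m) <= e / expR K by near: m; exact: XY.
rewrite (@le_trans _ _ (e / expR K * expR K))//.
  rewrite ler_pM ?exp_bound ?mulr_ge0 ?mxnorm_ge0//.
  by rewrite exprn_ge0// addr_ge0// divr_ge0.
by rewrite mulfVK// gt_eqF// expR_gt0.
Unshelve. all: by end_near. Qed.

Lemma semigroup_exp T s m : semigroup T -> 0 <= s -> T (m%:R * s) = T s ^+ m.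
Proof.
move=> [T0 TD] s0; elim: m => [|m IH]; first by rewrite mul0r T0 expr0.
by rewrite -natr1 mulrDl mul1r TD ?mulr_ge0// IH exprSr.
Qed.

(** X m = 1 + (t/m) A + o(1/m). This is all that the limit of the powers
(X m)^m depends on. *)
Definition tangent (t : R) X A := forall e : R, 0 < e ->
  \forall m \near \oo, m%:R * mxnorm (X m - 1 - (t / m%:R)%:C%C *: A) <= e.

Lemma tangent_bound t X A : 0 <= t -> tangent t X A ->
  \forall m \near \oo, mxnorm (X m - 1) <= (1 + t * mxnorm A) / m%:R.
Proof.
move=> t0 /(_ 1 ltr01) XA; near=> m.
have m0 : 0 < m%:R :> R by rewrite ltr0n; near: m; exact: nbhs_infty_gt.
rewrite ler_pdivlMr// mulrC.
have -> : X m - 1 = (X m - 1 - (t / m%:R)%:C%C *: A) + (t / m%:R)%:C%C *: A by rewrite subrK.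
rewrite (le_trans (ler_wpM2l (ltW m0) (mxnormD _ _)))// mulrDr lerD//; first by near: m.
rewrite mxnormZ normc_real ?divr_ge0 ?(ltW m0)// mulrA.
by rewrite [_ * (t / _)]mulrCA mulfV ?mulr1// gt_eqF.
Unshelve. all: by end_near. Qed.

(** Both sequences are within O(1/m) of the identity, so that their m-th powers
differ by at most a constant times m |X m - Y m|, which tends to 0. *)
Lemma tangent_power t X Y A : 0 <= t -> tangent t X A -> tangent t Y A ->
  forall e : R, 0 < e -> \forall m \near \oo, mxnorm (X m ^+ m - Y m ^+ m) <= e.
Proof.
move=> t0 XA YA.
apply: (@power_approx _ _ (1 + t * mxnorm A)); try exact: tangent_bound.
  by rewrite addr_ge0// mulr_ge0// mxnorm_ge0.
move=> e e0; have e2 : 0 < e / 2 by rewrite divr_gt0.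
pose B m := (t / m%:R)%:C%C *: A.
near=> m; have -> : X m - Y m = (X m - 1 - B m) - (Y m - 1 - B m).
  by rewrite -[X m - 1 - B m]addrA -[Y m - 1 - B m]addrA opprD addrACA subrr addr0.
rewrite (le_trans (ler_wpM2l (ler0n _ _) (mxnormD _ _)))// mxnormN mulrDr [e]splitr lerD//.
  by near: m; exact: XA.
by near: m; exact: YA.
Unshelve. all: by end_near. Qed.

Lemma generator_tangent T A t : semigroup T -> has_generator T A -> 0 <= t ->
  tangent t (fun m => T (t / m%:R)) A.
Proof.
move=> [T0 _] TA t0 e e0.
move: t0; rewrite le_eqVlt => /predU1P[<-|t0].
  by near=> m; rewrite mul0r T0 subrr scale0r subrr mxnorm0 mulr0 ltW.
have [d d0 dP] := TA (e / t) (divr_gt0 e0 t0).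
near=> m; have m0 : 0 < m%:R :> R by rewrite ltr0n; near: m; exact: nbhs_infty_gt.
have tm : t / m%:R < d.
  rewrite (@le_lt_trans _ _ (d / 2))//; last by rewrite ltr_pdivrMr//; lra.
  by near: m; apply: near_inv; rewrite divr_gt0.
rewrite (le_trans (ler_wpM2l (ltW m0) (dP _ (divr_gt0 t0 m0) tm)))//.
rewrite le_eqVlt; apply/orP; left; apply/eqP; field.
by rewrite !gt_eqF.
Unshelve. all: by end_near. Qed.

Lemma semigroup_root T t m : semigroup T -> 0 <= t -> (0 < m)%N ->
  T t = T (t / m%:R) ^+ m.
Proof.
move=> sT t0 m0; rewrite -semigroup_exp ?divr_ge0//.
by rewrite mulrCA mulfV ?mulr1// pnatr_eq0 -lt0n.
Qed.

(** A semigroup is an exact power, T t = (T (t/m))^m, and T (t/m) is tangent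
to A; so it is the limit of the powers of any sequence tangent to A. The Euler
scheme and the positive step of the positivity proof are both of this form, and
uniqueness of the semigroup with a given generator is another instance. *)
Lemma semigroup_approx T A t X : semigroup T -> has_generator T A -> 0 <= t ->
  tangent t X A ->
  forall e : R, 0 < e -> \forall m \near \oo, mxnorm (X m ^+ m - T t) <= e.
Proof.
move=> sT TA t0 XA e e0.
have h := tangent_power t0 XA (generator_tangent sT TA t0) e0.
near=> m; have m0 : (0 < m)%N by near: m; exact: nbhs_infty_gt.
by rewrite (semigroup_root sT t0 m0); near: m.
Unshelve. all: by end_near. Qed.

Lemma semigroup_unique T T' A : semigroup T -> semigroup T' ->
  has_generator T A -> has_generator T' A -> forall t, 0 <= t -> T t = T' t.
Proof.
move=> sT sT' TA TA' t t0; apply/eqP; rewrite -subr_eq0; apply/eqP.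
apply: mxnorm_small => e e0.
have h := semigroup_approx sT TA t0 (generator_tangent sT' TA' t0) e0.
near \oo => m; have m0 : (0 < m)%N by near: m; exact: nbhs_infty_gt.
by rewrite mxnormB (semigroup_root sT' t0 m0); near: m.
Unshelve. all: by end_near. Qed.

Lemma mxnorm_cvg S (F : set_system S) (FF : Filter F) (f : S -> M) A :
  (forall i j, (f x i j : C^o) @[x --> F] --> (A i j : C^o)) ->
  forall e : R, 0 < e -> \forall x \near F, mxnorm (f x - A) <= e.
Proof.
move=> fA e e0; pose e' := e / (N * N).+1%:R.
have e'0 : 0 < e' by rewrite divr_gt0.
have : \forall x \near F, forall i, forall j, normc (f x i j - A i j) < e'.
  apply: filter_forall => i; apply: filter_forall => j.
  by have /cvgCP := fA i j; apply.
apply: filterS => x fx.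
rewrite (@le_trans _ _ (\sum_(i < N) \sum_(j < N) e'))//.
  by rewrite ler_sum// => i _; rewrite ler_sum// => j _; rewrite !mxE ltW.
rewrite !sumr_const !card_ord -mulrnA -mulr_natl mulrCA ger_pMr// ler_pdivrMr// mul1r ler_nat.
exact: leqnSn.
Qed.

(** X^m - 1 is the sum of the X^i (X - 1) over i < m, and each X^i is close to
the identity. *)
Lemma exp_sub1_lin (X : M) m (c : R) : (forall i, (i < m)%N -> mxnorm (X ^+ i - 1) <= c) ->
  mxnorm (X ^+ m - 1 - m%:R *: (X - 1)) <= m%:R * c * mxnorm (X - 1).
Proof.
elim: m => [|m IH] Xc; first by rewrite expr0 subrr scale0r subr0 mxnorm0 !mul0r.
have -> : X ^+ m.+1 - 1 - m.+1%:R *: (X - 1) =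
    (X ^+ m - 1 - m%:R *: (X - 1)) + (X ^+ m - 1) * (X - 1).
  rewrite -natr1 scalerDl scale1r mulrBr mulr1 mulrBl mul1r -exprSr.
  set c1 := m%:R *: (X - 1); set Z := X ^+ m; set W := X ^+ m.+1.
  apply/eqP; rewrite -subr_eq0; apply/eqP.
  by rewrite !opprD !opprK; apply/matrixP => i j; rewrite !mxE; ring.
rewrite (le_trans (mxnormD _ _))// -natr1 -[_ * c * _]mulrA [leRHS]mulrDl mul1r mulrA lerD//.
  by apply: IH => i im; apply: Xc; apply: ltnW.
by rewrite (le_trans (mxnormM _ _))// ler_wpM2r ?mxnorm_ge0// Xc.
Qed.

Section Differentiability.
Variable T : R -> M.
Hypothesis sT : semigroup T.
Hypothesis T1 : forall e : R, 0 < e ->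
  exists2 d : R, 0 < d & forall t, 0 < t -> t < d -> mxnorm (T t - 1) <= e.

(** Continuity at 0 improves to a Lipschitz estimate: compare T s - 1 with
T (m s) - 1 for m s close to h/2. By exp_sub1_lin, m (T s - 1) differs from
T (m s) - 1 by at most half of its own norm, while T (m s) - 1 has norm at most
1/2; so |T s - 1| <= 1/m, which is of order s. *)
Let T_lip : exists h K : R, [/\ 0 < h, 0 < K & forall s, 0 <= s -> s < h ->
  mxnorm (T s - 1) <= K * s /\ mxnorm (T s - 1) <= 1].
Proof.
have [h h0 hP] := T1 (divr_gt0 (@ltr01 R) (@ltr0n R 2)).
have hP0 s : 0 <= s -> s < h -> mxnorm (T s - 1) <= 1 / 2.
  rewrite le_eqVlt => /predU1P[<- _|]; last exact: hP.
  by rewrite sT.1 subrr mxnorm0 divr_ge0.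
exists (h / 2), (4 / h); split; rewrite ?divr_gt0// => s s0 sh.
split; last by rewrite (le_trans (hP0 s s0 _)); lra.
move: s0; rewrite le_eqVlt => /predU1P[<-|s0].
  by rewrite sT.1 subrr mxnorm0 mulr0.
pose m := Num.truncn (h / 2 / s).
have /andP[mle mlt] : m%:R <= h / 2 / s < m.+1%:R.
  by apply: truncn_itv; rewrite !divr_ge0// ltW.
have m0 : (0 < m)%N.
  rewrite lt0n; apply/negP => /eqP m0; move: mlt; rewrite m0 ltr_pdivrMr// mul1r.
  by rewrite ltNge ltW.
have msle : m%:R * s <= h / 2 by rewrite -ler_pdivlMr.
have mslt : h / 2 < (m%:R + 1) * s by rewrite natr1 -ltr_pdivrMr.
have m1 : 1 <= m%:R :> R by rewrite ler1n.
have Ti i : (i <= m)%N -> mxnorm (T s ^+ i - 1) <= 1 / 2.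
  move=> im; rewrite -(semigroup_exp _ sT (ltW s0)); apply: hP0; first by rewrite mulr_ge0// ltW.
  rewrite (@le_lt_trans _ _ (m%:R * s))//; first by rewrite ler_wpM2r ?ler_nat// ltW.
  by lra.
have lin := exp_sub1_lin (fun i (im : (i < m)%N) => Ti i (ltnW im)).
have Tm := Ti m (leqnn m).
have : m%:R * mxnorm (T s - 1) <= 1 / 2 + m%:R * (1 / 2) * mxnorm (T s - 1).
  rewrite -{1}normc_nat -mxnormZ.
  have -> : m%:R *: (T s - 1) = (T s ^+ m - 1) - (T s ^+ m - 1 - m%:R *: (T s - 1)).
    by rewrite opprB [RHS]addrC subrK.
  by rewrite (le_trans (mxnormD _ _))// mxnormN lerD.
have n0 := mxnorm_ge0 (T s - 1); set n := mxnorm _ in n0 *; set c : R := m%:R in m1 mslt *.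
move=> mn; have cn : c * n <= 1 by lra.
rewrite mulrAC ler_pdivlMr//.
have h1 : h * n <= 2 * ((c + 1) * s) * n by rewrite ler_wpM2r//; lra.
have h2 : (c + 1) * s * n <= 2 * s.
  have -> : (c + 1) * s * n = (c * n + n) * s by ring.
  rewrite ler_wpM2r ?(ltW s0)//.
  have : n <= c * n by rewrite ler_peMl.
  lra.
lra.
Qed.

(** Write t = m s + r with r < s and compare T t - 1 with m (T s - 1): the
product rule costs t^2 by the Lipschitz estimate, and the remainder r and the
rounding of t/s cost a multiple of s. *)
Lemma semigroup_slopes : exists h K : R, [/\ 0 < h, 0 < K &
  forall s t, 0 < s -> s <= t -> t < h ->
  mxnorm ((T t - 1) - (t / s)%:C%C *: (T s - 1)) <= K * (t * t + s)].
Proof.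
have [h [K [h0 K0 TK]]] := T_lip.
exists h, (K * K + 3 * K); split=> //; first by rewrite addr_gt0 ?mulr_gt0.
move=> s t s0 st th.
have t0 : 0 < t by exact: lt_le_trans st.
pose m := Num.truncn (t / s); pose r := t - m%:R * s.
have /andP[mle mlt] : m%:R <= t / s < m.+1%:R.
  by apply: truncn_itv; rewrite divr_ge0// ltW.
have mst : m%:R * s <= t by rewrite -ler_pdivlMr.
have r0 : 0 <= r by rewrite subr_ge0.
have rs : r < s.
  have : t < (m%:R + 1) * s by rewrite natr1 -ltr_pdivrMr.
  by rewrite /r; lra.
have ms0 : 0 <= m%:R * s by rewrite mulr_ge0// ltW.
have sh : s < h by exact: le_lt_trans th.
have rh : r < h by exact: lt_trans sh.
have msh : m%:R * s < h by exact: le_lt_trans th.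
have Ti i : (i < m)%N -> mxnorm (T s ^+ i - 1) <= K * t.
  move=> im; rewrite -(semigroup_exp _ sT (ltW s0)).
  have ims : i%:R * s <= t by rewrite (le_trans _ mst)// ler_wpM2r ?(ltW s0)// ler_nat ltnW.
  have is0 : 0 <= i%:R * s by rewrite mulr_ge0// ltW.
  rewrite (le_trans (TK _ is0 (le_lt_trans ims th)).1)//.
  by rewrite ler_wpM2l// ltW.
have lin := exp_sub1_lin Ti.
have [Ts _] := TK s (ltW s0) sh.
have [Tr _] := TK r r0 rh.
have [_ Tms] := TK _ ms0 msh.
have tE : t = m%:R * s + r by rewrite /r addrC subrK.
have TtE : T t - T (m%:R * s) = T (m%:R * s) * (T r - 1).
  by rewrite mulrBr mulr1 {1}tE sT.2.
have -> : (T t - 1) - (t / s)%:C%C *: (T s - 1) = (T t - T (m%:R * s)) +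
    (T s ^+ m - 1 - m%:R *: (T s - 1)) - (r / s)%:C%C *: (T s - 1).
  rewrite -(semigroup_exp _ sT (ltW s0)).
  have -> : (t / s)%:C%C = m%:R + (r / s)%:C%C :> C.
    rewrite -(rmorph_nat (real_complex R)) -rmorphD; congr (_%:C%C).
    by rewrite {1}tE mulrDl mulfK// gt_eqF.
  rewrite scalerDl opprD addrA; congr (_ - _).
  by rewrite [in RHS]addrA [in RHS]addrA subrK.
have e1 : mxnorm (T t - T (m%:R * s)) <= 2 * (K * s).
  rewrite TtE (le_trans (mxnorm_mul1D _ _))// ler_pM ?mxnorm_ge0//.
  - by rewrite addr_ge0// mxnorm_ge0.
  - by lra.
  - by rewrite (le_trans Tr)// ler_wpM2l ?(ltW K0) ?(ltW rs).
have e2 : mxnorm (T s ^+ m - 1 - m%:R *: (T s - 1)) <= K * K * (t * t).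
  rewrite (le_trans lin)// (@le_trans _ _ (m%:R * (K * t) * (K * s)))//.
    by rewrite ler_wpM2l// !mulr_ge0// ltW.
  have -> : m%:R * (K * t) * (K * s) = K * K * (t * (m%:R * s)) by ring.
  by rewrite !ler_wpM2l ?mulr_ge0// ltW.
have e3 : mxnorm ((r / s)%:C%C *: (T s - 1)) <= K * s.
  rewrite mxnormZ normc_real ?divr_ge0 ?(ltW s0) ?r0// (@le_trans _ _ (1 * mxnorm (T s - 1)))//.
    by rewrite ler_wpM2r ?mxnorm_ge0// ler_pdivrMr// mul1r ltW.
  by rewrite mul1r.
rewrite (le_trans (mxnormD _ _))// mxnormN.
rewrite (le_trans (lerD (le_trans (mxnormD _ _) (lerD e1 e2)) e3))//.
have : 0 <= 3 * K * (t * t) by rewrite !mulr_ge0// ltW.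
have : 0 <= K * K * s by rewrite !mulr_ge0// ltW.
lra.
Qed.

(** After division by t, semigroup_slopes says that the difference quotients at
s <= t differ by O(t + s/t). Choosing first t small and then s small compared
with t shows that they form a Cauchy family. *)
Lemma semigroup_generator : exists A, has_generator T A.
Proof.
have [h [K [h0 K0 slope]]] := semigroup_slopes.
pose D t : M := (t^-1)%:C%C *: (T t - 1).
have DB s t : 0 < s -> s <= t -> t < h -> mxnorm (D t - D s) <= K * (t + s / t).
  move=> s0 st th; have t0 : 0 < t by exact: lt_le_trans st.
  have -> : D t - D s = (t^-1)%:C%C *: ((T t - 1) - (t / s)%:C%C *: (T s - 1)).
    have tt1 : t^-1 * (t / s) = s^-1 by rewrite mulrA mulVf ?mul1r// gt_eqF.
    by rewrite scalerBr scalerA -rmorphM tt1.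
  rewrite mxnormZ normc_real ?invr_ge0 ?(ltW t0)// (le_trans (ler_wpM2l _ (slope _ _ s0 st th)))//.
    by rewrite invr_ge0 ltW.
  by rewrite le_eqVlt; apply/orP; left; apply/eqP; field; rewrite gt_eqF.
have Dcauchy e : 0 < e -> exists2 d : R, 0 < d & forall s s', 0 < s -> s < d -> 0 < s' -> s' < d ->
    mxnorm (D s - D s') < e.
  move=> e0; pose t := Num.min (h / 2) (e / (8 * K)).
  have t0 : 0 < t by rewrite lt_min !divr_gt0// mulr_gt0.
  have th : t < h by rewrite gt_min ltr_pdivrMr// mulr2n; apply/orP; left; lra.
  have Kt : K * t <= e / 8.
    rewrite -ler_pdivlMl// (le_trans (y := e / (8 * K)))// ?ge_min ?lexx ?orbT//.
    by rewrite le_eqVlt; apply/orP; left; apply/eqP; field; rewrite gt_eqF.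
  pose d := Num.min t (t * (e / (8 * K))).
  have d0 : 0 < d by rewrite lt_min t0 mulr_gt0// divr_gt0// mulr_gt0.
  have Dt s : 0 < s -> s < d -> mxnorm (D t - D s) < e / 2.
    move=> s0 sd; have st : s <= t by rewrite ltW// (lt_le_trans sd)// ge_min lexx.
    rewrite (le_lt_trans (DB _ _ s0 st th))// mulrDr.
    have : K * (s / t) <= e / 8.
      rewrite -ler_pdivlMl// ler_pdivrMr//.
      rewrite (le_trans (ltW sd))// ge_min; apply/orP; right.
      by rewrite le_eqVlt; apply/orP; left; apply/eqP; field; rewrite gt_eqF.
    lra.
  exists d => // s s' s0 sd s'0 s'd.
  have -> : D s - D s' = (D t - D s') - (D t - D s) by rewrite opprB [RHS]addrC addrA subrK.
  rewrite (le_lt_trans (mxnormD _ _))// mxnormN [e]splitr addrC ltrD//.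
    exact: Dt.
  exact: Dt.
have near_small d : 0 < d -> \forall s \near 0^'+, 0 < s < d.
  move=> d0; near=> s; apply/andP; split; first by near: s; exact: nbhs_right_gt.
  by near: s; exact: nbhs_right_lt.
have entry i j : exists l : C, (D s i j : C^o) @[s --> 0^'+] --> (l : C^o).
  apply: cauchyC => e /Dcauchy[d d0 dP].
  exists ([set s | 0 < s < d], [set s | 0 < s < d]) => /=; first by split; exact: near_small.
  move=> [s s'] /= [/andP[s0 sd] /andP[s'0 s'd]].
  rewrite (le_lt_trans _ (dP s s' s0 sd s'0 s'd))//.
  by rewrite (le_trans _ (normc_mxnorm _ i j))// !mxE.
pose A : M := \matrix_(i, j) projT1 (cid (entry i j)).
have DA : forall e : R, 0 < e -> \forall s \near 0^'+, mxnorm (D s - A) <= e.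
  by apply: mxnorm_cvg => i j; rewrite mxE; case: cid.
exists A => e e0; exists (Num.min h (e / (2 * K))).
  by rewrite lt_min h0 divr_gt0// mulr_gt0.
move=> t t0; rewrite lt_min => /andP[th te].
have Kt : K * t <= e / 2.
  rewrite -ler_pdivlMl// (le_trans (ltW te))//.
  by rewrite le_eqVlt; apply/orP; left; apply/eqP; field; rewrite gt_eqF.
have e8 : 0 < e / 8 by rewrite divr_gt0.
near (0 : R)^'+ => s.
have DsA : mxnorm (D s - A) <= e / 8 by near: s; exact: DA.
have /andP[s0 sd] : 0 < s < Num.min t (t * (e / (8 * K))).
  by near: s; apply: near_small; rewrite lt_min t0 mulr_gt0// divr_gt0// mulr_gt0.
move: sd; rewrite lt_min => /andP[st se].
have Ks : K * (s / t) <= e / 8.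
  rewrite -ler_pdivlMl// ler_pdivrMr// (le_trans (ltW se))//.
  by rewrite le_eqVlt; apply/orP; left; apply/eqP; field; rewrite gt_eqF.
have -> : T t - 1 - t%:C%C *: A = t%:C%C *: ((D t - D s) + (D s - A)).
  rewrite addrA subrK scalerBr /D scalerA -rmorphM /= mulfV ?gt_eqF//.
  by rewrite scale1r.
rewrite mxnormZ normc_real ?(ltW t0)// mulrC ler_wpM2r ?(ltW t0)//.
rewrite (le_trans (mxnormD _ _))// (le_trans (lerD (DB s t s0 (ltW st) th) DsA))//.
by rewrite mulrDr; lra.
Unshelve. all: by end_near. Qed.

End Differentiability.

Lemma mxnorm_nat_scale t A m : 0 <= t -> (0 < m)%N ->
  mxnorm ((t / m%:R)%:C%C *: A) = t * mxnorm A / m%:R.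
Proof. by move=> t0 m0; rewrite mxnormZ normc_real ?divr_ge0// mulrAC. Qed.

Definition euler A (t : R) (m : nat) : M := 1 + (t / m%:R)%:C%C *: A.

Lemma euler_tangent A t : tangent t (euler A t) A.
Proof.
move=> e e0; near=> m.
by rewrite /euler (addrC 1 _) addrK subrr mxnorm0 mulr0 ltW.
Unshelve. all: by end_near. Qed.

Lemma euler_refine A t m k : 0 <= t -> (0 < m)%N -> (0 < k)%N ->
  mxnorm (euler A t (k * m) ^+ k - euler A t m) <=
  (t * mxnorm A) ^+ 2 * expR (t * mxnorm A) / m%:R ^+ 2.
Proof.
move=> t0 m0 k0; set a := mxnorm A; set B := (t / (k * m)%:R)%:C%C *: A.
have a0 : 0 <= t * a by rewrite mulr_ge0// mxnorm_ge0.
have mR : 0 < m%:R :> R by rewrite ltr0n.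
have kR : 0 < k%:R :> R by rewrite ltr0n.
have nB : mxnorm B = t * a / (k * m)%:R by rewrite mxnorm_nat_scale// muln_gt0 k0.
have -> : euler A t (k * m) ^+ k - euler A t m = (1 + B) ^+ k - 1 - k%:R *: B.
  rewrite /euler -/B opprD addrA; congr (_ - _).
  rewrite /B scalerA -(rmorph_nat (real_complex R)) -rmorphM; congr (_%:C%C *: _).
  by rewrite natrM; field; rewrite !gt_eqF.
rewrite (le_trans (mxnorm_expB_lin _ _))// nB.
have kB : k%:R * (t * a / (k * m)%:R) = t * a / m%:R.
  by rewrite natrM; field; rewrite !gt_eqF.
rewrite kB exprMn exprVn mulrAC ler_wpM2r ?invr_ge0 ?exprn_ge0// ?(ltW mR)//.
rewrite ler_wpM2l ?exprn_ge0//.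
have -> : t * a / (k * m)%:R = t * a / m%:R / k%:R by rewrite natrM; field; rewrite !gt_eqF.
rewrite (le_trans (exp_bound _ k0)) ?divr_ge0// ?(ltW mR)// ler_expR.
by rewrite ler_pdivrMr// ler_peMr// ler1n.
Qed.

(** Compare the schemes with m and with k m steps: a step of length t/m differs
from k steps of length t/(k m) by O(1/m^2), uniformly in k, and there are m of
them. Two schemes with m and l steps are both compared with the one with
m l steps. *)
Lemma euler_cauchy A t : 0 <= t -> exists2 c : R, 0 <= c &
  forall m k, (0 < m)%N -> (0 < k)%N ->
  mxnorm (euler A t (k * m) ^+ (k * m) - euler A t m ^+ m) <= c / m%:R.
Proof.
move=> t0; set a := mxnorm A.
have a0 : 0 <= t * a by rewrite mulr_ge0// mxnorm_ge0.
set q := (t * a) ^+ 2 * expR (t * a).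
have q0 : 0 <= q by rewrite mulr_ge0// ?sqr_ge0// expR_ge0.
exists (expR (t * a + q) * q); first by rewrite mulr_ge0// expR_ge0.
move=> m k m0 k0.
have mR : 0 < m%:R :> R by rewrite ltr0n.
have ref := euler_refine A t0 m0 k0; rewrite -/a -/q in ref.
have Y1 : mxnorm (euler A t m - 1) <= t * a / m%:R.
  by rewrite /euler (addrC 1 _) addrK mxnorm_nat_scale.
have qm : q / m%:R ^+ 2 <= q / m%:R.
  rewrite ler_wpM2l// lef_pV2 ?posrE ?exprn_gt0//.
  by rewrite expr2 ler_peMr ?(ltW mR)// ler1n.
have Y1' : mxnorm (euler A t m - 1) <= (t * a + q) / m%:R.
  by rewrite (le_trans Y1)// ler_wpM2r ?invr_ge0 ?(ltW mR)// lerDl.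
have X1 : mxnorm (euler A t (k * m) ^+ k - 1) <= (t * a + q) / m%:R.
  have -> : euler A t (k * m) ^+ k - 1 =
    (euler A t m - 1) + (euler A t (k * m) ^+ k - euler A t m).
    by rewrite [RHS]addrC addrA subrK.
  by rewrite mulrDl (le_trans (mxnormD _ _))// lerD// (le_trans ref).
rewrite exprM (le_trans (mxnorm_expB _ X1 Y1'))//.
rewrite (le_trans (ler_wpM2l _ ref))//.
  by rewrite mulr_ge0// exprn_ge0// addr_ge0// divr_ge0// addr_ge0.
have -> : m%:R * (1 + (t * a + q) / m%:R) ^+ m * (q / m%:R ^+ 2) =
   (1 + (t * a + q) / m%:R) ^+ m * (q / m%:R).
  by set z := _ ^+ m; field; rewrite gt_eqF.
rewrite -mulrA ler_wpM2r ?divr_ge0// ?(ltW mR)// exp_bound// addr_ge0//.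
Qed.

Lemma euler_limit A t : 0 <= t -> exists E : M,
  forall e : R, 0 < e -> \forall m \near \oo, mxnorm (euler A t m ^+ m - E) <= e.
Proof.
move=> t0; have [c c0 cP] := euler_cauchy A t0.
have entry i j : exists l : C, ((euler A t m ^+ m) i j : C^o) @[m --> \oo] --> (l : C^o).
  apply: cauchyC => e e0; have e4 : 0 < e / 4 by rewrite divr_gt0.
  pose P m := (0 < m)%N /\ c / m%:R <= e / 4.
  have nearP : \forall m \near \oo, P m.
    near=> m; split; first by near: m; exact: nbhs_infty_gt.
    by near: m; exact: near_inv.
  exists (P, P) => //= -[m l] /= [[m0 mc] [l0 lc]].
  have -> : (euler A t m ^+ m) i j - (euler A t l ^+ l) i j =
      (euler A t m ^+ m - euler A t l ^+ l) i j by rewrite !mxE.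
  rewrite (le_lt_trans (normc_mxnorm _ i j))//.
  have -> : euler A t m ^+ m - euler A t l ^+ l =
     (euler A t (m * l) ^+ (m * l) - euler A t l ^+ l) -
     (euler A t (l * m) ^+ (l * m) - euler A t m ^+ m).
    by rewrite mulnC opprB [RHS]addrC addrA subrK.
  rewrite (le_lt_trans (mxnormD _ _))// mxnormN.
  have := cP l m l0 m0; have := cP m l m0 l0; lra.
exists (\matrix_(i, j) projT1 (cid (entry i j))).
by apply: mxnorm_cvg => i j; rewrite mxE; case: cid.
Unshelve. all: by end_near. Qed.

Lemma mxlim_unique X A B :
  (forall e : R, 0 < e -> \forall m \near \oo, mxnorm (X m - A) <= e) ->
  (forall e : R, 0 < e -> \forall m \near \oo, mxnorm (X m - B) <= e) -> A = B.
Proof.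
move=> XA XB; apply/eqP; rewrite -subr_eq0; apply/eqP/mxnorm_small => e e0.
have e2 : 0 < e / 2 by rewrite divr_gt0.
near \oo => m.
have -> : A - B = (X m - B) - (X m - A) by rewrite opprB [RHS]addrC addrA subrK.
rewrite (le_trans (mxnormD _ _))// mxnormN [e]splitr lerD//; near: m.
  exact: XB.
exact: XA.
Unshelve. all: by end_near. Qed.

Lemma mxlimM X Y A B :
  (forall e : R, 0 < e -> \forall m \near \oo, mxnorm (X m - A) <= e) ->
  (forall e : R, 0 < e -> \forall m \near \oo, mxnorm (Y m - B) <= e) ->
  forall e : R, 0 < e -> \forall m \near \oo, mxnorm (X m * Y m - A * B) <= e.
Proof.
move=> XA YB e e0.
pose c := 1 + mxnorm A + mxnorm B.
have c0 : 0 < c by rewrite /c -addrA ltr_pwDl// addr_ge0// mxnorm_ge0.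
pose d := Num.min 1 (e / (2 * c)).
have d0 : 0 < d by rewrite lt_min ltr01 divr_gt0// mulr_gt0.
near=> m.
have h1 : mxnorm (X m - A) <= d by near: m; exact: XA.
have h2 : mxnorm (Y m - B) <= d by near: m; exact: YB.
have d1 : d <= 1 by rewrite ge_min lexx.
have dc : c * d <= e / 2.
  rewrite -ler_pdivlMl// (le_trans (y := e / (2 * c)))// ?ge_min ?lexx ?orbT//.
  by rewrite le_eqVlt; apply/orP; left; apply/eqP; field; rewrite gt_eqF.
have -> : X m * Y m - A * B = (X m - A) * (Y m - B) + (X m - A) * B + A * (Y m - B).
  by rewrite -mulrDr subrK mulrBl mulrBr addrA subrK.
rewrite (le_trans (mxnormD _ _))// (le_trans (lerD (le_trans (mxnormD _ _)
  (lerD (mxnormM _ _) (mxnormM _ _))) (mxnormM _ _)))//.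
have A0 := mxnorm_ge0 A; have B0 := mxnorm_ge0 B.
have k1 : mxnorm (X m - A) * mxnorm (Y m - B) <= d * 1.
  by rewrite ler_pM ?mxnorm_ge0// (le_trans h2).
have k2 : mxnorm (X m - A) * mxnorm B <= d * mxnorm B by rewrite ler_wpM2r.
have k3 : mxnorm A * mxnorm (Y m - B) <= mxnorm A * d by rewrite ler_wpM2l.
rewrite (le_trans (lerD (lerD k1 k2) k3))//.
have -> : d * 1 + d * mxnorm B + mxnorm A * d = c * d by rewrite /c; ring.
by lra.
Unshelve. all: by end_near. Qed.

Lemma comm_1D (U V : M) : U * V = V * U -> (1 + U) * (1 + V) = (1 + V) * (1 + U).
Proof. by move=> UV; rewrite !mulrDl !mulrDr !mul1r !mulr1 UV addrACA. Qed.

Lemma euler_comm A s t m : GRing.comm (euler A s m) (euler A t m).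
Proof.
rewrite /GRing.comm /euler; apply: comm_1D.
have scaler2 (c d : C) (U V : M) : (c *: U) * (d *: V) = (c * d) *: (U * V).
  rewrite -scalerA; transitivity (c *: (U * (d *: V))).
    exact: esym (scalemxAl _ _ _).
  by congr (_ *: _); exact: esym (scalemxAr _ _ _).
by rewrite !scaler2 [X in X *: _]mulrC.
Qed.

(** The semigroup law passes to the limit because the product of Euler steps of
lengths s/m and t/m is tangent to an Euler step of length (s + t)/m. *)
Lemma semigroup_exists A : exists T, semigroup T /\ has_generator T A.
Proof.
(* the value at negative times is arbitrary *)
pose T t := if pselect (0 <= t) is left h then projT1 (cid (euler_limit A h)) else 1.
have TP t : 0 <= t -> forall e : R, 0 < e ->
    \forall m \near \oo, mxnorm (euler A t m ^+ m - T t) <= e.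
  by rewrite /T; case: pselect => // h _; case: cid.
exists T; split; first split.
- apply: (mxlim_unique (TP 0 (lexx 0))) => e e0.
  by near=> m; rewrite /euler mul0r scale0r addr0 expr1n subrr mxnorm0 ltW.
- move=> s t s0 t0; have st0 : 0 <= s + t by rewrite addr_ge0.
  apply: (mxlim_unique (TP _ st0)).
  have tan : tangent (s + t) (fun m => euler A s m * euler A t m) A.
    move=> e e0; near=> m.
    have mR : 0 < m%:R :> R by rewrite ltr0n; near: m; exact: nbhs_infty_gt.
    have scalerr (c : C) (U V : M) : U * (c *: V) = c *: (U * V) by exact: esym (scalemxAr _ _ _).
    have scalerl (c : C) (U V : M) : (c *: U) * V = c *: (U * V) by exact: esym (scalemxAl _ _ _).
    have -> : euler A s m * euler A t m - 1 - ((s + t) / m%:R)%:C%C *: A =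
        (s / m%:R * (t / m%:R))%:C%C *: (A * A).
      rewrite /euler mulrDl mul1r mulrDr mulr1 scalerr scalerl scalerA mulrDl rmorphD scalerDl.
      set u := _%:C%C *: A; set v := _%:C%C *: A; set w := _ *: (A * A).
      set w' := _ *: (A * A); have -> : w' = w by rewrite /w' /w rmorphM mulrC.
      by apply/matrixP => i j; rewrite !mxE; ring.
    rewrite mxnormZ normc_real ?mulr_ge0 ?invr_ge0 ?(ltW mR)//.
    have -> : m%:R * (s / m%:R * (t / m%:R) * mxnorm (A * A)) =
      s * t * mxnorm (A * A) / m%:R by field; rewrite gt_eqF.
    by near: m; exact: near_inv.
  move=> e e0.
  have e2 : 0 < e / 2 by rewrite divr_gt0.
  have h1 := tangent_power st0 (euler_tangent A (s + t)) tan e2.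
  have h2 := mxlimM (TP s s0) (TP t t0) e2.
  near=> m.
  have -> : euler A (s + t) m ^+ m - T s * T t =
     (euler A (s + t) m ^+ m - (euler A s m * euler A t m) ^+ m) +
     (euler A s m ^+ m * euler A t m ^+ m - T s * T t).
    by rewrite (exprMn_comm _ (euler_comm A s t m)) addrA subrK.
  by rewrite (le_trans (mxnormD _ _))// [e]splitr lerD//; near: m.
- move=> e e0; set a := mxnorm A; have a0 : 0 <= a by exact: mxnorm_ge0.
  pose c := a ^+ 2 * expR a; have c0 : 0 <= c by rewrite mulr_ge0 ?sqr_ge0 ?expR_ge0.
  exists (Num.min 1 (e / (2 * (1 + c)))).
    by rewrite lt_min ltr01 divr_gt0// mulr_gt0// ltr_pwDl.
  move=> t t0; rewrite lt_min => /andP[t1 te].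
  have ct : c * t <= e / 2.
    rewrite (@le_trans _ _ ((1 + c) * (e / (2 * (1 + c)))))//.
      by rewrite ler_pM// ?(ltW t0) ?(ltW te)// lerDr.
    by rewrite le_eqVlt; apply/orP; left; apply/eqP; field; rewrite gt_eqF// ltr_pwDl.
  have et2 : 0 < e / 2 * t by rewrite mulr_gt0// divr_gt0.
  near \oo => m; have m0 : (0 < m)%N by near: m; exact: nbhs_infty_gt.
  have mR : 0 < m%:R :> R by rewrite ltr0n.
  have h1 : mxnorm (euler A t m ^+ m - T t) <= e / 2 * t.
    by near: m; exact: TP (ltW t0) _ et2.
  set B := (t / m%:R)%:C%C *: A.
  have nB : mxnorm B = t * a / m%:R by rewrite mxnorm_nat_scale// ltW.
  have mB : m%:R *: B = t%:C%C *: A.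
    rewrite /B scalerA -(rmorph_nat (real_complex R)) -rmorphM; congr (_%:C%C *: _).
    by rewrite mulrCA mulfV ?mulr1// gt_eqF.
  have := mxnorm_expB_lin B m; rewrite mB nB => h2.
  have h3 : mxnorm ((1 + B) ^+ m - 1 - t%:C%C *: A) <= c * t * t.
    rewrite (le_trans h2)// mulrCA mulfV ?gt_eqF// mulr1.
    have ta0 : 0 <= t * a by rewrite mulr_ge0// ltW.
    rewrite (@le_trans _ _ ((t * a) ^+ 2 * expR a))//.
      rewrite ler_wpM2l ?sqr_ge0// (le_trans (exp_bound ta0 m0))// ler_expR.
      by rewrite ler_piMl// ltW.
    by rewrite le_eqVlt; apply/orP; left; apply/eqP; rewrite /c; ring.
  have -> : T t - 1 - t%:C%C *: A = ((1 + B) ^+ m - 1 - t%:C%C *: A) -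
      (euler A t m ^+ m - T t).
    rewrite /euler -/B; set U := _ ^+ m.
    by apply/matrixP => i j; rewrite !mxE; ring.
  rewrite (le_trans (mxnormD _ _))// mxnormN (le_trans (lerD h3 h1))//.
  rewrite -mulrDl ler_wpM2r ?(ltW t0)//; lra.
Unshelve. all: by end_near. Qed.

End MatrixSemigroup.

(** * Convolution semigroups of functionals *)

Section ConvolutionSemigroup.
Variables (R : realType) (n : nat).
Local Notation C := R[i].
Local Notation Pol := (Pol C n).
Local Notation eps := (counit C n).

Lemma near_right0P (P : R -> Prop) : (\forall t \near 0^'+, P t) <->
  exists2 d : R, 0 < d & forall t, 0 < t -> t < d -> P t.
Proof.
split=> [/nbhs_ballP[d d0 dP]|[d d0 dP]].
  exists d => // t t0 td; apply: dP => //.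
  by rewrite -ball_normE /= sub0r normrN gtr0_norm.
near=> t; apply: dP; near: t; [exact: nbhs_right_gt|exact: nbhs_right_lt].
Unshelve. all: by end_near. Qed.

Lemma realC_neq0 (t : R) : 0 < t -> t%:C%C != 0 :> C.
Proof. by move=> t0; rewrite eq_complex /= eqxx andbT gt_eqF. Qed.

Lemma has_generatorP N (T : R -> 'M[C]_N) (A : 'M[C]_N) :
  has_generator T A <->
  forall i j, ((T t - 1) i j / t%:C%C : C^o) @[t --> 0^'+] --> (A i j : C^o).
Proof.
have slopeE t : 0 < t ->
    T t - 1 - t%:C%C *: A = t%:C%C *: ((t%:C%C)^-1 *: (T t - 1) - A).
  by move=> t0; rewrite scalerBr scalerA mulfV ?realC_neq0// scale1r.
split=> [TA i j|TA e e0].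
  apply/cvgCP => e e0; have e2 : 0 < e / 2 by rewrite divr_gt0.
  have [d d0 dP] := TA _ e2; apply/near_right0P; exists d => // t t0 td.
  have := dP t t0 td; rewrite slopeE// mxnormZ normc_real ?(ltW t0)// mulrC ler_pM2r//.
  move=> h; rewrite (@le_lt_trans _ _ (e / 2))//; last by rewrite ltr_pdivrMr//; lra.
  by rewrite (le_trans _ h)// (le_trans _ (normc_mxnorm _ i j))// !mxE mulrC.
have /near_right0P[d d0 dP] : \forall t \near 0^'+,
    mxnorm ((t%:C%C)^-1 *: (T t - 1) - A) <= e.
  apply: mxnorm_cvg => // i j.
  have -> : (fun t : R => ((t%:C%C)^-1 *: (T t - 1)) i j : C^o) =
     (fun t => (T t - 1) i j / t%:C%C : C^o); last exact: TA.
  by apply/funext => t; rewrite mxE mulrC.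
exists d => // t t0 td; rewrite slopeE// mxnormZ normc_real ?(ltW t0)// mulrC.
by rewrite ler_pM2r// dP.
Qed.

(** Every element is a finite combination of coefficients of corepresentations,
so that convergence there gives convergence everywhere, and the limit is again
linear. *)
Lemma limit_linear S (F : set_system S) (FF : ProperFilter F) (f : S -> Pol -> C) :
  (forall x c a b, f x (c *: a + b) = c * f x a + f x b) ->
  (forall (J : finType) (U : J -> J -> Pol), corep U -> forall i j, exists l : C,
    (f x (U i j) : C^o) @[x --> F] --> (l : C^o)) ->
  exists L : {linear Pol -> C^o}, forall a, (f x a : C^o) @[x --> F] --> L a.
Proof.
move=> flin fU.
have linC c a b (la lb : C) : (f x a : C^o) @[x --> F] --> (la : C^o) ->
    (f x b : C^o) @[x --> F] --> (lb : C^o) ->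
    (f x (c *: a + b) : C^o) @[x --> F] --> (c * la + lb : C^o).
  move=> fa fb; under eq_fun do rewrite flin.
  by apply: cvgD fb; apply: cvgMr fa.
have f0 : (f x 0 : C^o) @[x --> F] --> (0 : C^o).
  have -> : (fun x => f x 0 : C^o) = (fun=> 0).
    apply/funext => x; have := flin x (-1) 0 0.
    by rewrite scaler0 addr0 mulN1r addNr.
  exact: cvg_cst.
have lim_sum (K : finType) (c : K -> C) (u : K -> Pol) :
    (forall k, exists l : C, (f x (u k) : C^o) @[x --> F] --> (l : C^o)) ->
    exists l : C, (f x (\sum_k c k *: u k) : C^o) @[x --> F] --> (l : C^o).
  move=> h; elim: (index_enum K) => [|k r [l IH]]; first by exists 0; rewrite big_nil; exact: f0.
  by have [lk hk] := h k; exists (c k * lk + l); rewrite big_cons; exact: (linC (c k) (u k) _ lk l hk IH).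
have flim a : exists l : C, (f x a : C^o) @[x --> F] --> (l : C^o).
  have [J [U [UP [c ->]]]] := corep_exists a.
  have := lim_sum J (fun=> 1) (fun i => \sum_j c i j *: U i j).
  under eq_bigr do rewrite scale1r.
  by apply=> i; apply: lim_sum => j; exact: fU.
pose L0 a : C^o := projT1 (cid (flim a)).
have L0P a : (f x a : C^o) @[x --> F] --> L0 a by rewrite /L0; case: cid.
have L0lin : linear L0.
  move=> c a b; exact: (cvgC_unique FF (L0P (c *: a + b)) (linC c a b _ _ (L0P a) (L0P b))).
pose Lm := GRing.isLinear.Build C Pol C^o *:%R L0 L0lin.
pose L : {linear Pol -> C^o} := HB.pack L0 Lm.
by exists L.
Qed.

Definition conv_semigroup (om : R -> {linear Pol -> C^o}) : Prop :=
  (forall a, om 0 a = eps a) /\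
  (forall s t, 0 <= s -> 0 <= t -> forall a, om (s + t) a = conv (om s) (om t) a).

Definition generates (L : Pol -> C^o) (om : R -> {linear Pol -> C^o}) : Prop :=
  forall a, (fun t => (om t a - eps a) / (t%:C)%C : C^o) @ 0^'+ --> L a.

Lemma conv_semigroup_mx om (J : finType) (U : J -> J -> Pol) : corep U ->
  conv_semigroup om -> semigroup (fun t => functional_mx U (om t)).
Proof.
move=> UP [om0 omD]; split=> [|s t s0 t0].
  rewrite -(functional_mx_eps UP); apply/matrixP => x y; rewrite !mxE; exact: om0.
rewrite -functional_mx_conv//; apply/matrixP => x y; rewrite !mxE; exact: omD.
Qed.

Lemma functional_mx_slope om (J : finType) (U : J -> J -> Pol) x y : corep U ->
  (fun t : R => ((functional_mx U (om t) - 1) x y / t%:C%C : C^o)) =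
  (fun t => (om t (U (enum_val x) (enum_val y)) - eps (U (enum_val x) (enum_val y)))
     / t%:C%C : C^o).
Proof.
by move=> UP; apply/funext => t; rewrite -(functional_mx_eps UP) !mxE.
Qed.

Lemma generates_mx om (L : Pol -> C^o) (J : finType) (U : J -> J -> Pol) : corep U ->
  generates L om -> has_generator (fun t => functional_mx U (om t)) (functional_mx U L).
Proof.
move=> UP Lom; apply/has_generatorP => x y; rewrite (functional_mx_slope om x y UP).
rewrite [functional_mx U L x y]mxE; exact: Lom.
Qed.

Lemma conv_semigroup_unique om om' (L : Pol -> C^o) :
  conv_semigroup om -> conv_semigroup om' -> generates L om -> generates L om' ->
  forall t, 0 <= t -> om t =1 om' t.
Proof.
move=> som som' Lom Lom' t t0; apply: eq_on_coreps => J U UP i j.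
have E : functional_mx U (om t) = functional_mx U (om' t).
  exact: (semigroup_unique (conv_semigroup_mx UP som) (conv_semigroup_mx UP som')
    (generates_mx UP Lom) (generates_mx UP Lom')).
by rewrite -functional_mxE E functional_mxE.
Qed.

(** On each corepresentation a convolution semigroup is a semigroup of matrices
that is continuous at 0, hence differentiable there. *)
Lemma conv_semigroup_generator om : conv_semigroup om ->
  (forall a, (om t a : C^o) @[t --> 0^'+] --> eps a) ->
  exists L : {linear Pol -> C^o}, generates L om.
Proof.
move=> som om0.
apply: (@limit_linear _ _ _ (fun (t : R) a => (om t a - eps a) / (t%:C)%C)) => [t c a b|J U UP i j].
  have -> : (om t (c *: a + b) : C) = c * om t a + om t b by rewrite linearP.
  have -> : (eps (c *: a + b) : C) = c * eps a + eps b by rewrite linearP.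
  by ring.
have sT := conv_semigroup_mx UP som.
have [e e0|A /has_generatorP AP] := semigroup_generator sT.
  apply/near_right0P; rewrite -(functional_mx_eps UP).
  apply: mxnorm_cvg => // x y; rewrite mxE.
  have -> : (fun t => functional_mx U (om t) x y : C^o) =
    (fun t => om t (U (enum_val x) (enum_val y)) : C^o).
    by apply/funext => t; rewrite mxE.
  exact: om0.
exists (A (enum_rank i) (enum_rank j)).
by have := AP (enum_rank i) (enum_rank j); rewrite functional_mx_slope// !enum_rankK.
Qed.

Fixpoint conv_pow (mu : {linear Pol -> C^o}) (m : nat) : {linear Pol -> C^o} :=
  if m is m'.+1 then conv mu (conv_pow mu m') else eps.

Lemma conv_pow_mx mu m (J : finType) (U : J -> J -> Pol) : corep U ->
  functional_mx U (conv_pow mu m) = functional_mx U mu ^+ m.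
Proof.
move=> UP; elim: m => [|m IH]; first exact: functional_mx_eps.
by rewrite exprS -IH -functional_mx_conv.
Qed.

Section Euler.
Variable L : {linear Pol -> C^o}.

Definition euler_step (s : R) (a : Pol) : C^o := (eps a : C) + s%:C%C * (L a : C).

Fact euler_step_linear s : linear (euler_step s).
Proof.
move=> c a b; rewrite /euler_step.
have -> : (L (c *: a + b) : C) = c * L a + L b by rewrite linearP.
have -> : (eps (c *: a + b) : C) = c * eps a + eps b by rewrite linearP.
rewrite -[RHS]/(c * ((eps a : C) + s%:C%C * (L a : C)) + ((eps b : C) + s%:C%C * (L b : C))).
by ring.
Qed.
HB.instance Definition _ s :=
  GRing.isLinear.Build C Pol C^o *:%R (euler_step s) (euler_step_linear s).

Lemma euler_step_mx t m (J : finType) (U : J -> J -> Pol) : corep U ->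
  functional_mx U (conv_pow (euler_step (t / m%:R)) m) =
  euler (functional_mx U L) t m ^+ m.
Proof.
move=> UP; rewrite (conv_pow_mx _ _ UP); congr (_ ^+ _).
by rewrite /euler -(functional_mx_eps UP); apply/matrixP => x y; rewrite !mxE.
Qed.

Lemma mxnorm_cvg_entry N (X : nat -> 'M[C]_N) A x y :
  (forall e : R, 0 < e -> \forall m \near \oo, mxnorm (X m - A) <= e) ->
  (X m x y : C^o) @[m --> \oo] --> (A x y : C^o).
Proof.
move=> XA; apply/cvgCP => e e0; have e2 : 0 < e / 2 by rewrite divr_gt0.
have := XA _ e2; apply: filterS => m h.
rewrite (@le_lt_trans _ _ (e / 2))//; last by rewrite ltr_pdivrMr//; lra.
by rewrite (le_trans _ h)// (le_trans _ (normc_mxnorm _ x y))// !mxE.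
Qed.

(** The semigroup is constructed as the limit of the convolution powers of
eps + (t/m) L, which exist on all of Pol(S_n^+) at once; on each
corepresentation this limit is the matrix semigroup generated by L. The
approximation is kept in the statement because it shows that om t 1 = 1. *)
Lemma conv_semigroup_exists : exists om : R -> {linear Pol -> C^o},
  [/\ conv_semigroup om, generates L om &
  forall t, 0 <= t -> forall a,
    (conv_pow (euler_step (t / m%:R)) m a : C^o) @[m --> \oo] --> om t a].
Proof.
have entry (J : finType) (U : J -> J -> Pol) : corep U -> exists T : R -> 'M[C]_#|J|,
    [/\ semigroup T, has_generator T (functional_mx U L) & forall t, 0 <= t -> forall i j,
    (conv_pow (euler_step (t / m%:R)) m (U i j) : C^o) @[m --> \oo] -->
      (T t (enum_rank i) (enum_rank j) : C^o)].
  move=> UP; have [T [sT TA]] := semigroup_exists (functional_mx U L).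
  exists T; split=> // t t0 i j.
  have := mxnorm_cvg_entry (x := enum_rank i) (y := enum_rank j)
    (semigroup_approx sT TA t0 (@euler_tangent _ _ (functional_mx U L) t)).
  have -> : (fun m => (euler (functional_mx U L) t m ^+ m) (enum_rank i) (enum_rank j) : C^o) =
    (fun m => conv_pow (euler_step (t / m%:R)) m (U i j) : C^o); last by [].
  by apply/funext => m; rewrite -(euler_step_mx _ _ UP) functional_mxE.
have lim t : 0 <= t -> exists M : {linear Pol -> C^o}, forall a,
    (conv_pow (euler_step (t / m%:R)) m a : C^o) @[m --> \oo] --> M a.
  move=> t0; apply: (@limit_linear _ _ _ (fun m a => conv_pow (euler_step (t / m%:R)) m a)).
    by move=> m c a b; rewrite linearP.
  move=> J U UP i j; have [T [_ _ TP]] := entry J U UP.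
  by exists (T t (enum_rank i) (enum_rank j)); exact: TP.
(* the value at negative times is arbitrary *)
pose om t := if pselect (0 <= t) is left h then projT1 (cid (lim t h)) else eps.
have omP t : 0 <= t -> forall a,
    (conv_pow (euler_step (t / m%:R)) m a : C^o) @[m --> \oo] --> om t a.
  by rewrite /om; case: pselect => // h _; case: cid.
have omT (J : finType) (U : J -> J -> Pol) (T : R -> 'M[C]_#|J|) t : corep U ->
    (forall t, 0 <= t -> forall i j,
    (conv_pow (euler_step (t / m%:R)) m (U i j) : C^o) @[m --> \oo] -->
      (T t (enum_rank i) (enum_rank j) : C^o)) -> 0 <= t -> functional_mx U (om t) = T t.
  move=> UP TP t0; apply/matrixP => x y; rewrite mxE.
  have := TP t t0 (enum_val x) (enum_val y); rewrite !enum_valK => h.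
  exact: (cvgC_unique _ (omP t t0 _) h).
have som : conv_semigroup om.
  split=> [|s t s0 t0]; apply: eq_on_coreps => J U UP i j;
    have [T [sT TA TP]] := entry J U UP.
    by rewrite -functional_mxE (omT J U T)// sT.1 -(functional_mx_eps UP) functional_mxE.
  rewrite -functional_mxE (omT J U T) ?addr_ge0// sT.2// -(omT J U T s)// -(omT J U T t)//.
  by rewrite -functional_mx_conv// functional_mxE.
exists om; split=> //.
have slopeU (J : finType) (U : J -> J -> Pol) : corep U -> forall i j,
    ((om t (U i j) - eps (U i j)) / (t%:C)%C : C^o) @[t --> 0^'+] --> L (U i j).
  move=> UP i j; have [T [sT TA TP]] := entry J U UP.
  have /has_generatorP : has_generator (fun t => functional_mx U (om t)) (functional_mx U L).
    move=> e e0; have [d d0 dP] := TA e e0; exists d => // t t0 td.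
    by rewrite (omT J U T t UP TP (ltW t0)); exact: dP.
  by move=> /(_ (enum_rank i) (enum_rank j)); rewrite (functional_mx_slope om _ _ UP) !enum_rankK functional_mxE.
have [L' L'P] : exists L' : {linear Pol -> C^o}, generates L' om.
  apply: (@limit_linear _ _ _ (fun (t : R) a => (om t a - eps a) / (t%:C)%C)) => [t c a b|J U UP i j].
    have -> : (om t (c *: a + b) : C) = c * om t a + om t b by rewrite linearP.
    have -> : (eps (c *: a + b) : C) = c * eps a + eps b by rewrite linearP.
    by ring.
  by exists (L (U i j)); exact: slopeU.
have LL' : L' =1 L.
  apply: eq_on_coreps => J U UP i j; exact: (cvgC_unique _ (L'P (U i j)) (slopeU J U UP i j)).
by move=> a; rewrite -LL'; exact: L'P.
Qed.

End Euler.

End ConvolutionSemigroup.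

(** * Positivity of the semigroup of a Schurmann triple *)

Section Gram.
Variables (C : numClosedFieldType) (H : hilbertType C).

(** One step of Gram-Schmidt: projecting all vectors onto the complement of a
nonzero v k splits off a rank one matrix and turns at least one more vector
into 0. *)
Lemma gram_factor (I : finType) (v : I -> H) : exists s : seq (I -> C),
  forall i j, inner (v i) (v j) = \sum_(k <- s) (k i)^* * k j.
Proof.
have [m] := ubnP #|[pred i | v i != 0]|.
elim: m v => // m IH v; rewrite ltnS => vm.
have [k vk|v0] := pickP [pred i | v i != 0]; last first.
  have {}v0 i : v i = 0 by have /negbFE/eqP := v0 i.
  by exists [::] => i j; rewrite big_nil v0 inner0l.
pose nv := `|v k|; have nv0 : nv != 0 by rewrite normr_eq0.
have nvE : inner (v k) (v k) = nv ^+ 2 by rewrite inner_norm.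
have nvJ : nv^* = nv by rewrite conj_Creal ?normr_real.
pose e i := inner (v k) (v i) / nv.
pose w i := v i - (e i / nv) *: v k.
have wv i : v i = 0 -> w i = 0 by move=> vi; rewrite /w /e vi inner0r !mul0r scale0r subr0.
have wk : w k = 0.
  by rewrite /w /e nvE expr2 mulfK// mulfV// scale1r subrr.
have [|s sE] := IH w.
  apply: leq_trans vm; apply: proper_card; apply/properP; split.
    by apply/fintype.subsetP => i; rewrite !inE; apply: contra_neq => /wv.
  by exists k; rewrite !inE // wk eqxx.
exists (e :: s) => i j; rewrite big_cons -sE /w.
rewrite innerBl !innerBr !innerZl !innerZr nvE.
have -> : inner (v i) (v k) = (e i)^* * nv.
  by rewrite innerC /e rmorphM /= fmorphV /= nvJ mulfVK.
have -> : inner (v k) (v j) = e j * nv by rewrite /e mulfVK.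
rewrite rmorphM /= fmorphV /= nvJ.
by field; rewrite nv0 -[X in X != 0]/(nv^*) nvJ nv0.
Qed.

End Gram.

Section PositivityPreserving.
Variables (C : numClosedFieldType) (J : finType).
Local Notation M := 'M[C]_#|{: J * J}|.

(** With X the matrix of a functional mu on the tensor product of the entrywise
adjoint of U with U, and a = sum c_ij U_ij, this is mu (star a * a), see coefficient_square. Reading X
as an operator on matrices over J, it is the quadratic form of its Choi
matrix, so positivity of mu on coefficients of U says that X is completely
positive. *)
Definition choi_form (X : M) (c : J -> J -> C) : C :=
  \sum_(x : J * J) \sum_(y : J * J)
    (c x.1 y.1)^* * c x.2 y.2 * X (enum_rank x) (enum_rank y).

Definition choi_positive (X : M) := forall c, 0 <= choi_form X c.

Lemma choi_positive1 : choi_positive 1.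
Proof.
move=> c; rewrite /choi_form.
rewrite (_ : \sum_x _ = \sum_(x : J * J) (c x.1 x.1)^* * c x.2 x.2); last first.
  apply: eq_bigr => x _; rewrite (bigD1 x)//= mxE eqxx mulr1 big1 ?addr0// => y yx.
  by rewrite mxE (inj_eq enum_rank_inj) eq_sym (negPf yx) mulr0.
rewrite -(pair_bigA _ (fun i j => (c i i)^* * c j j)) /=.
under eq_bigr do rewrite -mulr_sumr.
by rewrite -mulr_suml -rmorph_sum mulrC mul_conjC_ge0.
Qed.

(** The hypothesis is a Kraus decomposition of X. Each Kraus operator K can be
absorbed into the coefficients c, which leaves a sum of values of the form
of Y. *)
Lemma choi_positiveM (X Y : M) (s : seq (J -> J -> C)) :
  (forall x z, X (enum_rank x) (enum_rank z) =
     \sum_(K <- s) (K x.1 z.1)^* * K x.2 z.2) ->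
  choi_positive Y -> choi_positive (X * Y).
Proof.
move=> XE YP c.
pose d (K : J -> J -> C) k j := \sum_i c i j * K i k.
suff -> : choi_form (X * Y) c = \sum_(K <- s) choi_form Y (d K).
  by apply: sumr_ge0 => K _; exact: YP.
rewrite /choi_form.
transitivity (\sum_x \sum_y \sum_z \sum_(K <- s)
   ((c x.1 y.1 * K x.1 z.1)^* * (c x.2 y.2 * K x.2 z.2)) * Y (enum_rank z) (enum_rank y)).
  apply: eq_bigr => x _; apply: eq_bigr => y _; rewrite mxE mulr_sumr.
  rewrite (reindex (@enum_rank _)) /=; last by apply: onW_bij; exact: enum_rank_bij.
  apply: eq_bigr => z _; rewrite XE mulr_suml mulr_sumr; apply: eq_bigr => K _.
  by rewrite rmorphM; ring.
under eq_bigr => x _ do under eq_bigr => y _ do rewrite exchange_big.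
under eq_bigr => x _ do rewrite exchange_big.
rewrite exchange_big; apply: eq_bigr => K _ /=.
under eq_bigr => x _ do rewrite exchange_big.
rewrite exchange_big; apply: eq_bigr => z _ /=.
rewrite exchange_big; apply: eq_bigr => y _ /=.
rewrite -mulr_suml; congr (_ * _).
rewrite /d rmorph_sum mulr_suml.
rewrite -(pair_bigA _ (fun i i' => (c i y.1 * K i z.1)^* * (c i' y.2 * K i' z.2))) /=.
by apply: eq_bigr => i _; rewrite mulr_sumr.
Qed.

Lemma choi_positiveX (X : M) (s : seq (J -> J -> C)) m :
  (forall x z, X (enum_rank x) (enum_rank z) =
     \sum_(K <- s) (K x.1 z.1)^* * K x.2 z.2) -> choi_positive (X ^+ m).
Proof.
move=> XE; elim: m => [|m IH]; first exact: choi_positive1.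
by rewrite exprS; exact: choi_positiveM IH.
Qed.

End PositivityPreserving.

Section CorepStar.
Variables (C : numClosedFieldType) (n : nat).
Local Notation Pol := (Pol C n).
Local Notation eps := (counit C n).

Lemma corep_star (J : finType) (U : J -> J -> Pol) :
  corep U -> corep (fun i j => star (U i j)).
Proof.
move=> [UD Ue]; split=> i j.
  transitivity (star (comult C n (U i j))); first exact: star_morph.
  by rewrite UD star_sum; apply: eq_bigr => k _; exact: star_purepol.
by rewrite eps_star Ue conjC_nat.
Qed.

Lemma coefficient_square (J : finType) (U : J -> J -> Pol) (c : J -> J -> C)
    (mu : {linear Pol -> C^o}) :
  let a := \sum_i \sum_j c i j *: U i j in
  mu (star a * a) =
  choi_form (functional_mx (corep_prod (fun i j => star (U i j)) U) mu) c.
Proof.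
rewrite /choi_form /=.
under [RHS]eq_bigr => x _ do under eq_bigr => y _ do rewrite functional_mxE /corep_prod.
rewrite star_sum mulr_suml.
rewrite -(pair_bigA _ (fun i i' => \sum_(y : J * J) (c i y.1)^* * c i' y.2 *
   mu (star (U i y.1) * U i' y.2))) /= linear_sum; apply: eq_bigr => i _.
rewrite mulr_sumr linear_sum; apply: eq_bigr => i' _.
rewrite -(pair_bigA _ (fun j j' => (c i j)^* * c i' j' * mu (star (U i j) * U i' j'))) /=.
rewrite star_sum mulr_suml linear_sum; apply: eq_bigr => j _.
rewrite mulr_sumr linear_sum; apply: eq_bigr => j' _.
by rewrite starZ -scalerAl -scalerAr scalerA linearZ.
Qed.

End CorepStar.

Section Schoenberg.
Variables (R : realType) (n : nat) (H : hilbertType R[i]).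
Local Notation C := R[i].
Local Notation Pol := (Pol C n).
Local Notation eps := (counit C n).
Variables (rho : Pol -> H -> H) (eta : Pol -> H) (L : {linear Pol -> C^o}).
Hypothesis triple : schurmann_triple rho eta L.

Lemma cvg_choi_form (J : finType) (X : nat -> 'M[C]_#|{: J * J}|)
    (Y : 'M[C]_#|{: J * J}|) c :
  (forall x y, (X m x y : C^o) @[m --> \oo] --> (Y x y : C^o)) ->
  (choi_form (X m) c : C^o) @[m --> \oo] --> (choi_form Y c : C^o).
Proof.
move=> XY; rewrite /choi_form.
apply: (@cvg_big C^o) => [|x _]; first exact: add_continuous.
apply: (@cvg_big C^o) => [|y _]; first exact: add_continuous.
exact: cvgMr (XY _ _).
Qed.

Section Step.
Variables (J : finType) (U : J -> J -> Pol) (UP : corep U).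
Let V := corep_prod (fun i j => star (U i j)) U.
Local Notation M := 'M[C]_#|{: J * J}|.

(** The functional eps + s L need not be positive: on star a * b its value
differs from the positive kernel below by the second order term
s^2 (L a)^* (L b). By tangency such a term is invisible in the limit of the
powers, so this kernel can replace eps + s L. *)
Definition step_form (s : R) (a b : Pol) : C :=
  (euler_step L s a : C)^* * euler_step L s b + s%:C%C * inner (eta a) (eta b).

Definition step_mx (s : R) : M := \matrix_(x, y)
  step_form s (U (enum_val x).1 (enum_val y).1) (U (enum_val x).2 (enum_val y).2).

Definition defect_mx : M := \matrix_(x, y)
  ((L (U (enum_val x).1 (enum_val y).1) : C)^* * L (U (enum_val x).2 (enum_val y).2)).

Lemma step_formE s a b : step_form s a b =
  eps (star a * b) + s%:C%C * L (star a * b) + s%:C%C * s%:C%C * ((L a : C)^* * L b).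
Proof.
rewrite (st_coboundary triple) (st_hermitian triple) /step_form /euler_step.
have -> : (eps (star a * b) : C) = (eps a : C)^* * eps b.
  by rewrite epsM eps_star.
have cJ (x y : C) : (x + s%:C%C * y)^* = x^* + s%:C%C * y^*.
  by rewrite rmorphD rmorphM /= [X in X * _]conj_Creal// complex_real eqxx.
by rewrite cJ eps_star; ring.
Qed.

Lemma step_mxE s : step_mx s - 1 - s%:C%C *: functional_mx V L =
  (s%:C%C * s%:C%C) *: defect_mx.
Proof.
rewrite -(functional_mx_eps (corep_prodP (corep_star UP) UP)).
by apply/matrixP => x y; rewrite !mxE step_formE /V /corep_prod; ring.
Qed.

Lemma step_tangent t : 0 <= t ->
  tangent t (fun m => step_mx (t / m%:R)) (functional_mx V L).
Proof.
move=> t0 e e0; near=> m.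
have mR : 0 < m%:R :> R by rewrite ltr0n; near: m; exact: nbhs_infty_gt.
have tm : 0 <= t / m%:R by rewrite divr_ge0// ltW.
rewrite step_mxE mxnormZ -rmorphM (normc_real (mulr_ge0 tm tm)).
have -> : m%:R * (t / m%:R * (t / m%:R) * mxnorm defect_mx) =
  t * t * mxnorm defect_mx / m%:R by field; rewrite gt_eqF.
by near: m; exact: near_inv.
Unshelve. all: by end_near. Qed.

Lemma step_mx_kraus s : 0 <= s -> exists r : seq (J -> J -> C),
  forall x z, step_mx s (enum_rank x) (enum_rank z) =
     \sum_(K <- r) (K x.1 z.1)^* * K x.2 z.2.
Proof.
move=> s0; have [r rE] := gram_factor (fun x : J * J => eta (U x.1 x.2)).
have sC : 0 <= s%:C%C :> C by rewrite ler0c.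
exists ((fun i k => euler_step L s (U i k) : C) ::
  [seq (fun i k => sqrtC s%:C%C * K (i, k)) | K <- r]) => x z.
rewrite mxE !enum_rankK big_cons big_map; congr (_ + _).
have := rE (x.1, z.1) (x.2, z.2) => /= ->.
rewrite mulr_sumr; apply: eq_bigr => K _.
rewrite rmorphM /= (_ : (sqrtC _)^* = sqrtC s%:C%C); last first.
  by rewrite conj_Creal// ger0_real// sqrtC_ge0.
by rewrite -{1}[s%:C%C]sqrtCK; ring.
Qed.

End Step.

(** On the tensor product of the entrywise adjoint of U with U, the semigroup is
the limit of the powers of step_mx, which are completely positive since step_mx has a Kraus decomposition: a rank one
term and s times a Gram matrix of vectors eta (U_ij). *)
Lemma schoenberg_positive (om : R -> {linear Pol -> C^o}) :
  conv_semigroup om -> generates L om ->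
  forall t, 0 <= t -> forall a, 0 <= (om t (star a * a) : C).
Proof.
move=> som Lom t t0 a; have [J [U [UP [c ->]]]] := corep_exists a.
rewrite coefficient_square.
have VP := corep_prodP (corep_star UP) UP.
have lim := semigroup_approx (conv_semigroup_mx VP som) (generates_mx VP Lom) t0
  (step_tangent UP t0).
apply: (cvgC_ge0 _ (cvg_choi_form (X := fun m => step_mx U (t / m%:R) ^+ m) _)).
  by move=> x y; apply: mxnorm_cvg_entry lim.
near=> m; have tm : 0 <= t / m%:R by rewrite divr_ge0.
have [r rE] := step_mx_kraus U tm.
exact: (choi_positiveX _ rE).
Unshelve. all: by end_near. Qed.

End Schoenberg.

(** * A product of states on an algebra of adjointable operators *)

Section AdjointableAlgebra.
Variables (C : numClosedFieldType) (V : lmodType C) (F : V -> V -> C) (Om : V).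

Record vector_form : Prop := {
  form_semi : semi_inner F;
  form_unit : F Om Om = 1 }.

Variable FP : vector_form.
Let FS : semi_inner F := form_semi FP.

(** The adjoint is part of the data: the form may be degenerate, so that an
operator does not determine its adjoint. It lives in the conjugate module
because it depends antilinearly on the operator. *)
Definition operator_pair : Type := ((V -> V) * conjugate_module (V -> V))%type.
HB.instance Definition _ := GRing.Lmodule.on operator_pair.

Definition adjoint_pair_of of vector_form : {pred operator_pair} := [pred T |
  `[< [/\ linear T.1, linear (T.2 : V -> V) &
     forall x y, F (T.1 x) y = F x ((T.2 : V -> V) y)] >]].

Local Notation adjoint_pair := (adjoint_pair_of FP).

Fact adjoint_pair_submod : submod_closed adjoint_pair.
Proof.
split.
  apply/asboolP; split=> [c x y|c x y|x y] /=.
  - by rewrite scaler0 addr0.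
  - by rewrite /= scaler0 addr0.
  - by rewrite (form0l FS) (form0r FS).
move=> c T S /asboolP[T1 T2 TT] /asboolP[S1 S2 SS]; apply/asboolP.
split=> [d x y|d x y|x y].
- rewrite -[(_ + S).1]/(c *: T.1 + S.1) /= !fctE T1 S1 !scalerDr !scalerA.
  by rewrite [c * d]mulrC addrACA.
- rewrite -[(_ + S).2]/(c^* *: (T.2 : V -> V) + (S.2 : V -> V)) /= !fctE T2 S2.
  by rewrite !scalerDr !scalerA [c^* * d]mulrC addrACA.
- rewrite -[(_ + S).1]/(c *: T.1 + S.1).
  rewrite -[(_ + S).2]/(c^* *: (T.2 : V -> V) + (S.2 : V -> V)) /= !fctE.
  by rewrite (formDl FS) (formDr FS) (formZl FS) (formZr FS) TT SS.
Qed.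

HB.instance Definition _ := GRing.isSubmodClosed.Build C operator_pair
  adjoint_pair adjoint_pair_submod.

Record adjointable_of : Type := Adjointable {
  adj_val :> operator_pair;
  adj_valP : adj_val \in adjoint_pair }.
Local Notation A := adjointable_of.

HB.instance Definition _ := [isSub for adj_val].
HB.instance Definition _ := gen_eqMixin A.
HB.instance Definition _ := gen_choiceMixin A.
HB.instance Definition _ := [SubChoice_isSubLmodule of A by <:].

Definition adj_op (T : A) : V -> V := (adj_val T).1.
Definition adj_adj (T : A) : V -> V := (adj_val T).2.

Lemma adj_eq (S T : A) : adj_op S =1 adj_op T -> adj_adj S =1 adj_adj T -> S = T.
Proof.
move=> h1 h2; apply: val_inj => /=.
rewrite [val S]surjective_pairing [val T]surjective_pairing.
by congr (_, _); apply/funext.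
Qed.

Lemma adj_opP (T : A) : linear (adj_op T).
Proof. have /asboolP[h1 h2 h3] := adj_valP T; exact: h1. Qed.
Lemma adj_adjP (T : A) : linear (adj_adj T).
Proof. have /asboolP[h1 h2 h3] := adj_valP T; exact: h2. Qed.
Lemma adjP (T : A) x y : F (adj_op T x) y = F x (adj_adj T y).
Proof. have /asboolP[h1 h2 h3] := adj_valP T; exact: (h3 x y). Qed.

Fact adj_mk_subproof (f g : V -> V) : linear f -> linear g ->
  (forall x y, F (f x) y = F x (g y)) -> ((f, g) : operator_pair) \in adjoint_pair.
Proof. by move=> *; apply/asboolP; split. Qed.

Definition adj_mk (f g : V -> V) (lf : linear f) (lg : linear g)
  (fg : forall x y, F (f x) y = F x (g y)) : A :=
  Adjointable (adj_mk_subproof lf lg fg).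

Lemma adj_opD (S T : A) x : adj_op (S + T) x = adj_op S x + adj_op T x.
Proof. by []. Qed.
Lemma adj_opZ c (T : A) x : adj_op (c *: T) x = c *: adj_op T x.
Proof. by []. Qed.
Lemma adj_adjD (S T : A) x : adj_adj (S + T) x = adj_adj S x + adj_adj T x.
Proof. by []. Qed.
Lemma adj_adjZ c (T : A) x : adj_adj (c *: T) x = c^* *: adj_adj T x.
Proof. by []. Qed.

Fact id_linear : linear (@id V). Proof. by []. Qed.
Definition adj_one : A := adj_mk id_linear id_linear (fun x y => erefl).

Fact comp_linear (f g : V -> V) : linear f -> linear g -> linear (f \o g).
Proof. by move=> lf lg c x y; rewrite /= lg lf. Qed.
Fact adj_mul_subproof (S T : A) x y :
  F ((adj_op S \o adj_op T) x) y = F x ((adj_adj T \o adj_adj S) y).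
Proof. by rewrite /= !adjP. Qed.
Definition adj_mul (S T : A) : A :=
  adj_mk (comp_linear (adj_opP S) (adj_opP T)) (comp_linear (adj_adjP T) (adj_adjP S))
    (adj_mul_subproof S T).

Fact adj_star_subproof (T : A) x y : F (adj_adj T x) y = F x (adj_op T y).
Proof. by rewrite (form_herm FS) -adjP -(form_herm FS). Qed.
Definition adj_star (T : A) : A := adj_mk (adj_adjP T) (adj_opP T) (adj_star_subproof T).

Lemma linear_add (f : V -> V) x y : linear f -> f (x + y) = f x + f y.
Proof. by move=> lf; have := lf 1 x y; rewrite !scale1r. Qed.
Lemma linear_scale (f : V -> V) c x : linear f -> f (c *: x) = c *: f x.
Proof.
move=> lf; have f0 : f 0 = 0.
  by have := lf (-1) 0 0; rewrite scaler0 addr0 scaleN1r addNr.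
by have := lf c x 0; rewrite f0 !addr0.
Qed.

Fact adj_mulA : associative adj_mul.
Proof. by move=> S T U; apply: adj_eq. Qed.
Fact adj_mul1 : left_id adj_one adj_mul.
Proof. by move=> T; apply: adj_eq. Qed.
Fact adj_1mul : right_id adj_one adj_mul.
Proof. by move=> T; apply: adj_eq. Qed.
Fact adj_mulDl : left_distributive adj_mul +%R.
Proof.
move=> S T U; apply: adj_eq => // x.
by rewrite adj_adjD; exact: (linear_add _ _ (adj_adjP U)).
Qed.
Fact adj_mulDr : right_distributive adj_mul +%R.
Proof.
move=> S T U; apply: adj_eq => // x.
by rewrite adj_opD; exact: (linear_add _ _ (adj_opP S)).
Qed.
Fact adj_1neq0 : adj_one != 0.
Proof.
apply/eqP => /(congr1 (fun T => F Om (adj_op T Om))).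
rewrite -[LHS]/(F Om Om) -[RHS]/(F Om 0) form_unit// (form0r FS).
by apply/eqP/oner_neq0.
Qed.
HB.instance Definition _ := GRing.Zmodule_isNzRing.Build A
  adj_mulA adj_mul1 adj_1mul adj_mulDl adj_mulDr adj_1neq0.

Fact adj_scaleAl (c : C) (S T : A) : c *: (S * T) = (c *: S) * T.
Proof.
apply: adj_eq => // x; rewrite adj_adjZ.
exact: esym (linear_scale c^* (adj_adj S x) (adj_adjP T)).
Qed.
HB.instance Definition _ := GRing.Lmodule_isLalgebra.Build C A adj_scaleAl.
Fact adj_scaleAr (c : C) (S T : A) : c *: (S * T) = S * (c *: T).
Proof.
apply: adj_eq => // x; rewrite adj_opZ.
exact: esym (linear_scale c (adj_op T x) (adj_opP S)).
Qed.
HB.instance Definition _ := GRing.Lalgebra_isAlgebra.Build C A adj_scaleAr.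

Fact adj_starK : involutive adj_star.
Proof. by move=> T; apply: adj_eq. Qed.
Fact adj_starD : {morph adj_star : S T / S + T}.
Proof. by move=> S T; apply: adj_eq. Qed.
Fact adj_starM (S T : A) : adj_star (S * T) = adj_star T * adj_star S.
Proof. by apply: adj_eq. Qed.
Fact adj_starZ (c : C) (T : A) : adj_star (c *: T) = c^* *: adj_star T.
Proof.
apply: adj_eq => // x.
by rewrite adj_adjZ conjCK.
Qed.
HB.instance Definition _ := isStarAlgebra.Build C A
  adj_starK adj_starD adj_starM adj_starZ.

Definition vector_state (T : A) : C^o := F Om (adj_op T Om).
Fact vector_state_linear : linear vector_state.
Proof. by move=> c S T; rewrite /vector_state adj_opD adj_opZ (form_linear FS). Qed.
HB.instance Definition _ :=
  GRing.isLinear.Build C A C^o *:%R vector_state vector_state_linear.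

Lemma vector_stateP : state vector_state.
Proof.
split=> [|T]; first exact: (form_unit FP).
rewrite -[X in 0 <= X]/(F Om (adj_adj T (adj_op T Om))) -adjP; exact: (form_ge0 FS).
Qed.

End AdjointableAlgebra.

Section StateTheory.
Variables (C : numClosedFieldType) (A : starAlgType C) (w : {linear A -> C^o}).

(** Polarization: positivity on 1 + a and on 1 + i a makes the combinations
w a + w (star a) and i (w a - w (star a)) real. *)
Lemma positive_herm : (forall a, 0 <= (w (star a * a) : C)) ->
  forall a, (w (star a) : C) = (w a : C)^*.
Proof.
move=> wpos.
have wD a b : (w (a + b) : C) = (w a : C) + w b by rewrite linearD.
have wZ c a : (w (c *: a) : C) = c * (w a : C) by rewrite linearZ.
have real_cross a b : ((w (star a * b) : C) + w (star b * a))^* =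
    (w (star a * b) : C) + w (star b * a).
  have h : (w (star a * b) : C) + w (star b * a) =
     w (star (a + b) * (a + b)) - w (star a * a) - w (star b * b).
    by rewrite starD !mulrDl !mulrDr !wD; ring.
  by rewrite h !rmorphB /= ![((w _ : C))^*]conj_Creal// ger0_real// wpos.
move=> a.
have h1 := real_cross 1 a; have h2 := real_cross 1 ('i *: a).
move: h1 h2; rewrite !star1 !mul1r !mulr1 starZ !wZ conjCi.
set x := (w a : C); set y := (w (star a) : C).
rewrite !rmorphD !rmorphM /= rmorphN /= conjCi => h1 h2.
have i0 : ('i : C) != 0 by rewrite neq0Ci.
have h2' : - x^* + y^* = x - y.
  by apply: (mulfI i0); move: h2; rewrite opprK mulrDr mulrBr mulrN mulNr => ->; ring.
have : 2 * y = 2 * x^*.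
  have -> : 2 * y = (x + y) - (x - y) by ring.
  by rewrite -h1 -h2'; ring.
by move/(mulfI _); apply; rewrite pnatr_eq0.
Qed.

Lemma positive_hermM : (forall a, 0 <= (w (star a * a) : C)) ->
  forall a b, (w (star a * b) : C) = (w (star b * a) : C)^*.
Proof. by move=> wpos a b; rewrite -(positive_herm wpos) starM starK. Qed.

End StateTheory.

Section ProductSpace.
Variables (C : numClosedFieldType) (A : starAlgType C) (eps : starMorphism A C^o).
Variables (I : choiceType) (w : I -> {linear A -> C^o}).

(** Inside the tensor product of the GNS spaces of the states w i, with vacuum
vectors 1, only the vectors that differ from the vacuum at one site at most are
kept: a multiple of the vacuum, and at each site an element of the kernel
of w i. *)
Definition product_ambient : Type := (C^o * (I -> A))%type.
HB.instance Definition _ := GRing.Lmodule.on product_ambient.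

Definition finite_kernel : {pred product_ambient} := [pred x |
  `[< (exists s : seq I, forall i, i \notin s -> x.2 i = 0) /\ (forall i, w i (x.2 i) = 0) >]].

Fact finite_kernel_submod : submod_closed finite_kernel.
Proof.
split; first by apply/asboolP; split=> [|i]; [exists [::]|rewrite linear0].
move=> c x y /asboolP[[s xs] wx] /asboolP[[t yt] wy]; apply/asboolP; split.
  exists (s ++ t) => i; rewrite mem_cat negb_or => /andP[/xs xi /yt yi].
  by rewrite -[LHS]/(c *: x.2 i + y.2 i) xi yi scaler0 addr0.
by move=> i; rewrite -[(_ + y).2 i]/(c *: x.2 i + y.2 i) linearP /= wx wy scaler0 addr0.
Qed.
HB.instance Definition _ := GRing.isSubmodClosed.Build C product_ambient
  finite_kernel finite_kernel_submod.

Record product_space := ProductSpace {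
  ps_val :> product_ambient;
  ps_valP : ps_val \in finite_kernel }.
Local Notation V := product_space.
HB.instance Definition _ := [isSub for ps_val].
HB.instance Definition _ := gen_eqMixin V.
HB.instance Definition _ := gen_choiceMixin V.
HB.instance Definition _ := [SubChoice_isSubLmodule of V by <:].

Definition ps_scal (x : V) : C := (ps_val x).1.
Definition ps_comp (x : V) (i : I) : A := (ps_val x).2 i.

Lemma ps_eq (x y : V) : ps_scal x = ps_scal y -> ps_comp x =1 ps_comp y -> x = y.
Proof.
move=> h1 h2; apply: val_inj => /=.
rewrite [val x]surjective_pairing [val y]surjective_pairing.
by congr (_, _); [exact: h1|apply/funext].
Qed.

Lemma ps_scalP c (x y : V) : ps_scal (c *: x + y) = c * ps_scal x + ps_scal y.
Proof. by []. Qed.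
Lemma ps_compP c (x y : V) i : ps_comp (c *: x + y) i = c *: ps_comp x i + ps_comp y i.
Proof. by []. Qed.
Lemma ps_kernel (x : V) i : w i (ps_comp x i) = 0.
Proof. by have /asboolP[] := ps_valP x. Qed.
Lemma ps_finite (x : V) : exists s : seq I, forall i, i \notin s -> ps_comp x i = 0.
Proof. by have /asboolP[] := ps_valP x. Qed.

Definition ps_supp (x : V) : seq I := undup (projT1 (cid (ps_finite x))).

Lemma ps_suppP (x : V) i : i \notin ps_supp x -> ps_comp x i = 0.
Proof. by rewrite mem_undup; case: cid => s /= h; exact: h. Qed.

Definition ps_form (x y : V) : C := (ps_scal x)^* * ps_scal y +
  \sum_(k <- ps_supp x) (w k (star (ps_comp x k) * ps_comp y k) : C).

Lemma big_supp_eq (S T : seq I) (G : I -> C) : uniq S -> uniq T ->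
  (forall k, k \notin S -> G k = 0) -> (forall k, k \notin T -> G k = 0) ->
  \sum_(k <- S) G k = \sum_(k <- T) G k.
Proof.
move=> uS uT GS GT.
have restr (P Q : seq I) : (forall k, k \notin Q -> G k = 0) ->
    \sum_(k <- P) G k = \sum_(k <- [seq k <- P | k \in Q]) G k.
  move=> GQ; rewrite big_filter [LHS](bigID (mem Q)) /= [X in _ + X]big1 ?addr0//.
rewrite (restr S T)// (restr T S)//; apply: perm_big; apply: uniq_perm.
- exact: filter_uniq.
- exact: filter_uniq.
- by move=> k; rewrite !mem_filter andbC.
Qed.

Lemma ps_formE (x y : V) (S : seq I) : uniq S -> (forall k, k \notin S -> ps_comp x k = 0) ->
  ps_form x y = (ps_scal x)^* * ps_scal y +
    \sum_(k <- S) (w k (star (ps_comp x k) * ps_comp y k) : C).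
Proof.
move=> uS xS; congr (_ + _); apply: big_supp_eq => // [|k kx|k kS].
- exact: undup_uniq.
- by rewrite (ps_suppP kx) star0 mul0r linear0.
- by rewrite (xS _ kS) star0 mul0r linear0.
Qed.

Lemma ps_common_supp (x y : V) : exists2 S : seq I, uniq S &
  (forall k, k \notin S -> ps_comp x k = 0 /\ ps_comp y k = 0).
Proof.
exists (undup (ps_supp x ++ ps_supp y)); first exact: undup_uniq.
by move=> k; rewrite mem_undup mem_cat negb_or => /andP[/ps_suppP -> /ps_suppP ->].
Qed.

Hypothesis wP : forall i, state (w i).

Let wpos i a : 0 <= (w i (star a * a) : C). Proof. by case: (wP i). Qed.
Let w1 i : (w i 1 : C) = 1. Proof. by case: (wP i). Qed.
Let wD i a b : (w i (a + b) : C) = (w i a : C) + w i b. Proof. by rewrite linearD. Qed.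
Let wB i a b : (w i (a - b) : C) = (w i a : C) - w i b. Proof. by rewrite linearB. Qed.
Let wZ i c a : (w i (c *: a) : C) = c * (w i a : C). Proof. by rewrite linearZ. Qed.

Fact vacuum_subproof : ((1, fun=> 0) : product_ambient) \in finite_kernel.
Proof. by apply/asboolP; split=> [|i]; [exists [::]|rewrite linear0]. Qed.
Definition vacuum : V := ProductSpace vacuum_subproof.

Lemma ps_form_vacuum y : ps_form vacuum y = ps_scal y.
Proof. by rewrite (@ps_formE _ _ [::])// big_nil addr0 /= conjC1 mul1r. Qed.

Lemma ps_form_vector : vector_form ps_form vacuum.
Proof.
split; last by rewrite ps_form_vacuum.
split=> [x c y z|x y|x].
- rewrite /ps_form ps_scalP.
  have -> : \sum_(k <- ps_supp x) (w k (star (ps_comp x k) * ps_comp (c *: y + z) k) : C) =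
      c * (\sum_(k <- ps_supp x) (w k (star (ps_comp x k) * ps_comp y k) : C)) +
      \sum_(k <- ps_supp x) (w k (star (ps_comp x k) * ps_comp z k) : C).
    rewrite mulr_sumr -big_split /=; apply: eq_bigr => k _.
    by rewrite ps_compP mulrDr -scalerAr wD wZ.
  by ring.
- have [S uS xyS] := ps_common_supp x y.
  rewrite (@ps_formE x y S)// => [|k /xyS[]//].
  rewrite (@ps_formE y x S)// => [|k /xyS[]//].
  rewrite rmorphD rmorphM /= conjCK mulrC; congr (_ + _).
  rewrite rmorph_sum /=; apply: eq_bigr => k _; exact: positive_hermM.
- apply: addr_ge0; first by rewrite mulrC mul_conjC_ge0.
  by apply: sumr_ge0 => k _; exact: wpos.
Qed.

Section Site.
Variable i : I.

Definition site_vec (a : A) (x : V) : A := a * ((ps_scal x)%:A + ps_comp x i).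

(** The algebra acts by left multiplication, as in the GNS representation of
w i, on the span of the vacuum and the vectors at site i, and through the
character eps on the vectors at the other sites. The new element at site i is
split into its mean, which goes to the vacuum, and its centered part. *)
Definition site_raw (a : A) (x : V) : product_ambient :=
  (w i (site_vec a x),
   fun k => if k == i then site_vec a x - (w i (site_vec a x) : C)%:A
            else (eps a : C) *: ps_comp x k).

Fact site_subproof a x : site_raw a x \in finite_kernel.
Proof.
apply/asboolP; split=> [|k] /=.
  exists (i :: ps_supp x) => k; rewrite inE negb_or => /andP[/negPf -> /ps_suppP ->].
  by rewrite scaler0.
case: eqP => [->|_].
  have := wB i (site_vec a x) (w i (site_vec a x))%:A.
  by rewrite wZ w1 mulr1 subrr.
by have := wZ k (eps a) (ps_comp x k); rewrite ps_kernel mulr0.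
Qed.
Definition site (a : A) (x : V) : V := ProductSpace (site_subproof a x).

Lemma site_scal a x : ps_scal (site a x) = w i (site_vec a x).
Proof. by []. Qed.
Lemma site_comp a x k : ps_comp (site a x) k =
  if k == i then site_vec a x - (w i (site_vec a x) : C)%:A
            else (eps a : C) *: ps_comp x k.
Proof. by []. Qed.

Lemma site_vec_linear a c x y :
  site_vec a (c *: x + y) = c *: site_vec a x + site_vec a y.
Proof.
rewrite /site_vec ps_scalP ps_compP scalerDl -scalerA addrACA -scalerDr mulrDr.
by rewrite scalerAr.
Qed.

Fact site_linear a : linear (site a).
Proof.
move=> c x y; apply: ps_eq => [|k].
  by rewrite ps_scalP !site_scal site_vec_linear wD wZ.
rewrite ps_compP !site_comp site_vec_linear wD wZ; case: eqP => _.
  by rewrite scalerDl -scalerA opprD addrACA -scalerBr.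
by rewrite scalerDr !scalerA mulrC.
Qed.

Lemma site_vec_linearl c a b x :
  site_vec (c *: a + b) x = c *: site_vec a x + site_vec b x.
Proof. by rewrite /site_vec mulrDl scalerAl. Qed.

Lemma site_linearl c a b x : site (c *: a + b) x = c *: site a x + site b x.
Proof.
apply: ps_eq => [|k].
  by rewrite ps_scalP !site_scal site_vec_linearl wD wZ.
rewrite ps_compP !site_comp site_vec_linearl wD wZ; case: eqP => _.
  by rewrite scalerDl -scalerA opprD addrACA -scalerBr.
have -> : (eps (c *: a + b) : C) = c * (eps a : C) + eps b by rewrite linearP.
by rewrite scalerDl scalerA.
Qed.

Lemma site1 x : site 1 x = x.
Proof.
have wv : (w i (site_vec 1 x) : C) = ps_scal x.
  by rewrite /site_vec mul1r wD wZ w1 mulr1 ps_kernel addr0.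
apply: ps_eq => [//|k]; rewrite site_comp wv /site_vec mul1r.
case: eqP => [->|_]; first by rewrite addrC addKr.
by have -> : (eps 1 : C) = 1 by [rewrite rmorph1]; rewrite scale1r.
Qed.

Lemma site_vecM a b x : site_vec (a * b) x = site_vec a (site b x).
Proof.
rewrite [RHS]/site_vec site_scal site_comp eqxx [_ + (_ - _)]addrC subrK.
by rewrite /site_vec mulrA.
Qed.

Lemma siteM a b x : site (a * b) x = site a (site b x).
Proof.
apply: ps_eq => [|k]; first by rewrite !site_scal site_vecM.
rewrite !site_comp site_vecM; case: eqP => // _; rewrite scalerA.
by have -> : (eps (a * b) : C) = (eps a : C) * eps b by rewrite rmorphM.
Qed.

Lemma site_adjoint a x y : ps_form (site a x) y = ps_form x (site (star a) y).
Proof.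
have [S uS xyS] := ps_common_supp x y.
pose T := undup (i :: S).
have uT : uniq T by exact: undup_uniq.
have iT : i \in T by rewrite mem_undup mem_head.
have xyT k : k \notin T -> [/\ k != i, ps_comp x k = 0 & ps_comp y k = 0].
  by rewrite mem_undup inE negb_or => /andP[ki /xyS[]].
rewrite (@ps_formE _ _ T)//; last first.
  by move=> k /xyT[/negPf ki xk _]; rewrite site_comp ki xk scaler0.
rewrite (@ps_formE x _ T)//; last by move=> k /xyT[].
rewrite !(bigD1_seq i iT uT) /= !addrA; congr (_ + _); last first.
  apply: eq_bigr => k /negPf ki; rewrite !site_comp ki starZ.
  rewrite -scalerAl -scalerAr !wZ.
  by have -> : (eps (star a) : C) = (eps a : C)^* by rewrite star_morph.
rewrite !site_comp eqxx !site_scal.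
set v := site_vec a x; set v' := site_vec (star a) y.
have scalar_star (c : C) : star (c%:A : A) = (c^*)%:A by rewrite starZ star1.
rewrite starD -scaleN1r starZ scalar_star rmorphN1 scaleN1r.
rewrite mulrDl mulNr -scalerAl mul1r mulrBr -scalerAr mulr1 !wB !wZ ps_kernel mulr0 subr0.
have -> : (w i (star (ps_comp x i)) : C) = 0.
  by rewrite (positive_herm (wpos i)) ps_kernel conjC0.
rewrite mulr0 subr0 -(positive_herm (wpos i)).
transitivity ((w i (star v * ((ps_scal y)%:A + ps_comp y i)) : C)).
  by rewrite mulrDr -scalerAr mulr1 wD wZ mulrC.
transitivity ((w i (star ((ps_scal x)%:A + ps_comp x i) * v') : C)).
  by rewrite /v /v' /site_vec starM mulrA.
by rewrite starD scalar_star mulrDl -scalerAl mul1r wD wZ.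
Qed.

Local Notation B := (adjointable_of ps_form_vector).

Definition site_hom (a : A) : B :=
  adj_mk ps_form_vector (site_linear a) (site_linear (star a)) (site_adjoint a).

Fact site_hom_linear : linear site_hom.
Proof.
move=> c a b; apply: adj_eq => x; first exact: site_linearl.
rewrite -[LHS]/(site (star (c *: a + b)) x) starD starZ site_linearl.
by rewrite adj_adjD adj_adjZ.
Qed.
Fact site_hom_monoid : monoid_morphism site_hom.
Proof.
split=> [|a b]; apply: adj_eq => x.
- exact: site1.
- by rewrite -[LHS]/(site (star 1) x) star1 site1.
- exact: siteM.
- by rewrite -[LHS]/(site (star (a * b)) x) starM siteM.
Qed.
Fact site_hom_star a : site_hom (star a) = star (site_hom a).
Proof.
apply: adj_eq => x //.
by rewrite -[LHS]/(site (star (star a)) x) starK.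
Qed.
HB.instance Definition _ := GRing.isLinear.Build C A B *:%R site_hom site_hom_linear.
HB.instance Definition _ := GRing.isMonoidMorphism.Build A B site_hom site_hom_monoid.
HB.instance Definition _ := isStarMorphism.Build C A B site_hom site_hom_star.

End Site.

Local Notation B := (adjointable_of ps_form_vector).

Definition scalar_hom (a : A) : B := (eps a : C)%:A.
Fact scalar_hom_linear : linear scalar_hom.
Proof.
move=> c a b; rewrite /scalar_hom.
have -> : (eps (c *: a + b) : C) = c * (eps a : C) + eps b by rewrite linearP.
by rewrite scalerDl scalerA.
Qed.
Fact scalar_hom_monoid : monoid_morphism scalar_hom.
Proof.
split=> [|a b]; rewrite /scalar_hom.
  by have -> : (eps 1 : C) = 1 by [rewrite rmorph1]; rewrite scale1r.
have -> : (eps (a * b) : C) = (eps a : C) * eps b by rewrite rmorphM.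
by rewrite -scalerAl mul1r scalerA.
Qed.
Fact scalar_hom_star a : scalar_hom (star a) = star (scalar_hom a).
Proof.
rewrite /scalar_hom starZ star1.
by have -> : (eps (star a) : C) = (eps a : C)^* by rewrite star_morph.
Qed.
HB.instance Definition _ := GRing.isLinear.Build C A B *:%R scalar_hom scalar_hom_linear.
HB.instance Definition _ := GRing.isMonoidMorphism.Build A B scalar_hom scalar_hom_monoid.
HB.instance Definition _ := isStarMorphism.Build C A B scalar_hom scalar_hom_star.

(** The case None serves increments over empty intervals, whose law is eps. *)
Definition slot_hom (o : option I) : starMorphism A B :=
  if o is Some i then site_hom i else scalar_hom.

Definition slot_state (o : option I) (a : A) : C :=
  if o is Some i then w i a else eps a.

Local Notation Phi := (@vector_state _ _ _ _ ps_form_vector).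

(** At a site that has not been used yet the vector has no component, so acting
with a multiplies its vacuum component by w i a; and only the components at the
used sites are ever different from 0. *)
Lemma slot_vacuum K (r : seq K) (o : K -> option I) (a : K -> A) :
  uniq (pmap o r) ->
  let x := adj_op (\prod_(k <- r) slot_hom (o k) (a k)) vacuum in
  ps_scal x = \prod_(k <- r) slot_state (o k) (a k) /\
  forall i, i \notin pmap o r -> ps_comp x i = 0.
Proof.
elim: r => [|k r IH] /=; first by rewrite !big_nil.
rewrite !big_cons; set P := \prod_(j <- r) _; set p := \prod_(j <- r) slot_state _ _.
move=> uo.
have opE (f : A -> B) : adj_op (f (a k) * P) vacuum = adj_op (f (a k)) (adj_op P vacuum) by [].
case ok : (o k) uo => [i|] /= uo.
  move: uo => /andP[ir uo]; have [IH1 IH2] := IH uo.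
  rewrite (opE (site_hom i)) -[adj_op (site_hom i _) _]/(site i (a k) _).
  have vE : site_vec i (a k) (adj_op P vacuum) = p *: a k.
    by rewrite /site_vec IH1 (IH2 _ ir) addr0 -scalerAr mulr1.
  split; first by rewrite site_scal vE wZ mulrC.
  move=> j; rewrite inE negb_or => /andP[/negPf ji jr].
  by rewrite site_comp ji (IH2 _ jr) scaler0.
have [IH1 IH2] := IH uo.
have xE : adj_op (scalar_hom (a k) * P) vacuum = (eps (a k) : C) *: adj_op P vacuum by [].
rewrite xE -[_ *: _]addr0; split=> [|j jr].
  by rewrite ps_scalP IH1 addr0.
by rewrite ps_compP (IH2 _ jr) scaler0 addr0.
Qed.

Lemma slot_product K (r : seq K) (o : K -> option I) (a : K -> A) :
  uniq (pmap o r) ->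
  (Phi (\prod_(k <- r) slot_hom (o k) (a k)) : C) = \prod_(k <- r) slot_state (o k) (a k).
Proof.
move=> uo; rewrite -[LHS]/(ps_form vacuum (adj_op _ vacuum)) ps_form_vacuum.
by have [] := slot_vacuum a uo.
Qed.

Lemma slot_single o a : (Phi (slot_hom o a) : C) = slot_state o a.
Proof.
have := @slot_product unit [:: tt] (fun=> o) (fun=> a); rewrite !big_seq1; apply.
by rewrite /=; case: o.
Qed.

End ProductSpace.

(** * Construction of a Levy process *)

Section LevyConstruction.
Variables (R : realType) (n : nat).
Local Notation C := R[i].
Local Notation Pol := (Pol C n).
Local Notation eps := (counit C n).

Lemma convolution_ext (mu mu' nu nu' : {linear Pol -> C^o}) :
  mu =1 mu' -> nu =1 nu' -> convolution mu nu =1 convolution mu' nu'.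
Proof.
move=> mm nn a; rewrite /convolution /tensor_functional.
by apply: tensor_eq => b c; rewrite /= /product_fun mm nn.
Qed.

(** Disjoint intervals that are not empty have different endpoints, since each
contains its left endpoint; empty ones occupy no site. *)
Lemma slot_uniq (m : nat) (s t : 'I_m -> R) :
  trivIset setT (fun i => `[s i, t i[%classic) ->
  uniq (pmap (fun i => if s i < t i then Some (s i, t i) else None) (index_enum 'I_m)).
Proof.
move=> tI; set o := fun i : 'I_m => _.
elim: (index_enum 'I_m) (index_enum_uniq 'I_m) => //= i r IH /andP[ir ur].
case oi : (o i) => [x|] /=; last exact: IH.
rewrite IH// andbT mem_pmap; apply/mapP => -[j jr].
move: oi; rewrite /o; case: ifP => // sti [<-]; case: ifP => // stj [sij tij].
have ij : i = j.
  apply: tI => //; exists (s i); split; rewrite /= in_itv /=.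
    by rewrite lexx.
  by rewrite -sij -tij lexx.
by move: ir; rewrite ij jr.
Qed.

Variable om : R -> {linear Pol -> C^o}.
Hypothesis som : conv_semigroup om.
Hypothesis stom : forall t, 0 <= t -> state (om t).
Hypothesis om_cvg : forall a, (om t a : C^o) @[t --> 0^'+] --> eps a.

(* Only pairs i with i.1 < i.2 are ever used; the absolute value makes w i a
   state for every pair. *)
Let w (i : R * R) : {linear Pol -> C^o} := om `|i.2 - i.1|.
Let wP i : state (w i). Proof. exact: stom. Qed.

Let Phi := @vector_state _ _ _ _ (ps_form_vector wP).
Let slot (s t : R) : option (R * R) := if s < t then Some (s, t) else None.
Let hom (s t : R) := slot_hom eps wP (slot s t).

Let omE s t a : s <= t -> (Phi (hom s t a) : C) = om (t - s) a.
Proof.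
move=> st; rewrite /Phi /hom slot_single /slot; case: ltP => [st'|ts] /=.
  by rewrite /w /= ger0_norm// subr_ge0.
have -> : t = s by apply/eqP; rewrite eq_le ts st.
by rewrite subrr som.1.
Qed.

Let om_of s t : {linear Pol -> C^o} := Phi \o hom s t.

(** Each interval is given its own site, carrying the state om (t - s). The
axioms of a Levy process only constrain the laws of single increments and the
joint moments of increments over disjoint intervals; the former hold since
om is a convolution semigroup, and the latter factorize because such
increments sit at distinct sites. *)
Lemma levy_of_semigroup : exists X : levy_process R n,
  forall t, 0 <= t -> forall a, omega X 0 t a = om t a.
Proof.
have omE' s t : s <= t -> om_of s t =1 om (t - s) by move=> st a; exact: omE.
have conv_ax r s t : 0 <= r -> r <= s -> s <= t ->
    forall a, om_of r t a = convolution (om_of r s) (om_of s t) a.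
  move=> r0 rs st a; rewrite (omE' _ _ (le_trans rs st)).
  rewrite (convolution_ext (omE' _ _ rs) (omE' _ _ st)).
  have -> : t - r = (s - r) + (t - s) by rewrite [RHS]addrC addrA subrK.
  by apply: som.2; rewrite subr_ge0.
have tt_ax t : 0 <= t -> forall a, om_of t t a = eps a.
  by move=> t0 a; rewrite (omE' _ _ (lexx t)) subrr som.1.
have stat_ax s t : 0 <= s -> s <= t -> forall a, om_of s t a = om_of 0 (t - s) a.
  by move=> s0 st a; rewrite (omE' _ _ st) omE' ?subr_ge0// subr0.
have ind_ax m (s t : 'I_m -> R) (a : 'I_m -> Pol) :
    (forall i, 0 <= s i <= t i) ->
    trivIset setT (fun i => `[s i, t i[%classic) ->
    Phi (\prod_(i < m) hom (s i) (t i) (a i)) = \prod_(i < m) om_of (s i) (t i) (a i).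
  move=> st tI; rewrite /Phi /hom.
  rewrite (slot_product eps wP (o := fun i => slot (s i) (t i)) a (slot_uniq tI)).
  by apply: eq_bigr => i _; rewrite -(slot_single eps wP).
have cvg_ax a : (om_of 0 t a : C^o) @[t --> 0^'+] --> (eps a : C^o).
  apply/cvgCP => e e0; have h : forall e : R, 0 < e -> \forall t \near 0^'+, normc ((om t a : C) - eps a) < e.
    by apply/cvgCP; exact: om_cvg.
  have /near_right0P[d d0 dP] := h e e0.
  apply/near_right0P; exists d => // t t0 td.
  by rewrite (omE' _ _ (ltW t0)) subr0; exact: dP.
pose X := @LevyProcess R n _ Phi hom (vector_stateP (ps_form_vector wP))
  conv_ax tt_ax stat_ax ind_ax cvg_ax.
by exists X => t t0 a; rewrite -[LHS]/(om_of 0 t a) omE'// subr0.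
Qed.

End LevyConstruction.

Section SchoenbergCorrespondence.
Variables (R : realType) (n : nat) (H : hilbertType R[i]).
Local Notation C := R[i].
Local Notation Pol := (Pol C n).
Local Notation eps := (counit C n).

Lemma triple_L1 (rho : Pol -> H -> H) eta (L : {linear Pol -> C^o}) :
  schurmann_triple rho eta L -> L 1 = 0.
Proof.
move=> t; have := st_coboundary t 1 1.
rewrite star1 mul1r rmorph1 (coc1 (st_cocycle t) (st_rep t)) inner0r add0r.
rewrite mul1r mulr1 => /add_self_eq0 //.
Qed.

Lemma conv_pow1 (mu : {linear Pol -> C^o}) m : mu 1 = 1 -> conv_pow mu m 1 = 1.
Proof.
move=> mu1; elim: m => [|m IH] /=; first exact: rmorph1.
rewrite /conv /convolution.
have -> : comult C n 1 = pure 1 1 by rewrite rmorph1.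
by rewrite tensor_functional_pure mu1 IH mulr1.
Qed.

(** Schoenberg correspondence: the semigroup generated by L consists of states,
being positive by schoenberg_positive and normalized since L 1 = 0, and it is
the law of a process. *)
Lemma schoenberg (rho : Pol -> H -> H) eta (L : {linear Pol -> C^o}) :
  schurmann_triple rho eta L -> exists X : levy_process R n, generating_functional X L.
Proof.
move=> t; have [om [som Lom om_lim]] := conv_semigroup_exists L.
have stom s : 0 <= s -> state (om s).
  move=> s0; split; last exact: (schoenberg_positive t som Lom s0).
  have := om_lim s s0 1.
  have -> : (fun m => conv_pow (euler_step L (s / m%:R)) m 1 : C^o) = fun=> 1.
    apply/funext => m; apply: conv_pow1.
    rewrite /= /euler_step (triple_L1 t) mulr0 addr0; exact: rmorph1.
  by move=> h; exact: (cvgC_unique _ h (cvg_cst _)).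
have om0 a : (om s a : C^o) @[s --> 0^'+] --> eps a.
  apply/cvgCP => e e0; have h : forall e : R, 0 < e ->
      \forall t \near 0^'+, normc ((om t a - eps a) / (t%:C)%C - L a : C) < e.
    by apply/cvgCP; exact: Lom.
  have slope := h _ ltr01.
  pose c := 1 + normc (L a); have c0 : 0 < c by rewrite ltr_pwDl// normc_ge0.
  near=> s; have s0 : 0 < s by near: s; exact: nbhs_right_gt.
  have se : s < e / c by near: s; apply: nbhs_right_lt; rewrite divr_gt0.
  have -> : (om s a : C) - eps a = s%:C%C * ((om s a - eps a) / (s%:C)%C).
    by rewrite mulrC mulfVK// realC_neq0.
  rewrite normcM (normc_real (ltW s0)) -ltr_pdivlMl//.
  rewrite (@le_lt_trans _ _ c)//; last first.
    by rewrite ltr_pdivlMl// -ltr_pdivlMr.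
  have h1 : normc ((om s a - eps a) / (s%:C)%C - L a) < 1 by near: s.
  rewrite -[X in normc X](subrK (L a : C)) (le_trans (le_normcD _ _))//.
  by rewrite lerD2r ltW.
have [X XE] := levy_of_semigroup som stom om0.
exists X => a; apply: cvg_trans (Lom a); apply: near_eq_cvg; near=> s.
by rewrite XE//; near: s; exact: nbhs_right_ge.
Unshelve. all: by end_near. Qed.

End SchoenbergCorrespondence.

(** * Completion of a space with a semi-inner product *)

Section Seminorm.
Variables (R : realType) (V : lmodType R[i]) (F : V -> V -> R[i]).
Local Notation C := R[i].
Hypothesis FS : semi_inner F.

Definition seminorm (x : V) : R := Num.sqrt (complex.Re (F x x)).

Lemma form_self_real x : F x x = (complex.Re (F x x))%:C%C.
Proof. by rewrite RRe_real// ger0_real// form_ge0. Qed.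

Lemma Re_form_ge0 x : 0 <= complex.Re (F x x).
Proof. by rewrite -ler0c -form_self_real form_ge0. Qed.

Lemma seminorm_ge0 x : 0 <= seminorm x. Proof. exact: sqrtr_ge0. Qed.

Lemma seminorm_sqr x : (seminorm x ^+ 2)%:C%C = F x x.
Proof. by rewrite sqr_sqrtr ?Re_form_ge0// -form_self_real. Qed.

Lemma normc_form_self x : normc (F x x) = seminorm x ^+ 2.
Proof. by rewrite -seminorm_sqr normc_real// sqr_ge0. Qed.

Lemma cauchy_schwarz x y : normc (F x y) <= seminorm x * seminorm y.
Proof.
(* expand F (z, z) >= 0 for z = y - t (F x y) x with t real; the minimum is at
   t = |x|^-2, and if |x| = 0 large t forces F x y = 0 *)
pose n := normc (F x y); have n0 : 0 <= n by exact: normc_ge0.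
have key (t : R) : 0 <= t ^+ 2 * n ^+ 2 * seminorm x ^+ 2 - 2 * t * n ^+ 2 + seminorm y ^+ 2.
  pose l : C := - (t%:C%C * F x y).
  have := form_ge0 FS (l *: x + y).
  rewrite (formDl FS) !(formDr FS) !(formZl FS) !(formZr FS) (form_herm FS y x).
  have tJ : (t%:C%C : C)^* = t%:C%C by rewrite conj_Creal// complex_real eqxx.
  have FJ : F x y * (F x y)^* = (n ^+ 2)%:C%C by rewrite -normCK normE rmorphXn.
  have lJ : l^* = - (t%:C%C * (F x y)^*).
    by rewrite /l rmorphN rmorphM /=; congr (- (_ * _)); exact: tJ.
  rewrite -!seminorm_sqr lJ /l.
  suff -> : - (t%:C%C * (F x y)^*) * (- (t%:C%C * F x y) * (seminorm x ^+ 2)%:C%C) +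
     - (t%:C%C * (F x y)^*) * F x y + (- (t%:C%C * F x y) * (F x y)^* + (seminorm y ^+ 2)%:C%C) =
     (t ^+ 2 * n ^+ 2 * seminorm x ^+ 2 - 2 * t * n ^+ 2 + seminorm y ^+ 2)%:C%C.
    by rewrite ler0c.
  transitivity (t%:C%C ^+ 2 * (n ^+ 2)%:C%C * (seminorm x ^+ 2)%:C%C
    - 2 * t%:C%C * (n ^+ 2)%:C%C + (seminorm y ^+ 2)%:C%C : C).
    by rewrite -FJ; ring.
  by rewrite -(rmorph_nat (real_complex R) 2) -rmorphXn -!rmorphM -rmorphB -rmorphD.
have nx := seminorm_ge0 x; have ny := seminorm_ge0 y.
rewrite -/n -(@ler_pXn2r _ 2)// ?nnegrE ?mulr_ge0// exprMn.
have [x0|x0] := eqVneq (seminorm x) 0.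
  rewrite x0 expr0n mul0r /= expr2.
  have [n00|n00] := eqVneq n 0; first by rewrite n00 mul0r.
  have := key ((seminorm y ^+ 2 + 1) / (2 * n ^+ 2)).
  rewrite x0 expr0n mulr0 add0r.
  have -> : 2 * ((seminorm y ^+ 2 + 1) / (2 * n ^+ 2)) * n ^+ 2 = seminorm y ^+ 2 + 1 by field.
  by rewrite opprD addrAC addNr add0r ler0N1.
have := key (seminorm x ^- 2).
have -> : seminorm x ^- 2 ^+ 2 * n ^+ 2 * seminorm x ^+ 2 - 2 * seminorm x ^- 2 * n ^+ 2 + seminorm y ^+ 2
  = seminorm y ^+ 2 - n ^+ 2 / seminorm x ^+ 2 by field.
by rewrite subr_ge0 ler_pdivrMr ?exprn_gt0 ?lt_neqAle ?(eq_sym 0) ?x0// mulrC.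
Qed.

Lemma seminormD x y : seminorm (x + y) <= seminorm x + seminorm y.
Proof.
rewrite -(@ler_pXn2r _ 2)// ?nnegrE ?addr_ge0 ?seminorm_ge0//.
rewrite -lecR seminorm_sqr (formDl FS) !(formDr FS) (form_herm FS y x) -!seminorm_sqr.
rewrite addrA -[X in X + _]addrA.
have -> : F x y + (F x y)^* = (2 * complex.Re (F x y))%:C%C.
  by rewrite rmorphM rmorph_nat; exact: addcJ.
rewrite -!rmorphD lecR sqrrD lerD2r lerD2l -[leRHS]mulr_natl ler_wpM2l//.
by rewrite (le_trans (ler_norm _))// (le_trans (normc_Re _))// cauchy_schwarz.
Qed.

Lemma seminormZ c x : seminorm (c *: x) = normc c * seminorm x.
Proof.
apply/eqP; rewrite -(@eqrXn2 _ 2) ?mulr_ge0 ?seminorm_ge0 ?normc_ge0//; apply/eqP.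
apply: complexI; rewrite seminorm_sqr (formZl FS) (formZr FS) mulrA exprMn rmorphM /= seminorm_sqr.
by congr (_ * _); rewrite mulrC -normCK normE rmorphXn.
Qed.

End Seminorm.

Section Completion.
Variables (R : realType) (V : lmodType R[i]) (F : V -> V -> R[i]).
Local Notation C := R[i].
Variable FS : semi_inner F.
Local Notation nrm := (seminorm F).

Definition approx (f : V -> C) (e : R) (v : V) : Prop :=
  forall b, normc (f b - F b v) <= e * nrm b.

Lemma approx_le f d e v : d <= e -> approx f d v -> approx f e v.
Proof.
by move=> de fv b; rewrite (le_trans (fv b))// ler_wpM2r// seminorm_ge0.
Qed.

Lemma approx_linear f g c d e v w : approx f d v -> approx g e w ->
  approx (fun b => c * f b + g b) (normc c * d + e) (c *: v + w).
Proof.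
move=> fv gw b; rewrite (form_linear FS).
have -> : c * f b + g b - (c * F b v + F b w) = c * (f b - F b v) + (g b - F b w) by ring.
rewrite (le_trans (le_normcD _ _))// normcM mulrDl -mulrA lerD//.
by rewrite ler_wpM2l ?normc_ge0.
Qed.

Lemma approx_form v d : 0 <= d -> approx (fun b => F b v) d v.
Proof. by move=> d0 b; rewrite subrr normc0 mulr_ge0// seminorm_ge0. Qed.

Lemma approx_close f d e v w : 0 <= d -> 0 <= e -> approx f d v -> approx f e w ->
  nrm (v - w) <= d + e.
Proof.
move=> d0 e0 fv fw; set b := v - w.
have : nrm b ^+ 2 <= (d + e) * nrm b.
  rewrite -(normc_form_self FS) {2}/b (formBr FS).
  have -> : F b v - F b w = (f b - F b w) - (f b - F b v) by ring.
  by rewrite (le_trans (le_normcD _ _))// normcN addrC mulrDl lerD.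
have := seminorm_ge0 F b; rewrite le_eqVlt => /predU1P[<- _|b0].
  by rewrite addr_ge0.
by rewrite expr2 ler_pM2r.
Qed.

(** A vector of the completion is encoded by the functional b |-> <b, f>. Those
that come from the completion are the ones that vectors of V approximate in
the norm of bounded functionals. This form needs neither a quotient by the
kernel of F nor classes of Cauchy sequences, and it makes equality pointwise. *)
Definition completable_of of semi_inner F : {pred V -> C^o} :=
  [pred f | `[< forall e : R, 0 < e -> exists v, approx f e v >]].
Local Notation completable := (completable_of FS).

Lemma completableP f : reflect (forall e : R, 0 < e -> exists v, approx f e v) (f \in completable).
Proof. exact: asboolP. Qed.

Fact completable_submod : submod_closed completable.
Proof.
split=> [|c f g /completableP fP /completableP gP]; apply/completableP => e e0.
  by exists 0 => b; rewrite (form0r FS) subr0 normc0 mulr_ge0 ?(ltW e0) ?seminorm_ge0.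
pose d := e / (normc c + 1).
have c1 : 0 < normc c + 1 by rewrite ltr_pwDr// normc_ge0.
have d0 : 0 < d by rewrite divr_gt0.
have [v fv] := fP d d0; have [w gw] := gP d d0.
exists (c *: v + w); have := approx_linear c fv gw.
have -> // : normc c * d + d = e by rewrite /d; field; rewrite gt_eqF.
Qed.
HB.instance Definition _ := GRing.isSubmodClosed.Build C (V -> C^o)
  completable completable_submod.

Record completion : Type := Completion {
  comp_fun :> V -> C^o;
  comp_funP : comp_fun \in completable }.
Local Notation H := completion.
HB.instance Definition _ := [isSub for comp_fun].
HB.instance Definition _ := gen_eqMixin H.
HB.instance Definition _ := gen_choiceMixin H.
HB.instance Definition _ := [SubChoice_isSubLmodule of H by <:].

Lemma comp_eq (f g : H) : f =1 g -> f = g.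
Proof. by move=> fg; apply/val_inj/funext. Qed.

Lemma compP c (f g : H) b : (c *: f + g) b = c * (f b : C) + (g b : C) :> C.
Proof. by []. Qed.

Lemma comp_approx (f : H) e : 0 < e -> exists v, approx f e v.
Proof. by have /completableP := comp_funP f; apply. Qed.

Fact embed_subproof v : (fun b => F b v) \in completable.
Proof. by apply/completableP => e /ltW e0; exists v; exact: approx_form. Qed.
Definition embed (v : V) : H := Completion (embed_subproof v).

Lemma embedE v b : embed v b = F b v. Proof. by []. Qed.

Lemma embed_linear : linear embed.
Proof. by move=> c v w; apply: comp_eq => b; rewrite compP !embedE (form_linear FS). Qed.

(** Approximants of f are close to each other, and bounded, by testing the
functional on their difference; so the form is uniformly continuous on
pairs of approximants, and their inner products converge. *)
Lemma form_close (f g : H) : exists2 K : R, 0 <= K & forall d v v' w w',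
  0 <= d -> d <= 1 -> approx f d v -> approx f d v' -> approx g d w -> approx g d w' ->
  normc (F v w - F v' w') <= d * K.
Proof.
have bound (h : H) : exists2 k : R, 0 <= k & forall d v, 0 <= d -> d <= 1 ->
    approx h d v -> nrm v <= k.
  have [v1 hv1] := comp_approx h ltr01.
  exists (2 + nrm v1); first by rewrite addr_ge0// seminorm_ge0.
  move=> d v d0 d1 hv; rewrite -[v](subrK v1) (le_trans (seminormD FS _ _))// lerD2r.
  by rewrite (le_trans (approx_close d0 ler01 hv hv1))//; lra.
have [k k0 kP] := bound f; have [l l0 lP] := bound g.
exists (2 * (k + l)); first by rewrite mulr_ge0// addr_ge0.
move=> d v v' w w' d0 d1 fv fv' gw gw'.
have -> : F v w - F v' w' = F (v - v') w + F v' (w - w').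
  by rewrite (formBl FS) (formBr FS) addrA subrK.
rewrite (le_trans (le_normcD _ _))//.
have h1 : normc (F (v - v') w) <= (d + d) * l.
  rewrite (le_trans (cauchy_schwarz FS _ _))// ler_pM ?seminorm_ge0//.
    exact: approx_close fv fv'.
  exact: lP gw.
have h2 : normc (F v' (w - w')) <= k * (d + d).
  rewrite (le_trans (cauchy_schwarz FS _ _))// ler_pM ?seminorm_ge0//.
    exact: kP fv'.
  exact: approx_close gw gw'.
rewrite (le_trans (lerD h1 h2))// le_eqVlt; apply/orP; left; apply/eqP; ring.
Qed.

Lemma dot_exists (f g : H) : exists z : C, forall e : R, 0 < e -> exists2 d : R, 0 < d &
  forall v w, approx f d v -> approx g d w -> normc (F v w - z) <= e.
Proof.
have [K K0 close] := form_close f g.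
have inv0 k : 0 < (k.+1%:R)^-1 :> R by rewrite invr_gt0 ltr0n.
pose v k := projT1 (cid (comp_approx f (inv0 k))).
pose w k := projT1 (cid (comp_approx g (inv0 k))).
have vP k : approx f (k.+1%:R)^-1 (v k) by rewrite /v; case: cid.
have wP k : approx g (k.+1%:R)^-1 (w k) by rewrite /w; case: cid.
have near_small (e : R) : 0 < e -> \forall k \near \oo, (k.+1%:R)^-1 <= e.
  move=> e0; pose m := Num.truncn e^-1; near=> k.
  rewrite invf_ple ?posrE// ltW// (lt_le_trans (truncnS_gt _))// ler_nat ltnS.
  by near: k; exact: nbhs_infty_ge.
have smallness (e : R) : 0 < e -> exists d : R, [/\ 0 < d, d <= 1 & d * K <= e].
  move=> e0; exists (Num.min 1 (e / (K + 1))).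
  have K1 : 0 < K + 1 by rewrite ltr_pwDr.
  split; first by rewrite lt_min ltr01 divr_gt0.
    by rewrite ge_min lexx.
  rewrite (@le_trans _ _ (e / (K + 1) * (K + 1)))//; last by rewrite mulfVK// gt_eqF.
  by rewrite ler_pM ?lerDl// ?ge_min ?lexx ?orbT// le_min ler01 divr_ge0// ltW.
have [z zP] : exists z : C, (F (v k) (w k) : C^o) @[k --> \oo] --> (z : C^o).
  apply: cauchyC => e e0; have e2 : 0 < e / 2 by rewrite divr_gt0.
  have [d [d0 d1 dK]] := smallness _ e2.
  exists ([set k | (k.+1%:R)^-1 <= d], [set k | (k.+1%:R)^-1 <= d]) => /=.
    by split; exact: near_small.
  move=> [k l] /= [kd ld]; rewrite (@le_lt_trans _ _ (e / 2))//; last first.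
    by rewrite ltr_pdivrMr//; lra.
  rewrite (le_trans _ dK)//.
  by apply: close; rewrite ?(ltW d0)//; apply: approx_le; try exact: vP; try exact: wP.
exists z => e e0; have e2 : 0 < e / 2 by rewrite divr_gt0.
have [d [d0 d1 dK]] := smallness _ e2; exists d => // v' w' fv' gw'.
have h : forall e : R, 0 < e -> \forall k \near \oo, normc (F (v k) (w k) - z) < e.
  by apply/cvgCP.
near \oo => k.
have -> : F v' w' - z = (F v' w' - F (v k) (w k)) + (F (v k) (w k) - z) by ring.
have kd : (k.+1%:R)^-1 <= d by near: k; exact: near_small.
rewrite (le_trans (le_normcD _ _))// [e]splitr lerD//.
  rewrite (le_trans _ dK)//; apply: close; rewrite ?(ltW d0)//.
    exact: approx_le (vP k).
  exact: approx_le (wP k).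
by rewrite ltW//; near: k; exact: h.
Unshelve. all: by end_near. Qed.

Definition comp_dot (f g : H) : C := projT1 (cid (dot_exists f g)).

Lemma comp_dotP (f g : H) (e : R) : 0 < e -> exists2 d : R, 0 < d &
  forall v w, approx f d v -> approx g d w -> normc (F v w - comp_dot f g) <= e.
Proof. by rewrite /comp_dot; case: cid => z /= h /h. Qed.

Lemma normc_small (z : C) : (forall e : R, 0 < e -> normc z <= e) -> z = 0.
Proof.
move=> h; apply: eq0_normc; apply/eqP; rewrite eq_le normc_ge0 andbT.
by apply/ler_addgt0Pl => e e0; rewrite addr0 h.
Qed.

Lemma comp_dot_eq (f g : H) (z : C) :
  (forall e d : R, 0 < e -> 0 < d -> exists v w,
    [/\ approx f d v, approx g d w & normc (F v w - z) <= e]) -> comp_dot f g = z.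
Proof.
move=> h; apply/eqP; rewrite -subr_eq0; apply/eqP/normc_small => e e0.
have e2 : 0 < e / 2 by rewrite divr_gt0.
have [d d0 dP] := comp_dotP f g e2; have [v [w [fv gw vwz]]] := h _ _ e2 d0.
have -> : comp_dot f g - z = (F v w - z) - (F v w - comp_dot f g) by ring.
by rewrite (le_trans (le_normcD _ _))// normcN [e]splitr lerD// dP.
Qed.

(** The reproducing property. It makes evaluation at b bounded, which is what
turns limits in the completion into pointwise limits. *)
Lemma comp_dot_embed v (f : H) : comp_dot (embed v) f = f v.
Proof.
apply: comp_dot_eq => e d e0 d0.
have n1 : 0 < nrm v + 1 by rewrite ltr_pwDr// seminorm_ge0.
pose d' := Num.min d (e / (nrm v + 1)).
have d'0 : 0 < d' by rewrite lt_min d0 divr_gt0.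
have [w fw] := comp_approx f d'0; exists v, w; split.
- exact: approx_form (ltW d0).
- by apply: approx_le fw; rewrite ge_min lexx.
- rewrite normcB (le_trans (fw v))//.
  rewrite (@le_trans _ _ (e / (nrm v + 1) * (nrm v + 1)))//; last by rewrite mulfVK// gt_eqF.
  by rewrite ler_pM ?(ltW d'0) ?seminorm_ge0 ?lerDl// ge_min lexx orbT.
Qed.

Lemma comp_dot_semi : semi_inner comp_dot.
Proof.
split=> [f c g h|f g|f].
- apply: comp_dot_eq => e d e0 d0.
  have c1 : 0 < normc c + 1 by rewrite ltr_pwDr// normc_ge0.
  pose e' := e / (normc c + 1).
  have e'0 : 0 < e' by rewrite divr_gt0.
  have [d1 d10 d1P] := comp_dotP f g e'0; have [d2 d20 d2P] := comp_dotP f h e'0.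
  pose d' := Num.min (d / (normc c + 1)) (Num.min d (Num.min d1 d2)).
  have d'0 : 0 < d' by rewrite !lt_min d0 d10 d20 divr_gt0.
  have [v fv] := comp_approx f d'0; have [w gw] := comp_approx g d'0.
  have [x hx] := comp_approx h d'0.
  have d'd : d' <= d by rewrite !ge_min lexx !orbT.
  have d'd1 : d' <= d1 by rewrite !ge_min lexx !orbT.
  have d'd2 : d' <= d2 by rewrite !ge_min lexx !orbT.
  have d'dc : d' <= d / (normc c + 1) by rewrite ge_min lexx.
  exists v, (c *: w + x); split; first exact: approx_le fv.
    apply: approx_le (approx_linear c gw hx).
    rewrite -[X in _ + X]mul1r -mulrDl mulrC -ler_pdivlMr//.
  rewrite (form_linear FS).
  have -> : c * F v w + F v x - (c * comp_dot f g + comp_dot f h) =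
    c * (F v w - comp_dot f g) + (F v x - comp_dot f h) by ring.
  rewrite (le_trans (le_normcD _ _))// normcM.
  have -> : e = normc c * e' + e' by rewrite /e'; field; rewrite gt_eqF.
  rewrite lerD//; first rewrite ler_wpM2l ?normc_ge0//.
    by apply: d1P; [exact: approx_le fv|exact: approx_le gw].
  by apply: d2P; [exact: approx_le fv|exact: approx_le hx].
- apply: comp_dot_eq => e d e0 d0; have [d1 d10 d1P] := comp_dotP g f e0.
  pose d' := Num.min d d1; have d'0 : 0 < d' by rewrite lt_min d0.
  have [v fv] := comp_approx f d'0; have [w gw] := comp_approx g d'0.
  have d'd : d' <= d by rewrite ge_min lexx.
  have d'd1 : d' <= d1 by rewrite ge_min lexx orbT.
  exists v, w; split; [exact: approx_le fv|exact: approx_le gw|].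
  rewrite (form_herm FS) -rmorphB normc_conj.
  by apply: d1P; [exact: approx_le gw|exact: approx_le fv].
- apply: normc_limit_ge0 => e e0; have [d d0 dP] := comp_dotP f f e0.
  have [v fv] := comp_approx f d0; exists (F v v); first exact: form_ge0.
  exact: dP.
Qed.

Local Notation hnrm := (seminorm comp_dot).

Lemma hnrm_embed v : hnrm (embed v) = nrm v.
Proof. by rewrite /seminorm comp_dot_embed. Qed.

Lemma hnrm_eval (f : H) b : normc (f b) <= nrm b * hnrm f.
Proof. by rewrite -comp_dot_embed -hnrm_embed cauchy_schwarz//; exact: comp_dot_semi. Qed.

Lemma hnrm_eq0 (f : H) : hnrm f = 0 -> f = 0.
Proof.
move=> f0; apply: comp_eq => b; apply: eq0_normc; apply/eqP.
by rewrite eq_le normc_ge0 andbT (le_trans (hnrm_eval _ _))// f0 mulr0.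
Qed.

(** If v approximates f then F v v is close to f v, which is at most e |v|; so
|v| is at most about e, and |f| is the limit of such |v|. *)
Lemma hnrm_le (f : H) (e : R) : 0 <= e -> (forall b, normc (f b) <= e * nrm b) -> hnrm f <= e.
Proof.
move=> e0 fe.
rewrite -(@ler_pXn2r _ 2)// ?nnegrE ?seminorm_ge0// -(normc_form_self comp_dot_semi).
have step (d : R) : 0 < d -> normc (comp_dot f f) <= (e + d) ^+ 2 + d.
  move=> d0; have [d1 d10 d1P] := comp_dotP f f d0.
  pose d' := Num.min d d1; have d'0 : 0 < d' by rewrite lt_min d0.
  have d'd : d' <= d by rewrite ge_min lexx.
  have d'd1 : d' <= d1 by rewrite ge_min lexx orbT.
  have [v fv] := comp_approx f d'0.
  have vd : nrm v <= e + d.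
    have : nrm v ^+ 2 <= (e + d) * nrm v.
      rewrite -(normc_form_self FS).
      have -> : F v v = f v - (f v - F v v) by ring.
      rewrite (le_trans (le_normcD _ _))// normcN mulrDl lerD//.
      exact: (approx_le d'd fv).
    have := seminorm_ge0 F v; rewrite le_eqVlt => /predU1P[<- _|v0].
      by rewrite addr_ge0// ltW.
    by rewrite expr2 ler_pM2r.
  have -> : comp_dot f f = F v v - (F v v - comp_dot f f) by ring.
  rewrite (le_trans (le_normcD _ _))// normcN lerD//.
    by rewrite (normc_form_self FS) lerXn2r ?nnegrE ?seminorm_ge0// addr_ge0// ltW.
  by apply: d1P; exact: approx_le fv.
apply/ler_addgt0Pl => d d0.
pose x := Num.min 1 (d / (2 * e + 2)).
have e2 : 0 < 2 * e + 2 by rewrite ltr_wpDl// mulr_ge0.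
have x0 : 0 < x by rewrite lt_min ltr01 divr_gt0.
have x1 : x <= 1 by rewrite ge_min lexx.
have xd : x * (2 * e + 2) <= d by rewrite -ler_pdivlMr// ge_min lexx orbT.
rewrite (le_trans (step x x0))// sqrrD.
have : x ^+ 2 <= x by rewrite expr2 ler_piMr// ltW.
by rewrite -mulr_natl; lra.
Qed.

Lemma embed_near (f : H) (e : R) v : 0 <= e -> approx f e v -> hnrm (f - embed v) <= e.
Proof. by move=> e0 fv; apply: hnrm_le. Qed.

Definition comp_norm (f : H) : C := (hnrm f)%:C%C.

Fact comp_normD (f g : H) : comp_norm (f + g) <= comp_norm f + comp_norm g.
Proof. by rewrite /comp_norm -rmorphD lecR; exact: seminormD comp_dot_semi _ _. Qed.
Fact comp_normZ (c : C) (f : H) : comp_norm (c *: f) = `|c| * comp_norm f.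
Proof. by rewrite /comp_norm (seminormZ comp_dot_semi) rmorphM normE. Qed.
Fact comp_norm_eq0 (f : H) : comp_norm f = 0 -> f = 0.
Proof. by move=> h; apply: hnrm_eq0; exact: complexI. Qed.

HB.instance Definition _ := Lmodule_isNormed.Build C H
  comp_normD comp_normZ comp_norm_eq0.

Lemma comp_normE (f : H) : `|f| = (hnrm f)%:C%C. Proof. by []. Qed.

(** A Cauchy filter converges pointwise; the convergence is uniform on bounded
sets, so the limit is still approximated by vectors of V. *)
Fact comp_complete (G : set_system H) : ProperFilter G -> cauchy G -> cvg G.
Proof.
move=> GG /cauchy_ballP Gc.
have GcR (e : R) : 0 < e -> \forall f & g \near G, hnrm (f - g) < e.
  move=> e0; have : 0 < e%:C%C by rewrite ltcR.
  move=> /Gc[[P Q] /= GPQ PQ]; exists (P, Q) => // -[f g] /PQ /=.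
  by rewrite -ball_normE /= comp_normE ltcR.
have evalC b : exists l : C, (comp_fun f b : C^o) @[f --> G] --> (l : C^o).
  apply: cauchyC => e e0; have n1 : 0 < nrm b + 1 by rewrite ltr_pwDr// seminorm_ge0.
  have [[P Q] /= GPQ PQ] := GcR _ (divr_gt0 e0 n1); exists (P, Q) => // -[f g] /PQ /= fg.
  have -> : (comp_fun f b : C) - g b = (f - g) b by [].
  rewrite (le_lt_trans (hnrm_eval _ _))//.
  rewrite (@le_lt_trans _ _ ((nrm b + 1) * hnrm (f - g)))//; last first.
    by rewrite mulrC -ltr_pdivlMr.
  by rewrite ler_wpM2r ?seminorm_ge0 ?lerDl.
pose h0 b : C^o := projT1 (cid (evalC b)).
have h0P b : forall e : R, 0 < e -> \forall f \near G, normc ((comp_fun f b : C) - h0 b) < e.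
  by rewrite /h0; case: cid => l /= hl; apply/cvgCP.
have close (e : R) : 0 < e -> \forall f \near G, forall b, normc ((comp_fun f b : C) - h0 b) <= e * nrm b.
  move=> e0; have := GcR e e0.
  move=> [[P Q] /= [GP GQ] PQ]; apply: filterS GP => f Pf b.
  apply/ler_addgt0Pl => d d0; near G => g.
  have -> : (comp_fun f b : C) - h0 b = (f - g) b + ((g b : C) - h0 b).
    by rewrite -[(f - g) b]/((comp_fun f b : C) - g b); ring.
  rewrite (le_trans (le_normcD _ _))// addrC lerD//.
    by rewrite ltW//; near: g; exact: h0P.
  rewrite (le_trans (hnrm_eval _ _))// mulrC ler_wpM2r ?seminorm_ge0// ltW//.
  by apply: (PQ (f, g)); split=> //=; near: g.
have h0c : h0 \in completable.
  apply/completableP => e e0; have e2 : 0 < e / 2 by rewrite divr_gt0.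
  near G => f; have [v fv] := comp_approx f e2; exists v => b.
  have -> : (h0 b : C) - F b v = ((comp_fun f b : C) - F b v) - ((comp_fun f b : C) - h0 b) by ring.
  rewrite (le_trans (le_normcD _ _))// normcN [e in leRHS]splitr mulrDl lerD//.
  by move: b; near: f; exact: close.
apply/cvg_ex; exists (Completion h0c); apply/cvgrPdist_le => e e0.
have er : e = (complex.Re e)%:C%C by rewrite RRe_real// gtr0_real.
move: e0; rewrite er ltcR => e0; near=> f.
rewrite distrC comp_normE lecR; apply: hnrm_le; first exact: ltW.
by near: f; exact: close.
Unshelve. all: by end_near. Qed.

HB.instance Definition _ := Uniform_isComplete.Build H comp_complete.

(** the dot product of a Hilbert space is linear in its first argument *)
Definition comp_hdot (f g : H) : C := comp_dot g f.

Fact comp_hdot_bilinear : bilinear_for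
  (GRing.Scale.Law.clone _ _ *%R _) (GRing.Scale.Law.clone _ _ (Num.conj \; *%R) _)
  comp_hdot.
Proof.
split=> u c x y; rewrite /comp_hdot; first exact: (form_linear comp_dot_semi).
by rewrite (formDl comp_dot_semi) (formZl comp_dot_semi).
Qed.
HB.instance Definition _ :=
  bilinear_isBilinear.Build C H H C _ _ comp_hdot comp_hdot_bilinear.

Fact comp_hdot_herm (f g : H) : comp_hdot f g = (-1) ^+ false * (comp_hdot g f)^*.
Proof. by rewrite expr0 mul1r; exact: (form_herm comp_dot_semi). Qed.
HB.instance Definition _ :=
  isHermitianSesquilinear.Build C H false Num.conj comp_hdot comp_hdot_herm.

Fact comp_hdot_gt0 (f : H) : f != 0 -> 0 < comp_hdot f f.
Proof.
move=> f0; rewrite /comp_hdot lt_neqAle (form_ge0 comp_dot_semi) andbT eq_sym.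
apply: contra_neq f0 => ff0; apply: hnrm_eq0.
by rewrite /seminorm ff0 sqrtr0.
Qed.
HB.instance Definition _ := isDotProduct.Build C H comp_hdot comp_hdot_gt0.

Fact comp_hdot_norm (f : H) : `|f| ^+ 2 = comp_hdot f f.
Proof. by rewrite comp_normE -rmorphXn; exact: (seminorm_sqr comp_dot_semi). Qed.

HB.instance Definition _ := isHilbert.Build C H comp_hdot_norm.

End Completion.

(** * The GNS construction for a generating functional *)

Section BoundedContinuous.
Variables (R : realType) (H : hilbertType R[i]).

Lemma bounded_linear_continuous (T : H -> H) (K : R) : linear T -> 0 <= K ->
  (forall x, `|T x| <= K%:C%C * `|x|) -> continuous T.
Proof.
move=> lT K0 TK x; apply/cvgrPdist_le => e e0.
have K1 : 0 < (K + 1)%:C%C :> R[i] by rewrite ltcR ltr_pwDr.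
near=> y.
have -> : T x - T y = T (x - y).
  have -> : x - y = (-1) *: y + x by rewrite scaleN1r addrC.
  by rewrite lT scaleN1r addrC.
have xy : `|x - y| < e / (K + 1)%:C%C.
  by near: y; apply: cvgr_dist_lt; rewrite // divr_gt0.
rewrite (le_trans (TK _))// (@le_trans _ _ ((K + 1)%:C%C * `|x - y|))//.
  by rewrite ler_wpM2r// lecR lerDl.
by rewrite mulrC -ler_pdivlMr// ltW.
Unshelve. all: by end_near. Qed.

End BoundedContinuous.

Section GNS.
Variables (R : realType) (n : nat).
Local Notation C := R[i].
Local Notation Pol := (Pol C n).
Local Notation eps := (counit C n).
Local Notation p := (@pgen C n).
Variable L : {linear Pol -> C^o}.
Hypothesis L1 : (L 1 : C) = 0.
Hypothesis Lherm : forall a, (L (star a) : C) = (L a : C)^*.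
Hypothesis Lpos : forall a, (eps a : C) = 0 -> 0 <= (L (star a * a) : C).

Let LD a b : (L (a + b) : C) = (L a : C) + L b. Proof. by rewrite linearD. Qed.
Let LB a b : (L (a - b) : C) = (L a : C) - L b. Proof. by rewrite linearB. Qed.
Let LZ c a : (L (c *: a) : C) = c * (L a : C). Proof. by rewrite linearZ. Qed.

Definition aug (a : Pol) : Pol := a - (eps a : C)%:A.

Lemma eps_aug a : (eps (aug a) : C) = 0.
Proof. by rewrite /aug epsB epsZ eps1 mulr1 subrr. Qed.

Lemma aug_id a : (eps a : C) = 0 -> aug a = a.
Proof. by rewrite /aug => ->; rewrite scale0r subr0. Qed.

Lemma eps_mul_aug a b : (eps (a * aug b) : C) = 0.
Proof. by rewrite epsM eps_aug mulr0. Qed.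

Lemma aug_mul a b : aug (a * aug b) = a * aug b.
Proof. by rewrite aug_id// eps_mul_aug. Qed.

Lemma aug_linear c a b : aug (c *: a + b) = c *: aug a + aug b.
Proof. by rewrite /aug epsD epsZ scalerDl -scalerA opprD addrACA -scalerBr. Qed.

Definition gns_form (a b : Pol) : C := L (star (aug a) * aug b).

Lemma gns_form_semi : semi_inner gns_form.
Proof.
split=> [a c b d|a b|a]; rewrite /gns_form.
- by rewrite aug_linear mulrDr -scalerAr LD LZ.
- by rewrite -Lherm starM starK.
- by apply: Lpos; exact: eps_aug.
Qed.

Lemma gns_form_aug a b c : gns_form (star c * aug a) b = gns_form a (c * aug b).
Proof. by rewrite /gns_form !aug_mul starM starK mulrA. Qed.

Local Notation nrm := (seminorm gns_form).
Local Notation H := (completion gns_form_semi).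

(** Positivity of L on the kernel of eps does not bound left multiplication by
itself; here the algebra is generated by projections, and a projection p
satisfies |p z| <= |z| because 1 - p is one as well. *)
Lemma gns_bounded a : exists2 K : R, 0 <= K & forall b, nrm (a * aug b) <= K * nrm b.
Proof.
have FS := gns_form_semi.
elim/pol_ind: a => [i j||a b [K K0 Ka] [M M0 Mb]|a b [K K0 Ka] [M M0 Mb]|c a [K K0 Ka]].
- exists 1 => // b; rewrite mul1r.
  rewrite -(@ler_pXn2r _ 2)// ?nnegrE ?seminorm_ge0// -lecR !(seminorm_sqr FS).
  rewrite /gns_form aug_mul starM star_pgen -mulrA [p i j * (_ * _)]mulrA pgen_idem.
  set z := aug b; set q : Pol := 1 - p i j.
  have qE : star q = q by rewrite /q starD star1 -scaleN1r starZ rmorphN1 star_pgen.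
  have qq : q * q = q by rewrite /q mulrBl mul1r mulrBr mulr1 pgen_idem subrr subr0.
  have : 0 <= (L (star (q * z) * (q * z)) : C) by apply: Lpos; rewrite epsM eps_aug mulr0.
  rewrite starM qE -mulrA [q * (_ * _)]mulrA qq /q mulrBl mul1r mulrBr LB.
  by rewrite subr_ge0.
- by exists 1 => // b; rewrite mul1r mul1r {1}/seminorm /gns_form aug_id// eps_aug.
- exists (K + M); first exact: addr_ge0.
  by move=> c; rewrite mulrDl (le_trans (seminormD FS _ _))// mulrDl lerD.
- exists (K * M); first exact: mulr_ge0.
  move=> c; rewrite -mulrA -[b * aug c]aug_mul (le_trans (Ka _))// -mulrA.
  by rewrite ler_wpM2l.
- exists (normc c * K); first by rewrite mulr_ge0// normc_ge0.
  by move=> b; rewrite -scalerAl (seminormZ FS) -mulrA ler_wpM2l ?normc_ge0.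
Qed.

Lemma comp_antilinear (f : H) c a b : (f (c *: a + b) : C) = c^* * (f a : C) + f b.
Proof.
rewrite -!(comp_dot_embed _ f) embed_linear.
by rewrite (formDl (comp_dot_semi _)) (formZl (comp_dot_semi _)).
Qed.

Lemma comp_aug (f : H) a : f (aug a) = f a.
Proof.
rewrite -!(comp_dot_embed _ f); congr (comp_dot _ _); apply: comp_eq => b.
by rewrite !embedE /gns_form [aug (aug a)]aug_id// eps_aug.
Qed.

(** Read f as the functional b |-> <b, f>: then <b, rho a f> has to be
<rho (star a) b, f>, and rho (star a) acts on the class of b as left
multiplication on its component in the kernel of eps. *)
Definition gns_raw (a : Pol) (f : H) : Pol -> C^o := fun b => f (star a * aug b).

Fact gns_subproof a (f : H) : gns_raw a f \in completable_of gns_form_semi.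
Proof.
have [K K0 Ka] := gns_bounded (star a).
apply/completableP => e e0; have K1 : 0 < K + 1 by rewrite ltr_pwDr.
have [v fv] := comp_approx f (divr_gt0 e0 K1); exists (a * aug v) => b.
rewrite -gns_form_aug (le_trans (fv _))//.
rewrite (@le_trans _ _ (e / (K + 1) * (K * nrm b)))//.
  by rewrite ler_wpM2l// divr_ge0// ltW.
rewrite mulrA ler_wpM2r ?seminorm_ge0// mulrAC ler_pdivrMr//.
by rewrite ler_wpM2l ?(ltW e0)// lerDl.
Qed.

Definition gns_rho (a : Pol) (f : H) : H := Completion (gns_subproof a f).
Definition gns_eta (a : Pol) : H := embed gns_form_semi a.

Lemma gns_rhoE a f b : gns_rho a f b = f (star a * aug b). Proof. by []. Qed.

Lemma gns_rho_eta a b : gns_rho a (gns_eta b) = gns_eta (a * aug b).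
Proof. by apply: comp_eq => c; rewrite gns_rhoE !embedE gns_form_aug. Qed.

Lemma gns_rho_bounded a : exists2 K : R, 0 <= K & forall f : H,
  seminorm (@comp_dot _ _ _ gns_form_semi) (gns_rho a f) <=
  K * seminorm (@comp_dot _ _ _ gns_form_semi) f.
Proof.
have [K K0 Ka] := gns_bounded (star a); exists K => // f.
apply: hnrm_le => [|b]; first by rewrite mulr_ge0// seminorm_ge0.
rewrite gns_rhoE (le_trans (hnrm_eval _ _))// mulrC mulrAC [X in _ <= X]mulrAC [K * _]mulrC.
by rewrite -mulrA ler_wpM2l ?seminorm_ge0.
Qed.

Local Notation hnrm := (seminorm (@comp_dot _ _ _ gns_form_semi)).

Lemma gns_rho_linear a : linear (gns_rho a).
Proof. by move=> c f g; apply: comp_eq. Qed.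

Lemma gns_rho_linearl c a b f : gns_rho (c *: a + b) f = c *: gns_rho a f + gns_rho b f.
Proof.
apply: comp_eq => x; rewrite compP !gns_rhoE starD starZ mulrDl -scalerAl.
by rewrite comp_antilinear conjCK.
Qed.

Lemma gns_rho_continuous a : continuous (gns_rho a).
Proof.
have [K K0 Ka] := gns_rho_bounded a.
apply: (bounded_linear_continuous (gns_rho_linear a) K0) => f.
by rewrite !comp_normE -rmorphM lecR; exact: Ka.
Qed.

Lemma comp_dot_rho_eta a v (g : H) :
  comp_dot (gns_rho (star a) (gns_eta v)) g = comp_dot (gns_eta v) (gns_rho a g).
Proof. by rewrite gns_rho_eta !comp_dot_embed gns_rhoE. Qed.

(** By density and boundedness it is enough to take f in the image of eta, where
comp_dot_embed computes both sides. *)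
Lemma comp_dot_rho a (f g : H) :
  comp_dot (gns_rho (star a) f) g = comp_dot f (gns_rho a g).
Proof.
have HS := comp_dot_semi gns_form_semi.
apply/eqP; rewrite -subr_eq0; apply/eqP/normc_small => e e0.
have [K K0 Ka] := gns_rho_bounded (star a).
pose M := K * hnrm g + hnrm (gns_rho a g) + 1.
have M0 : 0 < M by rewrite ltr_pwDr// addr_ge0 ?mulr_ge0 ?seminorm_ge0.
have d0 : 0 < e / M by rewrite divr_gt0.
have [v fv] := comp_approx f d0.
have fvd := embed_near (ltW d0) fv; set h := f - _ in fvd.
have fE : f = h + gns_eta v by rewrite /h subrK.
have -> : comp_dot (gns_rho (star a) f) g - comp_dot f (gns_rho a g) =
  comp_dot (gns_rho (star a) h) g - comp_dot h (gns_rho a g).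
  rewrite fE -[h in gns_rho _ (h + _)]scale1r gns_rho_linear scale1r.
  rewrite !(formDl HS) comp_dot_rho_eta; ring.
rewrite (le_trans (le_normcD _ _))// normcN.
rewrite (le_trans (lerD (cauchy_schwarz HS _ _) (cauchy_schwarz HS _ _)))//.
have h1 : hnrm (gns_rho (star a) h) * hnrm g <= e / M * (K * hnrm g).
  rewrite mulrA ler_wpM2r ?seminorm_ge0// (le_trans (Ka _))// mulrC.
  by rewrite ler_wpM2r.
have h2 : hnrm h * hnrm (gns_rho a g) <= e / M * hnrm (gns_rho a g).
  by rewrite ler_wpM2r ?seminorm_ge0.
rewrite (le_trans (lerD h1 h2))// -mulrDr mulrAC ler_pdivrMr// ler_wpM2l ?(ltW e0)//.
by rewrite /M lerDl.
Qed.

Lemma gns_representation : representation gns_rho.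
Proof.
split.
- exact: gns_rho_linear.
- exact: gns_rho_continuous.
- exact: gns_rho_linearl.
- by move=> f; apply: comp_eq => b; rewrite gns_rhoE star1 mul1r comp_aug.
- move=> a b f; apply: comp_eq => c.
  by rewrite !gns_rhoE aug_mul starM mulrA.
- by move=> a f g; rewrite /inner /hdot /= /comp_hdot comp_dot_rho.
Qed.

Lemma gns_cocycle : cocycle gns_rho gns_eta.
Proof.
split=> [|a b]; first exact: embed_linear.
rewrite gns_rho_eta addrC -embed_linear; congr (embed _ _).
by rewrite /aug mulrBr -scalerAr mulr1 addrC subrK.
Qed.

Lemma gns_triple : schurmann_triple gns_rho gns_eta L.
Proof.
split; [exact: gns_representation|exact: gns_cocycle|exact: Lherm|].
move=> a b.
have -> : inner (gns_eta a) (gns_eta b) = gns_form a b.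
  by rewrite /inner /hdot /= /comp_hdot comp_dot_embed.
have scalar_star (c : C) : star (c%:A : Pol) = (c^*)%:A by rewrite starZ star1.
rewrite /gns_form /aug starD -scaleN1r starZ rmorphN1 scaleN1r scalar_star.
rewrite mulrBl !mulrBr -!scalerAl -!scalerAr !mul1r mulr1 !LB !LZ L1 eps_star.
by ring.
Qed.

Lemma gns_dense : dense (range gns_eta).
Proof.
move=> O [f Of] oO; move: (oO) => /(_ f Of) /nbhs_ballP[e e0 fe].
have {}e0 : 0 < e by [].
have er : e = (complex.Re e)%:C%C by rewrite RRe_real// gtr0_real.
move: e0 fe; rewrite er ltcR; move: (complex.Re e) => {er} r r0 fr.
have r2 : 0 < r / 2 by rewrite divr_gt0.
have [v fv] := comp_approx f r2.
exists (gns_eta v); split; last by exists v.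
apply: fr; rewrite -ball_normE /= comp_normE ltcR.
rewrite (le_lt_trans (embed_near (ltW r2) fv))//.
by rewrite ltr_pdivrMr//; lra.
Qed.

End GNS.

Section LevyTriple.
Variables (R : realType) (n : nat).
Local Notation C := R[i].
Local Notation Pol := (Pol C n).
Local Notation eps := (counit C n).

(** The space is the completion of the kernel of eps for the form
L (star a * b), and eta is the projection onto that kernel. *)
Lemma cond_positive_triple (L : {linear Pol -> C^o}) :
  (L 1 : C) = 0 -> (forall a, (L (star a) : C) = (L a : C)^*) ->
  (forall a, (eps a : C) = 0 -> 0 <= (L (star a * a) : C)) ->
  exists (H : hilbertType C) (rho : Pol -> H -> H) (eta : Pol -> H),
    schurmann_triple rho eta L /\ dense (range eta).
Proof.
move=> L1 Lh Lp.
exists (completion (gns_form_semi Lh Lp) : hilbertType C), (@gns_rho _ _ _ Lh Lp),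
  (@gns_eta _ _ _ Lh Lp); split; first exact: gns_triple.
exact: gns_dense.
Qed.

Variable X : levy_process R n.

Lemma levy_conv_semigroup : conv_semigroup (fun t => omega X 0 t).
Proof.
split=> [a|s t s0 t0 a]; first exact: levy_tt.
have st : s <= s + t by rewrite lerDl.
rewrite (levy_conv X (lexx 0) s0 st); apply: convolution_ext => // b.
rewrite (levy_stationary X s0 st); congr (omega X 0 _ b).
by rewrite addrC addKr.
Qed.

Lemma levy_omega_state t : state (omega X 0 t).
Proof.
have [Phi1 Phi_ge0] := levy_stateP X; split=> [|a].
  rewrite /omega /=.
  by have -> : levy_hom X 0 t 1 = 1 by rewrite rmorph1.
rewrite /omega /=.
have -> : levy_hom X 0 t (star a * a) = star (levy_hom X 0 t a) * levy_hom X 0 t a.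
  transitivity (levy_hom X 0 t (star a) * levy_hom X 0 t a); first exact: rmorphM.
  by congr (_ * _); exact: star_morph.
exact: Phi_ge0.
Qed.

(** The difference quotients of states at 0 pass three properties to their
limit: they vanish at 1, are hermitian, and are nonnegative at star a * a if
eps a = 0, where the term eps (star a * a) drops out. *)
Lemma levy_triple :
  exists (H : hilbertType C) (rho : Pol -> H -> H)
     (eta : Pol -> H) (L : {linear Pol -> C^o}),
     schurmann_triple_of X rho eta L.
Proof.
have [L gL] := conv_semigroup_generator levy_conv_semigroup (levy_continuous X).
have stX t := levy_omega_state t.
have L1 : (L 1 : C) = 0.
  have h := gL 1.
  have zero : (fun t => (omega X 0 t 1 - eps 1) / (t%:C)%C : C^o) = fun=> 0.
    apply/funext => t; have [-> _] := stX t.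
    by have -> : (eps 1 : C) = 1 by [exact: eps1]; rewrite subrr mul0r.
  rewrite zero in h; exact: (cvgC_unique _ h (cvg_cst _)).
have Lh a : (L (star a) : C) = (L a : C)^*.
  have h : ((omega X 0 t (star a) - eps (star a)) / (t%:C)%C : C^o) @[t --> 0^'+] -->
      ((L a : C)^* : C^o).
    apply/cvgCP => e e0.
    have h : forall e : R, 0 < e ->
        \forall t \near 0^'+, normc ((omega X 0 t a - eps a) / (t%:C)%C - L a : C) < e.
      by apply/cvgCP; exact: gL.
    apply: filterS (h e e0) => t.
    have tJ : (t%:C%C : C)^* = t%:C%C by rewrite conj_Creal// complex_real eqxx.
    have -> : (omega X 0 t (star a) - eps (star a)) / (t%:C)%C - (L a : C)^* =
      ((omega X 0 t a - eps a) / (t%:C)%C - L a : C)^*.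
      rewrite (positive_herm (proj2 (stX t))) eps_star rmorphB rmorphM fmorphV rmorphB.
      by congr (_ * _^-1 - _).
    by rewrite normc_conj.
  exact: (cvgC_unique _ (gL (star a)) h).
have Lp a : (eps a : C) = 0 -> 0 <= (L (star a * a) : C).
  move=> a0; apply: (cvgC_ge0 _ (gL (star a * a))).
  near=> t; have t0 : 0 < t by near: t; exact: nbhs_right_gt.
  have -> : (eps (star a * a) : C) = 0 by rewrite epsM a0 mulr0.
  rewrite subr0 mulr_ge0 ?invr_ge0 ?ler0c ?(ltW t0)//.
  by have [_] := stX t; apply.
have [H [rho [eta [t d]]]] := cond_positive_triple L1 Lh Lp.
by exists H, rho, eta, L; split.
Unshelve. all: by end_near. Qed.

End LevyTriple.

(** * Unitary equivalence of Schurmann triples *)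

Section IsometryExtension.
Variables (R : realType) (A : Type) (H K : hilbertType R[i]).
Local Notation C := R[i].
Variables (f : A -> H) (g : A -> K).
Hypothesis fg : forall a b, `|f a - f b| = `|g a - g b|.
Hypothesis fdense : dense (range f).

Lemma dense_approx (x : H) (e : R) : 0 < e -> exists a, `|x - f a| < e%:C%C.
Proof.
move=> e0; have e0C : 0 < e%:C%C :> C by rewrite ltcR.
have [|z [/= xz [a _ az]]] := fdense (O := ball x e%:C%C) _ (ball_open x _).
  by exists x; exact: ballxx.
by exists a; move: xz; rewrite -az -ball_normE.
Qed.

(** The closure of the graph of f a |-> g a, hence the graph of its continuous
extension; the relation is symmetric in f and g, which gives surjectivity of
the extension. *)
Definition matched (x : H) (y : K) : Prop :=
  forall e : R, 0 < e -> exists a, `|x - f a| < e%:C%C /\ `|y - g a| < e%:C%C.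

Lemma distC_split (M : hilbertType C) (z x y : M) (e : R) :
  `|x - z| < (e / 2)%:C%C -> `|z - y| < (e / 2)%:C%C -> `|x - y| < e%:C%C.
Proof.
move=> xz zy; rewrite [e]splitr rmorphD.
by rewrite (le_lt_trans (ler_distD z _ _))// ltrD.
Qed.

Lemma matched_exists (x : H) : exists y, matched x y.
Proof.
pose B (e : R) : set A := [set a | `|x - f a| < e%:C%C].
pose G := filter_from [set e : R | 0 < e] B.
have GF : Filter G.
  apply: filter_from_filter; first by exists 1 => /=.
  move=> d e d0 e0; exists (Num.min d e); first by rewrite /= lt_min d0.
  have h1 : (Num.min d e)%:C%C <= d%:C%C :> C by rewrite lecR ge_min lexx.
  have h2 : (Num.min d e)%:C%C <= e%:C%C :> C by rewrite lecR ge_min lexx orbT.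
  by move=> a; rewrite /B /= => ha; split; [exact: lt_le_trans h1|exact: lt_le_trans h2].
have GP : ProperFilter G.
  apply: filter_from_proper => // e e0; have [a ha] := dense_approx x e0; by exists a.
have : cvg (g @ G).
  apply: cauchy_cvg; apply: cauchy_exP => e e0.
  have er : e = (complex.Re e)%:C%C by rewrite RRe_real// gtr0_real.
  move: e0; rewrite er ltcR; move: (complex.Re e) => {er} r r0.
  have r2 : 0 < r / 2 by rewrite divr_gt0.
  have [a ha] := dense_approx x r2; exists (g a); exists (r / 2) => //= b hb.
  rewrite -ball_normE /= -fg; apply: distC_split hb.
  by rewrite distrC.
move=> /cvg_ex[y /cvgrPdist_lt gy]; exists y => e e0.
have e0C : 0 < e%:C%C :> C by rewrite ltcR.
have [d /= d0 dP] := gy _ e0C.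
have m0 : 0 < Num.min d e by rewrite lt_min d0.
have [a ha] := dense_approx x m0; exists a; split.
  by rewrite (lt_le_trans ha)// lecR ge_min lexx orbT.
by apply: dP; rewrite /B /= (lt_le_trans ha)// lecR ge_min lexx.
Qed.

Lemma dist_small_eq (M : hilbertType C) (x y : M) :
  (forall e : R, 0 < e -> `|x - y| < e%:C%C) -> x = y.
Proof.
move=> h; apply/eqP; rewrite -subr_eq0 -normr_eq0.
have /complex_realP[r rE] : `|x - y| \is Num.real by rewrite normr_real.
have r0 : 0 <= r by rewrite -ler0c -rE.
rewrite rE; suff -> : r = 0 by [].
apply/eqP; rewrite eq_le r0 andbT; apply/ler_addgt0Pl => e e0.
by rewrite addr0 ltW// -ltcR -rE h.
Qed.

Lemma matched_unique x y y' : matched x y -> matched x y' -> y = y'.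
Proof.
move=> xy xy'; apply: dist_small_eq => e e0.
have e8 : 0 < e / 2 / 2 / 2 by rewrite !divr_gt0.
have le84 : (e / 2 / 2 / 2)%:C%C <= (e / 2 / 2)%:C%C :> C by rewrite lecR; lra.
have le82 : (e / 2 / 2 / 2)%:C%C <= (e / 2)%:C%C :> C by rewrite lecR; lra.
have [a [xa ya]] := xy _ e8; have [b [xb yb]] := xy' _ e8.
apply: (@distC_split _ (g a)); first exact: lt_le_trans le82.
apply: (@distC_split _ (g b)); last by rewrite distrC; exact: lt_le_trans le84.
by rewrite -fg; apply: distC_split xb; rewrite distrC.
Qed.

Lemma matched_base a : matched (f a) (g a).
Proof. by move=> e e0; exists a; rewrite !subrr !normr0 ltcR. Qed.

Lemma matched_continuous (S : H -> H) (T : K -> K) (u : A -> A) x y :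
  continuous S -> continuous T -> (forall a, S (f a) = f (u a)) ->
  (forall a, T (g a) = g (u a)) -> matched x y -> matched (S x) (T y).
Proof.
move=> cS cT Sf Tg xy e e0; have e0C : 0 < e%:C%C :> C by rewrite ltcR.
have nbhsR (M : hilbertType C) (P : M -> Prop) (z : M) : (\forall w \near z, P w) ->
    exists2 d : R, 0 < d & forall w, `|z - w| < d%:C%C -> P w.
  move=> /nbhs_ballP[d /= d0 dP].
  have dr : d = (complex.Re d)%:C%C by rewrite RRe_real// gtr0_real.
  exists (complex.Re d) => [|w zw]; first by rewrite -ltcR -dr.
  by apply: dP; rewrite -ball_normE /= dr.
have /cvgrPdist_lt/(_ _ e0C)/nbhsR[d1 d10 h1] := cS x.
have /cvgrPdist_lt/(_ _ e0C)/nbhsR[d2 d20 h2] := cT y.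
have d0 : 0 < Num.min d1 d2 by rewrite lt_min d10.
have [a [xa ya]] := xy _ d0; exists (u a); split.
  by rewrite -Sf; apply: h1; rewrite (lt_le_trans xa)// lecR ge_min lexx.
by rewrite -Tg; apply: h2; rewrite (lt_le_trans ya)// lecR ge_min lexx orbT.
Qed.

End IsometryExtension.

Lemma matched_sym (R : realType) (A : Type) (H K : hilbertType R[i])
    (f : A -> H) (g : A -> K) x y : matched f g x y -> matched g f y x.
Proof. by move=> xy e /xy[a [xa ya]]; exists a. Qed.

Section Polarization.
Variables (C : numClosedFieldType) (H K : hilbertType C).

(** Polarization with x + y and x + i y. *)
Lemma isometry_inner (V : H -> K) : linear V -> (forall x, `|V x| = `|x|) ->
  forall x y, inner (V x) (V y) = inner x y.
Proof.
move=> lV nV.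
have VD x y : V (x + y) = V x + V y by have := lV 1 x y; rewrite !scale1r.
have V0 : V 0 = 0 by have := lV (-1) 0 0; rewrite scaler0 addr0 scaleN1r addNr.
have VZ c x : V (c *: x) = c *: V x by have := lV c x 0; rewrite V0 !addr0.
have self x : inner (V x) (V x) = inner x x by rewrite !inner_norm nV.
have cross x y : inner (V x) (V y) + inner (V y) (V x) = inner x y + inner y x.
  have := self (x + y); rewrite VD !innerDl !innerDr !self.
  by rewrite !addrA -!addrA => /addrI; rewrite !addrA => /addIr.
move=> x y; have h1 := cross x y; have := cross x ('i *: y).
rewrite VZ !innerZr !innerZl conjCi !mulNr -!mulrBr.
move=> /(mulfI (neq0Ci C)) h2.
have two : (2 : C) != 0 by rewrite pnatr_eq0.
apply: (mulfI two).
have -> : 2 * inner (V x) (V y) = (inner (V x) (V y) + inner (V y) (V x)) +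
   (inner (V x) (V y) - inner (V y) (V x)) by ring.
by rewrite h1 h2; ring.
Qed.

End Polarization.

Section IsometryUnitary.
Variables (R : realType) (A : lmodType R[i]) (H K : hilbertType R[i]).
Local Notation C := R[i].
Variables (f : A -> H) (g : A -> K).
Hypotheses (lf : linear f) (lg : linear g).
Hypothesis fg : forall a b, inner (f a) (f b) = inner (g a) (g b).
Hypotheses (fdense : dense (range f)) (gdense : dense (range g)).

Let fgN a : `|f a| = `|g a|.
Proof.
by apply/eqP; rewrite -(@eqrXn2 _ 2)// -!inner_norm fg.
Qed.

Let fg_dist a b : `|f a - f b| = `|g a - g b|.
Proof.
have -> : f a - f b = f (-1 *: b + a) by rewrite lf scaleN1r addrC.
have -> : g a - g b = g (-1 *: b + a) by rewrite lg scaleN1r addrC.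
exact: fgN.
Qed.

Lemma unitary_extension : exists V : H -> K, [/\ unitary V,
  forall x, matched f g x (V x) & forall x y, matched f g x y -> V x = y].
Proof.
pose V x := projT1 (cid (matched_exists fg_dist fdense x)).
have VP x : matched f g x (V x) by rewrite /V; case: cid.
have VU x y : matched f g x y -> V x = y.
  by move=> xy; exact: (matched_unique fg_dist (VP x) xy).
exists V; split=> //.
have lV : linear V.
  move=> c x y; apply: VU => e e0.
  pose m := complex.Re `|c| + 1; have nc : `|c| = (complex.Re `|c|)%:C%C by rewrite RRe_real// normr_real.
  have c0 : 0 <= complex.Re `|c| by rewrite -ler0c -nc.
  have m0 : 0 < m by rewrite ltr_pwDr.
  have d0 : 0 < e / m by rewrite divr_gt0.
  have [a [xa Va]] := VP x _ d0; have [b [yb Vb]] := VP y _ d0.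
  have bound (M : hilbertType C) (u v w z : M) : `|u - v| < (e / m)%:C%C ->
      `|w - z| < (e / m)%:C%C -> `|c *: u + w - (c *: v + z)| < e%:C%C.
    move=> uv wz; have -> : c *: u + w - (c *: v + z) = c *: (u - v) + (w - z).
      by rewrite opprD addrACA scalerBr.
    rewrite (le_lt_trans (ler_normD _ _))// normrZ.
    have -> : e = complex.Re `|c| * (e / m) + e / m.
      by rewrite /m; field; rewrite gt_eqF.
    rewrite rmorphD rmorphM /= -nc ler_ltD//.
    by rewrite ler_wpM2l// ltW.
  by exists (c *: a + b); rewrite lf lg; split; exact: bound.
have nV x : `|V x| = `|x|.
  have nr (M : hilbertType C) (u : M) : `|u| = (complex.Re `|u|)%:C%C.
    by rewrite RRe_real// normr_real.
  have near (M : hilbertType C) (u v : M) (e : R) : `|u - v| < e%:C%C ->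
      `|complex.Re `|u| - complex.Re `|v| | <= e.
    move=> uv; rewrite -lecR.
    have -> : `|complex.Re `|u| - complex.Re `|v| |%:C%C = `| `|u| - `|v| | :> C.
      transitivity (`|(complex.Re `|u|)%:C%C - (complex.Re `|v|)%:C%C| : C); last by rewrite -!nr.
      rewrite -rmorphB normc_def /=.
      by rewrite expr0n addr0 sqrtr_sqr.
    by rewrite (le_trans (ler_dist_dist _ _))// ltW.
  rewrite [LHS]nr [RHS]nr; congr (_%:C%C).
  apply/eqP; rewrite -subr_eq0 -normr_eq0 eq_le normr_ge0 andbT.
  apply/ler_addgt0Pl => e e0; rewrite addr0; have e2 : 0 < e / 2 by rewrite divr_gt0.
  have [a [xa Va]] := VP x _ e2.
  rewrite [e]splitr (le_trans (ler_distD (complex.Re `|g a|) _ _))// lerD//.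
    exact: near.
  by rewrite distrC -fgN; exact: near.
split=> // [x y|y]; first exact: isometry_inner.
have gf_dist a b : `|g a - g b| = `|f a - f b| by rewrite fg_dist.
have [x xy] := matched_exists gf_dist gdense y.
by exists x; apply: VU; exact: matched_sym.
Qed.

End IsometryUnitary.

Section TripleUnitary.
Variables (R : realType) (n : nat).
Local Notation C := R[i].
Local Notation Pol := (Pol C n).
Local Notation eps := (counit C n).

Lemma triple_inner (H : hilbertType C) (rho : Pol -> H -> H) eta (L : {linear Pol -> C^o}) a b :
  schurmann_triple rho eta L -> inner (eta a) (eta b) =
  (L (star a * b) : C) - (eps (star a) : C) * L b - (L (star a) : C) * eps b.
Proof. by move=> t; rewrite (st_coboundary t); ring. Qed.

(** L determines the inner products of the vectors eta a, so that eta a |-> eta' a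
extends to a unitary. It intertwines the representations on the range of eta,
where rho a is expressed through eta by the cocycle identity, and hence
everywhere by continuity. *)
Lemma triple_unitary (H H' : hilbertType C) (rho : Pol -> H -> H) (eta : Pol -> H)
   (rho' : Pol -> H' -> H') (eta' : Pol -> H') (L L' : {linear Pol -> C^o}) :
  schurmann_triple rho eta L -> schurmann_triple rho' eta' L' -> L =1 L' ->
  dense (range eta) -> dense (range eta') ->
  exists V : H -> H', [/\ unitary V, forall a x, V (rho a x) = rho' a (V x)
    & forall a, V (eta a) = eta' a].
Proof.
move=> t t' LL' d d'.
have ip a b : inner (eta a) (eta b) = inner (eta' a) (eta' b).
  by rewrite (triple_inner _ _ t) (triple_inner _ _ t') !LL'.
have [leta _] := st_cocycle t; have [leta' _] := st_cocycle t'.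
have [V [uV match_all VP]] := unitary_extension leta leta' ip d d'.
exists V; split=> // [a x|a]; last exact/VP/matched_base.
have shift (K : hilbertType C) (r : Pol -> K -> K) (e : Pol -> K) :
    cocycle r e -> forall b, r a (e b) = e (a * b - (eps b : C) *: a).
  move=> ce b; rewrite -scaleN1r addrC (proj1 ce) scaleN1r (cocM ce) (cocZ ce).
  by rewrite addrC addrK.
apply: VP; apply: (@matched_continuous _ _ _ _ eta eta' (rho a) (rho' a)
  (fun b => a * b - (eps b : C) *: a)).
- exact: (rho_bounded (st_rep t)).
- exact: (rho_bounded (st_rep t')).
- exact: shift (st_cocycle t).
- exact: shift (st_cocycle t').
- exact: match_all.
Qed.

End TripleUnitary.

(** * The correspondence *)

Section Assembly.
Variables (R : realType) (n : nat).
Local Notation C := R[i].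
Local Notation Pol := (Pol C n).
Local Notation eps := (counit C n).

Lemma cocycle_exists_unique (T : rep_tuple R n) : tuple_relations T ->
  exists! eta : Pol -> rt_space T, associated_cocycle T eta.
Proof.
move=> [xi_diag xi_eq].
have [eta [L [t etaxi]]] := schurmann_triple_exists (rt_rep T) xi_diag xi_eq.
exists eta; split=> [|eta' [ceta' eta'xi]]; first by split=> //; exact: st_cocycle t.
apply/funext; apply: (cocycle_unique (rt_rep T) (st_cocycle t) ceta') => i.
by rewrite etaxi eta'xi.
Qed.

(** The two expressions for eta (p_ij) that come from p_ij p_ii = 0 and from
p_ij p_jj = 0 must agree. *)
Lemma cocycle_relations (H : hilbertType C) (rho : Pol -> H -> H) (eta : Pol -> H) :
  cocycle rho eta -> forall rep : representation rho,
  tuple_relations (RepTuple (fun i => eta (pgen C i i)) rep).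
Proof.
move=> ceta rep; split=> [i|i j] /=; first exact: (coc_diag ceta).
have [->//|ij] := eqVneq i j.
by apply: oppr_inj; rewrite -(coc_offdiagl ceta ij) -(coc_offdiagr ceta ij).
Qed.

Lemma generator_determines (X Y : levy_process R n) (L : Pol -> C^o) :
  generating_functional X L -> generating_functional Y L -> levy_equiv X Y.
Proof.
move=> gX gY t t0 a.
exact: (conv_semigroup_unique (levy_conv_semigroup X) (levy_conv_semigroup Y) gX gY t0).
Qed.

Lemma generator_equiv (X Y : levy_process R n) (L : Pol -> C^o) :
  levy_equiv X Y -> generating_functional X L -> generating_functional Y L.
Proof.
move=> XY gX a; apply: cvg_trans (gX a); apply: near_eq_cvg; near=> t.
by rewrite XY//; near: t; exact: nbhs_right_ge.
Unshelve. all: by end_near. Qed.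

Lemma generator_unique (X : levy_process R n) (L L' : Pol -> C^o) :
  generating_functional X L -> generating_functional X L' -> L =1 L'.
Proof. by move=> gL gL' a; exact: (cvgC_unique _ (gL a) (gL' a)). Qed.

(** Two functionals with the same coboundary differ by an eps-derivation. *)
Lemma cocycle_determines (H H' : hilbertType C) (rho : Pol -> H -> H) (eta : Pol -> H)
   (rho' : Pol -> H' -> H') (eta' : Pol -> H') (L L' : {linear Pol -> C^o}) :
  schurmann_triple rho eta L -> schurmann_triple rho' eta' L' ->
  (forall a b, inner (eta a) (eta b) = inner (eta' a) (eta' b)) -> L =1 L'.
Proof.
move=> t t' ip a; apply/eqP; rewrite -subr_eq0; apply/eqP.
pose D a : C := (L a : C) - L' a; rewrite -[LHS]/(D a).
apply: eps_derivation0 => [c b d|b d]; rewrite /D.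
  have -> : (L (c *: b + d) : C) = c * L b + L d by rewrite linearP.
  have -> : (L' (c *: b + d) : C) = c * L' b + L' d by rewrite linearP.
  by ring.
have LM (K : hilbertType C) r e (l : {linear Pol -> C^o}) : schurmann_triple (H := K) r e l ->
    (l (b * d) : C) = inner (e (star b)) (e d) + (eps b : C) * l d + (l b : C) * eps d.
  by move=> tl; have := st_coboundary tl (star b) d; rewrite starK.
by rewrite (LM _ _ _ _ t) (LM _ _ _ _ t') ip; ring.
Qed.

(** Every cocycle on S_n^+ comes with a generating functional, since it is the
one constructed from its own tuple. *)
Lemma cocycle_triple (H : hilbertType C) (rho : Pol -> H -> H) (eta : Pol -> H) :
  representation rho -> cocycle rho eta ->
  exists L : {linear Pol -> C^o}, schurmann_triple rho eta L.
Proof.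
move=> rep ceta; have [xi_diag xi_eq] := cocycle_relations ceta rep.
have [eta' [L [t etaxi]]] := schurmann_triple_exists rep xi_diag xi_eq.
have <- : eta' = eta by apply/funext; apply: (cocycle_unique rep (st_cocycle t) ceta).
by exists L.
Qed.

Lemma unitary_id (H : hilbertType C) : unitary (@id H).
Proof. by split=> // y; exists y. Qed.

Lemma unitary_comp (H H' H'' : hilbertType C) (V : H -> H') (W : H' -> H'') :
  unitary V -> unitary W -> unitary (W \o V).
Proof.
move=> [lV iV sV] [lW iW sW]; split=> [c x y|x y|z] /=.
- by rewrite lV lW.
- by rewrite iW iV.
- by have [y <-] := sW z; have [x <-] := sV y; exists x.
Qed.

Lemma unitary_inv (H H' : hilbertType C) (V : H -> H') : unitary V ->
  exists W : H' -> H, [/\ unitary W, cancel V W & cancel W V].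
Proof.
move=> [lV iV sV].
have injV : injective V.
  move=> x y Vxy; apply/eqP; rewrite -subr_eq0 -normr_eq0 -sqrf_eq0 hdot_norm.
  have VB : V (x - y) = 0 by rewrite -scaleN1r addrC lV scaleN1r Vxy addNr.
  by rewrite -[hdot _ _]/(inner (x - y) (x - y)) -iV VB /inner linear0l.
pose W y := projT1 (cid (sV y)).
have WK : cancel W V by move=> y; rewrite /W; case: cid.
have VK : cancel V W by move=> x; apply: injV; rewrite WK.
exists W; split=> //; split=> [c x y|x y|x].
- by apply: injV; rewrite lV !WK.
- by rewrite -iV !WK.
- by exists (V x).
Qed.

Lemma tuple_equiv_refl (T : rep_tuple R n) : tuple_equiv T T.
Proof. by exists id; split=> //; exact: unitary_id. Qed.

Lemma tuple_equiv_sym (T T' : rep_tuple R n) : tuple_equiv T T' -> tuple_equiv T' T.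
Proof.
move=> [V [uV VT Vxi]]; have [W [uW VK WK]] := unitary_inv uV.
exists W; split=> // [a x|i]; last by rewrite Vxi VK.
have -> : rt_rho T' a x = V (rt_rho T a (W x)) by rewrite VT WK.
by rewrite VK.
Qed.

Lemma tuple_equiv_trans (T T' T'' : rep_tuple R n) :
  tuple_equiv T T' -> tuple_equiv T' T'' -> tuple_equiv T T''.
Proof.
move=> [V [uV VT Vxi]] [W [uW WT Wxi]]; exists (W \o V); split=> [|a x|i] /=.
- exact: unitary_comp.
- by rewrite VT WT.
- by rewrite Wxi Vxi.
Qed.

Lemma tuple_equiv_eq (T T' : rep_tuple R n) :
  tuple_equiv T T' -> tuple_equiv T = tuple_equiv T'.
Proof.
move=> TT'; apply/funext => S; apply/propext; split=> [TS|]; last exact: tuple_equiv_trans.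
by apply: tuple_equiv_trans TS; apply: tuple_equiv_sym.
Qed.

Lemma unitary_representation (H H' : hilbertType C) (rho : Pol -> H -> H) (eta : Pol -> H) 
  (rho' : Pol -> H' -> H') (V : H -> H') :
  unitary V -> (forall a x, V (rho a x) = rho' a (V x)) ->
  cocycle rho eta -> cocycle rho' (V \o eta).
Proof.
move=> [lV _ _] VT [leta eta_mul]; split=> [c a b|a b] /=.
  by rewrite leta lV.
by rewrite eta_mul addrC lV VT addrC.
Qed.

(** Equivalent processes have the same L, hence unitarily equivalent triples.
Conversely a unitary that matches the tuples matches the cocycles, which are
determined by the tuples; the cocycle determines L, and L the process. *)
Lemma triple_of_equiv (X Y : levy_process R n) (H H' : hilbertType C)
    (rho : Pol -> H -> H) (eta : Pol -> H) (L : {linear Pol -> C^o})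
    (rho' : Pol -> H' -> H') (eta' : Pol -> H') (L' : {linear Pol -> C^o})
    (hX : schurmann_triple_of X rho eta L) (hY : schurmann_triple_of Y rho' eta' L') :
  levy_equiv X Y <->
  tuple_equiv (RepTuple (fun i => eta (pgen C i i)) (schurmann_triple_rep hX))
              (RepTuple (fun i => eta' (pgen C i i)) (schurmann_triple_rep hY)).
Proof.
have [tX gX dX] := hX; have [tY gY dY] := hY; split=> [XY|[V /= [uV VT Vxi]]].
  have LL' : L =1 L' by apply: generator_unique gY; apply: generator_equiv gX.
  have [V [uV VT Veta]] := triple_unitary tX tY LL' dX dY.
  by exists V; split=> // i /=; rewrite Veta.
have etaE : V \o eta =1 eta'.
  pose T' := RepTuple (fun i => eta' (pgen C i i)) (schurmann_triple_rep hY).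
  have [e [_ eU]] : exists! eta : Pol -> rt_space T', associated_cocycle T' eta.
    by apply: cocycle_exists_unique; apply: cocycle_relations; case: tY.
  have <- : e = V \o eta.
    apply: eU; split=> [|i]; last by rewrite /= Vxi.
    by apply: (unitary_representation uV VT); case: tX.
  by move=> a; congr (_ a); apply: eU; split=> //; case: tY.
have LL' : L =1 L'.
  apply: (cocycle_determines tX tY) => a b; rewrite -!etaE.
  by case: uV => _ ->.
apply: (generator_determines gX).
by have -> : (L : Pol -> C^o) = L' by exact/funext.
Qed.

(** The class attached to a process, as a predicate, so that no choice of a
triple is made: triples live on arbitrary Hilbert spaces. *)
Definition tuple_of (X : levy_process R n) (T : rep_tuple R n) : Prop :=
  exists (H : hilbertType C) (rho : Pol -> H -> H) (eta : Pol -> H)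
    (L : {linear Pol -> C^o}) (h : schurmann_triple_of X rho eta L),
  tuple_equiv (RepTuple (fun i => eta (pgen C i i)) (schurmann_triple_rep h)) T.

Lemma tuple_ofE (X : levy_process R n) (H : hilbertType C) (rho : Pol -> H -> H)
    (eta : Pol -> H) (L : {linear Pol -> C^o}) (h : schurmann_triple_of X rho eta L) :
  tuple_of X =
  tuple_equiv (RepTuple (fun i => eta (pgen C i i)) (schurmann_triple_rep h)).
Proof.
apply/funext => T; apply/propext; split=> [[H' [rho' [eta' [L' [h' T'T]]]]]|TT].
  by apply: tuple_equiv_trans T'T; apply/triple_of_equiv.
by exists H, rho, eta, L, h.
Qed.

Lemma tuple_of_admissible (X : levy_process R n) :
  exists2 T, admissible T & tuple_of X = tuple_equiv T.
Proof.
have [H [rho [eta [L h]]]] := levy_triple X.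
exists (RepTuple (fun i => eta (pgen C i i)) (schurmann_triple_rep h)); last exact: tuple_ofE.
have [t _ d] := h; split; first by apply: cocycle_relations; case: t.
by exists eta; split=> //; split=> //; case: t.
Qed.

Lemma levy_of_admissible (T : rep_tuple R n) : admissible T ->
  exists X, tuple_of X = tuple_equiv T.
Proof.
move=> [_ [eta [[ceta etaxi] d]]].
have [L t] := cocycle_triple (rt_rep T) ceta.
have [X g] := schoenberg t.
have h : schurmann_triple_of X (@rt_rho _ _ T) eta L by split.
exists X; rewrite (tuple_ofE h); apply: tuple_equiv_eq.
by exists id; split=> [||i] //; [exact: unitary_id|rewrite -etaxi].
Qed.

Lemma tuple_of_levy_equiv (X Y : levy_process R n) :
  tuple_of X = tuple_of Y <-> levy_equiv X Y.
Proof.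
have [H [rho [eta [L hX]]]] := levy_triple X.
have [H' [rho' [eta' [L' hY]]]] := levy_triple Y.
rewrite (tuple_ofE hX) (tuple_ofE hY) (triple_of_equiv hX hY); split=> [->|].
  exact: tuple_equiv_refl.
exact: tuple_equiv_eq.
Qed.

Definition class_map_fun (c : levy_class R n) (T : rep_tuple R n) : Prop :=
  exists2 X, sval c X & tuple_of X T.

Lemma class_map_funE (c : levy_class R n) X : sval c = levy_equiv X ->
  class_map_fun c = tuple_of X.
Proof.
move=> cE; apply/funext => T; apply/propext; split=> [[Y]|XT].
  by rewrite cE => /tuple_of_levy_equiv ->.
by exists X => //; rewrite cE.
Qed.

Lemma class_map_subproof (c : levy_class R n) :
  exists2 T, admissible T & class_map_fun c = tuple_equiv T.
Proof.
have [X cE] := svalP c; rewrite (class_map_funE cE); exact: tuple_of_admissible.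
Qed.

Definition class_map (c : levy_class R n) : tuple_class R n :=
  exist _ (class_map_fun c) (class_map_subproof c).

Definition class_inv_fun (d : tuple_class R n) (X : levy_process R n) : Prop :=
  tuple_of X = sval d.

Lemma class_inv_subproof (d : tuple_class R n) :
  exists X, class_inv_fun d = levy_equiv X.
Proof.
have [T aT dE] := svalP d; have [X XT] := levy_of_admissible aT; exists X.
apply/funext => Y; apply/propext; rewrite /class_inv_fun dE -XT; split.
  by move=> /esym/tuple_of_levy_equiv.
by move=> /tuple_of_levy_equiv ->.
Qed.

Definition class_inv (d : tuple_class R n) : levy_class R n :=
  exist _ (class_inv_fun d) (class_inv_subproof d).

Lemma class_map_bij : bijective class_map.
Proof.
exists class_inv => [c|d]; apply: eq_sig_hprop => /=; try by move=> ? ? ?; apply: Prop_irrelevance.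
  have [X cE] := svalP c; rewrite /class_inv_fun /= (class_map_funE cE) cE.
  apply/funext => Y; apply/propext; split=> [/esym/tuple_of_levy_equiv//|].
  by move=> /tuple_of_levy_equiv ->.
have [X dE] := class_inv_subproof d.
rewrite (@class_map_funE _ X)//.
by have : levy_equiv X X by []; rewrite -[X in X -> _]/(levy_equiv X X) -dE.
Qed.

End Assembly.

Theorem corollary8p6 (R : realType) (n : nat) (hn : (1 <= n)%N) :
  (forall T : rep_tuple R n, tuple_relations T ->
     exists! eta : Pol R[i] n -> rt_space T, associated_cocycle T eta) /\
  (forall X : levy_process R n,
     exists (H : hilbertType R[i]) (rho : Pol R[i] n -> H -> H)
       (eta : Pol R[i] n -> H) (L : {linear Pol R[i] n -> R[i]^o}),
       schurmann_triple_of X rho eta L) /\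
  exists Psi : levy_class R n -> tuple_class R n,
    bijective Psi /\
    forall (X : levy_process R n) (H : hilbertType R[i])
      (rho : Pol R[i] n -> H -> H) (eta : Pol R[i] n -> H)
      (L : {linear Pol R[i] n -> R[i]^o})
      (hst : schurmann_triple_of X rho eta L),
      sval (Psi (class_of_levy X)) =
      tuple_equiv (RepTuple (fun i => eta (pgen R[i] i i))
                            (schurmann_triple_rep hst)).
Proof.
split; first exact: cocycle_exists_unique.
split; first exact: levy_triple.
exists (@class_map R n); split; first exact: class_map_bij.
by move=> X H rho eta L h; rewrite /= (@class_map_funE _ _ _ X)// (tuple_ofE h).
Qed.
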